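(* Let $\{(X_i,Y_i)\}_{i\ge1}$ be a sequence of i.i.d. random vectors whose generic vector $(X,Y)$ follows a bivariate Sarmanov distribution with marginals $F$ (of $X$) and $G$ (of $Y$), kernels $\phi_1,\phi_2$ and parameter $\theta$, satisfying $\lim_{x\to\infty}\phi_1(x)=d_1$ for some $d_1\in\mathbb{R}$. Assume $F\in\mathcal{D}$ and $\overline{G}(x)=o(\overline{F}(x))$ as $x\to\infty$. With $\overline{H}(x)=P[XY>x]$ and, for $v>0$, $\widetilde{H}(v)=\sup_{x>0}\frac{\overline{H}(x/v)}{\overline{H}(x)}$, assume that $\int_0^\infty\widetilde{H}(v)\,G(dv)<\infty$. Suppose $X$ is nonnegative and, for some $\alpha>0$ and some fixed integer $n\ge1$, $S_n\in RV_{-\alpha}$, where $S_n=\sum_{i=1}^nX_i\prod_{j=1}^iY_j$. Assume that $E[Y^{\alpha+\epsilon}]<\infty$ for some $\epsilon>0$, and that for all $\beta\in\mathbb{R}$ $$E[Y^{\alpha+i\beta}]+\theta d_1E[\phi_2(Y)Y^{\alpha+i\beta}]\neq0\qquad\text{and}\qquad\sum_{k=0}^{n-1}\left\{E[Y^{\alpha+i\beta}]\right\}^k\neq0.$$ Then each $X_i\in RV_{-\alpha}$ and $$P[S_n>x]\sim\frac{\left(1-(E[Y^\alpha])^n\right)\left(E[Y^\alpha]+\theta d_1E[\phi_2(Y)Y^\alpha]\right)}{1-E[Y^\alpha]}\,\overline{F}(x)\quad\text{as }x\to\infty,$$ where $\frac{1-(E[Y^\alpha])^n}{1-E[Y^\alpha]}$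 is read as $n$ if $E[Y^\alpha]=1$.
   Context: Notation: for a distribution function $F$, $\overline{F}(x)=1-F(x)$. For positive functions, $a(x)\sim b(x)$ as $x\to\infty$ means $\lim_{x\to\infty}a(x)/b(x)=1$. Bivariate Sarmanov distribution: $(X,Y)$ follows a bivariate Sarmanov distribution with marginals $F$ (of $X$) and $G$ (of $Y$), kernels $\phi_1,\phi_2$ and parameter $\theta$ if $$P(X\in dx,Y\in dy)=(1+\theta\phi_1(x)\phi_2(y))F(dx)G(dy),\quad x\in\mathbb{R},\ y\ge 0,$$ where $\phi_1,\phi_2$ are real valued functions and $\theta$ is a real constant satisfying $E\{\phi_1(X)\}=E\{\phi_2(Y)\}=0$ and $1+\theta\phi_1(x)\phi_2(y)\ge 0$ for all $x\in D_X$, $y\in D_Y$; here $D_X\subset\mathbb{R}$ and $D_Y\subset\mathbb{R}^+$ are the supports of $X$ and $Y$. Regular variation: a random variable $X$ with tail $\overline F(x)=P[X>x]$ has a regularly varying tail of index $-\alpha$, $\alpha>0$, written $X\in RV_{-\alpha}$, if for all $y>0$, $\overline{F}(xy)\sim y^{-\alpha}\overline{F}(x)$ as $x\to\infty$. Dominatedly-tail-varying class: $F\in\mathcal{D}$ if for all $0<y<1$, $\limsup_{x\to\infty}\overline{F}(xy)/\overline{F}(x)<\infty$. *)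

(* Defs.v *)
From HB Require Import structures.
From mathcomp Require Import all_boot all_order all_algebra.
From mathcomp Require Import finmap complex.
From mathcomp Require Import all_classical all_reals all_analysis measurable_realfun.

Set Implicit Arguments.
Unset Strict Implicit.
Unset Printing Implicit Defensive.

Import Order.TTheory GRing.Theory Num.Theory.
Import numFieldNormedType.Exports.

Local Open Scope classical_set_scope.
Local Open Scope ring_scope.

(* For positive functions: if [b] vanishes arbitrarily far out, the ratio is
   [0] there, so the limit cannot be [1]. *)
Definition asymp_equiv (R : realType) (a b : R -> R) : Prop :=
  (fun x => a x / b x) @ +oo --> (1 : R).

Section tails.
Context d (T : measurableType d) (R : realType) (P : probability T R).
Implicit Types X Y : {mfun T >-> R}.

(* The real number P[X > x]. *)
Definition tail X (x : R) : R := fine (ccdf (X : {RV P >-> R}) x).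

Definition regularly_varying (alpha : R) X : Prop :=
  forall y : R, 0 < y ->
    asymp_equiv (fun x => tail X (x * y)) (fun x => y `^ (- alpha) * tail X x).

(* Positivity of the tail is what gives the ratios a meaning: without it,
   [x / 0 = 0] would put every bounded distribution in the class. *)
Definition dominatedly_varying X : Prop :=
  (forall x, 0 < tail X x) /\
  forall y : R, 0 < y < 1 ->
    (limf_esup (fun x : R => (tail X (x * y) / tail X x)%:E) +oo%R < +oo)%E.

Definition tail_ratio_sup X (v : R) : \bar R :=
  ereal_sup [set (tail X (x / v) / tail X x)%:E | x in `]0, +oo[].

End tails.

Definition support (R : realType) (mu : set R -> \bar R) : set R :=
  [set x | forall U : set R, open U -> U x -> (0 < mu U)%E].

Section random_vectors.
Context d (T : measurableType d) (R : realType) (P : probability T R).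

Definition rvpair (X Y : {mfun T >-> R}) (w : T) : R * R := (X w, Y w).

(* The marginals are the laws [distribution P X] and [distribution P Y]. *)
Definition sarmanov (X Y : {mfun T >-> R}) (phi1 phi2 : R -> R) (theta : R)
    : Prop :=
  [/\ measurable_fun [set: R] phi1 /\ measurable_fun [set: R] phi2,
      {ae P, forall w, 0 <= Y w},
      (P.-integrable [set: T] (EFin \o (phi1 \o X)) /\ 'E_P[phi1 \o X]%E = 0%E) /\
      (P.-integrable [set: T] (EFin \o (phi2 \o Y)) /\ 'E_P[phi2 \o Y]%E = 0%E),
      forall x y, support (distribution P X) x -> support (distribution P Y) y ->
        0 <= 1 + theta * phi1 x * phi2 y
    & forall A : set (R * R), measurable A ->
        P (rvpair X Y @^-1` A) =
        (\int[(distribution P X \x distribution P Y)%E]_(z in A)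
           (1 + theta * phi1 z.1 * phi2 z.2)%:E)%E].

Definition mutually_independent (Z : nat -> T -> R * R) : Prop :=
  forall (J : {fset nat}) (A : nat -> set (R * R)),
    (forall i, measurable (A i)) ->
    P (\bigcap_(i in [set` J]) (Z i @^-1` A i)) =
    (\prod_(i <- J) P (Z i @^-1` A i))%E.

Definition same_law (Z Z' : T -> R * R) : Prop :=
  forall A, measurable A -> P (Z @^-1` A) = P (Z' @^-1` A).

(* With indices starting at [0], this is X_1 Y_1 + ... + X_n Y_1 ... Y_n. *)
Definition weighted_sum (X Y : nat -> {mfun T >-> R}) (n : nat)
    : {mfun T >-> R} :=
  \sum_(i < n) X i * \prod_(j < i.+1) Y j.

End random_vectors.

Section moments.
Context d (T : measurableType d) (R : realType) (P : probability T R).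

(* [y ^ s] for real [y >= 0]; it is [0] at [y = 0] when ['Re s] is positive. *)
Definition cpow (y : R) (s : R[i]) : R[i] :=
  Complex (y `^ complex.Re s * cos (complex.Im s * ln y))
          (y `^ complex.Re s * sin (complex.Im s * ln y)).

Definition cexpectation (Z : T -> R[i]) : R[i] :=
  Complex (fine 'E_P[(fun w => complex.Re (Z w))%R]%E)
          (fine 'E_P[(fun w => complex.Im (Z w))%R]%E).

End moments.

(* Main.v *)
(** In logarithmic coordinates a relation [\int B (x / v) u v nu(dv) ~ c * M x],
    with [M] regularly varying of index [-alpha] and [B] monotone, is a convolution
    equation for [B / M] with a measure whose Fourier transform is
    [b |-> \int v ^ (alpha + i b) u v nu(dv)]. If the latter has no zero, dividing
    the compactly supported Fourier transform of a Fejer kernel by it gives an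
    integrable kernel, so the Fejer means of [B / M] converge, and then so does
    [B / M], by monotonicity. This is used twice. Since only one summand of
    [S_n] is large, [P (S_n > x)] is equivalent to the sum over [k < n] of
    [E (H (x / (Y_0 ... Y_(k-1))))], where [H] is the tail of [X * Y], and inverting
    this gives the limit of [H / P (S_n > x)]. The Sarmanov law gives
    [H x ~ \int P (X > x / v) (1 + theta d1 phi2 v) G(dv)], and inverting this
    gives the limit of [P (X > x) / P (S_n > x)]. *)

Require Import Defs.
From HB Require Import structures.
From mathcomp Require Import all_boot all_order all_algebra.
From mathcomp Require Import finmap complex.
From mathcomp Require Import all_classical all_reals all_analysis measurable_realfun.
From mathcomp Require Import ring lra.

Set Implicit Arguments.
Unset Strict Implicit.
Unset Printing Implicit Defensive.

Import Order.TTheory GRing.Theory Num.Theory.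
Import numFieldNormedType.Exports.

Local Open Scope classical_set_scope.
Local Open Scope ring_scope.

(** Inverting a Fourier transform usually calls for Wiener's lemma; here smoothness takes its place.
    The moment of order [alpha + eps] absorbs [ln v ^ 2] at infinity and [alpha > 0] does so at [0],
    so the transform of [v ^ alpha * u v * nu(dv)] in [ln v] is twice continuously differentiable.
    The quotient kernel is then an oscillatory integral of C2 functions over a compact interval, and
    two integrations by parts make it decay like [1 / (1 + t ^ 2)].

    Neither [H] nor the tail of [X] is known to vary regularly beforehand, so everything is compared
    with [M], the tail of [S_n]. Both ratios are bounded: [H <= M] on positive reals because the
    first summand of [S_n] is distributed as [X * Y], and the tail of [X] is at most a constant
    times [H] because [F] is dominatedly varying and the limiting density is not degenerate. These
    bounds and the integrable supremum of [H (x / v) / H x] dominate both convolution equations.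

    The kernel [phi2] may be unbounded. Positivity of the Sarmanov density allows a bounded function
    [psi] to replace it. *)

Section shift.
Context {R : realType}.
Let mu := @lebesgue_measure R.
Local Open Scope ereal_scope.

Lemma lebesgue_measure_shift (c : R) (D : set (measurableTypeR R)) :
  measurable D ->
  pushforward mu (fun x : measurableTypeR R => x + c : measurableTypeR R)%R D
  = mu D.
Proof.
move=> mD; pose s (x : measurableTypeR R) : measurableTypeR R := (x + c)%R.
have ms : measurable_fun setT s by exact: measurable_funD.
pose f : {mfun measurableTypeR R >-> measurableTypeR R} :=
  mfun_Sub (mem_set ms : s \in mfun).
apply/esym.
apply: (@lebesgue_measure_unique R (pushforward mu f)) mD => _ [[a b] _ <-] /=.
rewrite /pushforward /=.
have -> : s @^-1` [set` `]a, b]] = [set` `]a - c, b - c]%R].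
  by apply/seteqP; split => x /=; rewrite !in_itv/= ltrBlDr lerBrDr.
rewrite /mu !lebesgue_measure_itv/= !lte_fin ltrD2r.
by case: ifPn => // _; rewrite -!EFinD; congr EFin; ring.
Qed.

Lemma ge0_integral_shift (f : R -> \bar R) (c : R) :
  measurable_fun setT f -> (forall x, 0 <= f x) ->
  \int[mu]_x f (x + c)%R = \int[mu]_x f x.
Proof.
move=> mf f0; pose s (x : measurableTypeR R) : measurableTypeR R := (x + c)%R.
have ms : measurable_fun setT s by exact: measurable_funD.
pose sm : {mfun measurableTypeR R >-> measurableTypeR R} :=
  mfun_Sub (mem_set ms : s \in mfun).
transitivity (\int[pushforward mu sm]_y f y).
  by rewrite ge0_integral_pushforward.
by apply: eq_measure_integral => A mA _; exact: lebesgue_measure_shift.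
Qed.

Lemma integrable_shift (f : R -> \bar R) (c : R) :
  mu.-integrable setT f -> mu.-integrable setT (fun x => f (x + c)%R).
Proof.
move=> /integrableP[mf fi]; apply/integrableP; split.
  by apply: (measurableT_comp mf); exact: measurable_funD.
have mf' : measurable_fun setT (abse \o f) by exact: measurableT_comp.
by have /= -> := ge0_integral_shift c mf' (fun x => abse_ge0 (f x)).
Qed.

Lemma integral_shift (f : R -> \bar R) (c : R) :
  mu.-integrable setT f -> \int[mu]_x f (x + c)%R = \int[mu]_x f x.
Proof.
move=> fi; have mf := measurable_int mu fi.
pose s (x : measurableTypeR R) : measurableTypeR R := (x + c)%R.
have ms : measurable_fun setT s by exact: measurable_funD.
pose sm : {mfun measurableTypeR R >-> measurableTypeR R} :=
  mfun_Sub (mem_set ms : s \in mfun).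
transitivity (\int[pushforward mu sm]_y f y).
  rewrite integral_pushforward//; exact: integrable_shift.
by apply: eq_measure_integral => A mA _; exact: lebesgue_measure_shift.
Qed.

End shift.

(** * Dominated convergence along the reals, and Fubini for real-valued integrals *)

Section dominated_convergence_pinfty.
Context d {S : measurableType d} {R : realType}.
Variable nu : {measure set S -> \bar R}.

Lemma dominated_cvg_pinfty (f : R -> S -> R) (h g : S -> R) (t0 : R) :
  (forall t, measurable_fun setT (f t)) -> measurable_fun setT h ->
  {ae nu, forall s, f t s @[t --> +oo] --> h s} ->
  nu.-integrable setT (EFin \o g) ->
  {ae nu, forall s t, t0 <= t -> `|f t s| <= g s} ->
  (\int[nu]_s f t s) @[t --> +oo] --> \int[nu]_s h s.
Proof.
move=> mf mh fh ig fg; apply/cvg_pinftyP => u uoo.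
(* Clipping the sequence at [t0] makes the domination hold for every index; the two sequences agree
   eventually. *)
pose u' n := Num.max t0 (u n).
have uu' : \forall n \near \oo, u' n = u n.
  move/cvgryPge : uoo => /(_ t0); apply: filterS => n t0u.
  by rewrite /u' (max_idPr _).
have u'oo : u' n @[n --> \oo] --> +oo.
  move: uoo; apply: cvg_trans; apply: near_eq_cvg.
  by apply: filterS uu' => n ->.
have -> : (\int[nu]_s f (u n) s) @[n --> \oo] =
          (\int[nu]_s f (u' n) s) @[n --> \oo].
  by apply/seteqP; split; apply: near_eq_cvg; apply: filterS uu' => n ->.
have [|||||ih _ H] := @dominated_convergence _ _ _ nu setT measurableT
  (fun n s => (f (u' n) s)%:E) (EFin \o h) (EFin \o g).
- by move=> n; exact/measurable_EFinP.
- exact/measurable_EFinP.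
- apply: filterS fh => s + _ /=; move=> /cvg_pinftyP/(_ _ u'oo) H.
  by apply: cvg_EFin H; exact: nearW.
- exact: ig.
- by apply: filterS fg => s H n _; rewrite lee_fin H// /u' le_max lexx.
apply: fine_cvg; rewrite fineK//; exact: integrable_fin_num.
Qed.

End dominated_convergence_pinfty.

Section rfubini.
Context d1 d2 {S1 : measurableType d1} {S2 : measurableType d2} {R : realType}.
Variables (m1 : {sigma_finite_measure set S1 -> \bar R})
  (m2 : {sigma_finite_measure set S2 -> \bar R}).

(** The sections are integrable at every point, not only almost everywhere, because the inner real
    integral is the [fine] of an extended one and [fineK] is applied pointwise under the outer
    integral. *)
Lemma Rintegral_Fubini (f : S1 * S2 -> R) :
  (m1 \x m2)%E.-integrable setT (EFin \o f) ->
  (forall x, m2.-integrable setT (fun y => (f (x, y))%:E)) ->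
  (forall y, m1.-integrable setT (fun x => (f (x, y))%:E)) ->
  \int[m1]_x \int[m2]_y f (x, y) = \int[m2]_y \int[m1]_x f (x, y).
Proof.
move=> fi f1 f2; rewrite /Rintegral.
under eq_integral do rewrite fineK ?integrable_fin_num//.
under [in RHS]eq_integral do rewrite fineK ?integrable_fin_num//.
by rewrite (Fubini fi).
Qed.

Lemma integrable_prod_bound (f : S1 * S2 -> R) (g : S1 -> R) (h : S2 -> R) :
  measurable_fun setT f ->
  m1.-integrable setT (EFin \o g) -> m2.-integrable setT (EFin \o h) ->
  (forall z, `|f z| <= `|g z.1| * `|h z.2|) ->
  (m1 \x m2)%E.-integrable setT (EFin \o f).
Proof.
move=> mf ig ih fgh.
have mg : measurable_fun setT g.
  by apply/measurable_EFinP; exact: measurable_int ig.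
have mh : measurable_fun setT h.
  by apply/measurable_EFinP; exact: measurable_int ih.
apply: (@le_integrable _ _ _ (m1 \x m2)%E _ measurableT _
    (fun z => (`|g z.1| * `|h z.2|)%:E)).
- exact/measurable_EFinP.
- by move=> z _; rewrite lee_fin (ger0_norm (mulr_ge0 _ _)).
have mgh : measurable_fun setT (fun z : S1 * S2 => (`|g z.1| * `|h z.2|)%:E).
  apply/measurable_EFinP/measurable_funM; apply: measurableT_comp => //.
    exact: measurableT_comp.
  exact: measurableT_comp.
apply/integrable12ltyP => //=.
under eq_integral => x _.
  under eq_integral => y _ do rewrite ger0_norm ?mulr_ge0// EFinM.
  rewrite ge0_integralZl//; last first.
    by apply/measurable_EFinP; exact: measurableT_comp.
  over.
rewrite ge0_integralZr//; last 2 first.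
- by apply/measurable_EFinP; exact: measurableT_comp.
- by apply: integral_ge0.
move/integrableP : ig => [_ ig]; move/integrableP : ih => [_ ih].
by apply: lte_mul_pinfty => //; [exact: integral_ge0|rewrite ge0_fin_numE//; exact: integral_ge0].
Qed.

End rfubini.

(** * Twice continuously differentiable functions on the line *)

Section C2.
Context {R : realType}.
Implicit Types f g F : R -> R.
Let mu := @lebesgue_measure R.

(** The derivatives are explicit witnesses, so closure under products and inverses amounts to
    exhibiting formulas. Continuity of [f''] bounds the remainder left by two integrations by
    parts. *)
Definition C2 f := exists f' f'' : R -> R, [/\ forall x : R, is_derive x 1 f (f' x),
  forall x : R, is_derive x 1 f' (f'' x) & continuous f''].

Lemma is_derive_continuous f (f' : R -> R) : (forall x : R, is_derive x 1 f (f' x)) ->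
  continuous f.
Proof.
by move=> df x; apply/differentiable_continuous/derivable1_diffP/ex_derive.
Qed.

Lemma C2_continuous f : C2 f -> continuous f.
Proof. by move=> [f' [f'' [df _ _]]]; exact: is_derive_continuous df. Qed.

Lemma C2M f g : C2 f -> C2 g -> C2 (fun x : R => f x * g x).
Proof.
move=> [f' [f'' [df df' cf]]] [g' [g'' [dg dg' cg]]].
exists (fun x : R => f x * g' x + g x * f' x),
  (fun x : R => (f x * g'' x + g' x * f' x) + (g x * f'' x + f' x * g' x)).
have cf0 := is_derive_continuous df; have cf1 := is_derive_continuous df'.
have cg0 := is_derive_continuous dg; have cg1 := is_derive_continuous dg'.
split=> [x|x|x].
- exact: is_deriveM.
- by apply: is_deriveD; exact: is_deriveM.
- by apply: cvgD; apply: cvgD; apply: cvgM;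
    [exact: cf0|exact: cg|exact: cg1|exact: cf1|
     exact: cg0|exact: cf|exact: cf1|exact: cg1].
Qed.

Lemma C2D f g : C2 f -> C2 g -> C2 (fun x : R => f x + g x).
Proof.
move=> [f' [f'' [df df' cf]]] [g' [g'' [dg dg' cg]]].
exists (fun x : R => f' x + g' x), (fun x : R => f'' x + g'' x).
split=> [x|x|x]; [exact: is_deriveD|exact: is_deriveD|].
by apply: cvgD; [exact: cf|exact: cg].
Qed.

Lemma C2V f : (forall x, f x != 0) -> C2 f -> C2 (fun x : R => (f x)^-1).
Proof.
move=> f0 [f' [f'' [df df' cf]]].
have dV (x : R) : is_derive x 1 (fun x : R => (f x)^-1) (- f x ^- 2 *: f' x).
  by apply: is_deriveV; exact: f0.
have cf0 := is_derive_continuous df; have cf1 := is_derive_continuous df'.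
pose h x := (f x)^-1.
have ch := is_derive_continuous dV.
exists (fun x : R => - (h x * h x * f' x)),
  (fun x : R => - ((h x * h x) * f'' x +
     f' x * (h x * (- (h x * h x * f' x)) + h x * (- (h x * h x * f' x))))).
have dh (x : R) : is_derive x 1 h (- (h x * h x * f' x)).
  rewrite (_ : - _ = - f x ^- 2 *: f' x); first exact: dV.
  by rewrite /h expr2 invfM scaleNr.
split=> [x|x|x]; first exact: dh.
- by apply: is_deriveN; apply: is_deriveM; exact: is_deriveM.
- have cn : (fun x : R => - (h x * h x * f' x)) @ x --> - (h x * h x * f' x).
    by apply: cvgN; apply: cvgM; [apply: cvgM; exact: ch|exact: cf1].
  by apply: cvgN; apply: cvgD; apply: cvgM;
    [apply: cvgM; exact: ch|exact: cf|exact: cf1|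
     apply: cvgD; apply: cvgM => //; exact: ch].
Qed.

Lemma C2N f : C2 f -> C2 (fun x : R => - f x).
Proof.
move=> [f' [f'' [df df' cf]]].
exists (fun x : R => - f' x), (fun x : R => - f'' x).
by split=> [x|x|x]; [exact: is_deriveN|exact: is_deriveN|apply: cvgN; exact: cf].
Qed.

Lemma C2_affine (c e : R) : C2 (fun x : R => c + e * x).
Proof.
exists (fun=> e), (fun=> 0); split=> [x|x|x]; last exact: cvg_cst.
- by apply: is_derive_eq; rewrite ?add0r /GRing.scale /= mulr1 mul1r.
- by apply: is_derive_eq.
Qed.

Lemma within_continuous_itv f (a b : R) : continuous f ->
  {within `[a, b], continuous f}.
Proof. exact: continuous_subspaceT. Qed.

Lemma continuous_integrable_itv f (a b : R) : continuous f ->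
  mu.-integrable `[a, b] (EFin \o f).
Proof.
move=> cf; apply: continuous_compact_integrable; first exact: segment_compact.
exact: within_continuous_itv.
Qed.

Lemma Rintegral_is_derive F f (a b : R) : a < b ->
  (forall x : R, is_derive x 1 F (f x)) -> continuous f ->
  \int[mu]_(x in `[a, b]) f x = F b - F a.
Proof.
move=> ab dF cf; have cF := is_derive_continuous dF.
rewrite /Rintegral (@continuous_FTC2 _ _ F)//.
- exact: within_continuous_itv.
- split => [x _| |]; first exact: ex_derive.
  + by apply: cvg_at_right_filter; exact: cF.
  + by apply: cvg_at_left_filter; exact: cF.
- by move=> x _; rewrite derive1E; exact: derive_val.
Qed.

Lemma le_Rintegral_itv f (lam C : R) : 0 < lam -> continuous f ->
  (forall x, 0 <= x <= lam -> `|f x| <= C) ->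
  `|\int[mu]_(x in `[0, lam]) f x| <= C * lam.
Proof.
move=> l0 cf fC.
apply: le_trans; first by apply: le_normr_Rintegral => //; exact: continuous_integrable_itv.
have -> : C * lam = \int[mu]_(x in `[0, lam]) C.
  by rewrite Rintegral_cst//= lebesgue_measure_itv/= lte_fin l0 sube0.
apply: le_Rintegral => //.
- by apply: continuous_integrable_itv => x; apply: cvg_norm; exact: cf.
- by apply: continuous_integrable_itv => x; exact: cvg_cst.
Qed.

Lemma continuous_bounded_itv f (a b : R) : a <= b -> continuous f ->
  exists2 C : R, 0 <= C & forall x, a <= x <= b -> `|f x| <= C.
Proof.
move=> ab cf; have [c cab H] : exists2 c, c \in `[a, b]%R &
    forall t, t \in `[a, b]%R -> `|f t| <= `|f c|.
  apply: (@EVT_max _ (fun x : R => `|f x|)) => //.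
  by apply: within_continuous_itv => x; apply: cvg_norm; exact: cf.
by exists `|f c| => // x xab; apply: H; rewrite in_itv.
Qed.

End C2.

(** * Decay of oscillatory integrals over a compact interval *)

Section oscillatory.
Context {R : realType}.
Implicit Types p q : R -> R.
Let mu := @lebesgue_measure R.
Variable (lam : R) (p q : R -> R).
Hypotheses (lam0 : 0 < lam) (Cp : C2 p) (Cq : C2 q)
  (plam : p lam = 0) (qlam : q lam = 0) (q0 : q 0 = 0).

Definition osc (t : R) :=
  \int[mu]_(x in `[0, lam]) (p x * cos (x * t) + q x * sin (x * t)).

Lemma continuous_cosM (t : R) : continuous (fun x : R => cos (x * t)).
Proof.
move=> x; apply: (@continuous_comp _ _ _ (fun x : R => x * t) cos).
  exact: mulrr_continuous.
exact: continuous_cos.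
Qed.

Lemma continuous_sinM (t : R) : continuous (fun x : R => sin (x * t)).
Proof.
move=> x; apply: (@continuous_comp _ _ _ (fun x : R => x * t) sin).
  exact: mulrr_continuous.
exact: continuous_sin.
Qed.

Lemma continuous_osc (f g : R -> R) (t : R) : continuous f -> continuous g ->
  continuous (fun x : R => f x * cos (x * t) + g x * sin (x * t)).
Proof.
move=> cf cg x; apply: cvgD; apply: cvgM; [exact: cf|exact: continuous_cosM|
  exact: cg|exact: continuous_sinM].
Qed.

Lemma osc_le (C D t y z : R) : `|y| <= C -> `|z| <= D ->
  `|y * cos t + z * sin t| <= C + D.
Proof.
move=> yC zD; apply: le_trans (ler_normD _ _) _; rewrite !normrM lerD//.
- apply: le_trans yC; rewrite -[leRHS]mulr1 ler_wpM2l//.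
  by rewrite ler_norml cos_geN1 cos_le1.
- apply: le_trans zD; rewrite -[leRHS]mulr1 ler_wpM2l//.
  by rewrite ler_norml sin_geN1 sin_le1.
Qed.

(* Two integrations by parts; the boundary terms of order [1 / t] vanish because
   [p lam = q lam = q 0 = 0]. *)
Lemma osc_decay : exists2 C : R, 0 <= C & forall t, `|osc t| <= C / oneDsqr t.
Proof.
move: (Cp) (Cq) => [p' [p'' [dp dp' cp'']]] [q' [q'' [dq dq' cq'']]].
have cp := C2_continuous Cp; have cq := C2_continuous Cq.
have [A A0 HA] := continuous_bounded_itv (ltW lam0) cp.
have [B B0 HB] := continuous_bounded_itv (ltW lam0) cq.
have [A2 A20 HA2] := continuous_bounded_itv (ltW lam0) cp''.
have [B2 B20 HB2] := continuous_bounded_itv (ltW lam0) cq''.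
have b0 t : `|osc t| <= (A + B) * lam.
  apply: le_Rintegral_itv => //; first exact: continuous_osc.
  by move=> x x0l; apply: osc_le; [exact: HA|exact: HB].
pose D := `|p' lam| + `|q' lam| + `|p' 0| + `|q' 0| + (A2 + B2) * lam.
have b2 t : t ^+ 2 * `|osc t| <= D.
  have [->|t0] := eqVneq t 0.
    by rewrite expr0n mul0r /D !addr_ge0// mulr_ge0// ?addr_ge0// ltW.
  (* [Phi] collects the boundary terms of the two integrations by parts: its derivative is the
     integrand plus [t ^- 2] times the same expression built on [p''] and [q'']. *)
  pose Phi x := p x * (sin (x * t) * t^-1) + p' x * (cos (x * t) * t^-1 ^+ 2)
    - q x * (cos (x * t) * t^-1) + q' x * (sin (x * t) * t^-1 ^+ 2).
  pose phi x := p'' x * cos (x * t) + q'' x * sin (x * t).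
  have dPhi (x : R) : is_derive x 1 Phi (p x * cos (x * t) + q x * sin (x * t) +
      t^-1 ^+ 2 * phi x).
    have dxt : is_derive x 1 (fun x : R => x * t) t.
      by apply: is_derive_eq; rewrite /GRing.scale /=; ring.
    have dS : is_derive x 1 (fun x : R => sin (x * t)) (cos (x * t) * t).
      exact: (@is_derive1_comp _ sin (fun x : R => x * t) x _ _ (is_derive_sin _) dxt).
    have dC : is_derive x 1 (fun x : R => cos (x * t)) (- sin (x * t) * t).
      exact: (@is_derive1_comp _ cos (fun x : R => x * t) x _ _ (is_derive_cos _) dxt).
    rewrite /Phi; apply: is_derive_eq.
    rewrite /phi !scaler0 ?addr0 ?add0r /GRing.scale /=; field.
    exact: t0.
  have I1 := @continuous_osc p q t cp cq.
  have I2 := @continuous_osc p'' q'' t cp'' cq''.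
  have : \int[mu]_(x in `[0, lam]) (p x * cos (x * t) + q x * sin (x * t) +
      t^-1 ^+ 2 * phi x) = Phi lam - Phi 0.
    apply: Rintegral_is_derive => // x.
    by apply: cvgD; [exact: I1|apply: cvgM; [exact: cvg_cst|exact: I2]].
  rewrite RintegralD//; last 2 first.
  - exact: continuous_integrable_itv.
  - by apply: continuous_integrable_itv => x; apply: cvgM;
      [exact: cvg_cst|exact: I2].
  rewrite RintegralZl//; last exact: continuous_integrable_itv.
  rewrite -/(osc t) => E.
  have -> : t ^+ 2 * `|osc t| = `|t ^+ 2 * (Phi lam - Phi 0) -
      \int[mu]_(x in `[0, lam]) phi x|.
    rewrite -E -[X in X * _ = _]ger0_norm ?sqr_ge0// -normrM; congr `|_|.
    by field.
  apply: le_trans (ler_normB _ _) _; rewrite /D lerD//; last first.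
    apply: le_Rintegral_itv => //.
    by move=> x x0l; apply: osc_le; [exact: HA2|exact: HB2].
  have -> : t ^+ 2 * (Phi lam - Phi 0) =
     (p' lam * cos (lam * t) + q' lam * sin (lam * t)) - p' 0.
    by rewrite /Phi plam qlam q0 !mul0r cos0 sin0; field.
  apply: le_trans (ler_normB _ _) _.
  have := @osc_le _ _ (lam * t) _ _ (lexx `|p' lam|) (lexx `|q' lam|).
  have := normr_ge0 (q' 0); lra.
exists ((A + B) * lam + D).
  rewrite /D !addr_ge0// mulr_ge0// ?addr_ge0// ltW//.
move=> t; rewrite ler_pdivlMr ?oneDsqr_gt0// /oneDsqr mulrDr mulr1.
by rewrite [X in _ + X]mulrC lerD.
Qed.

End oscillatory.

Section bounded_factor.
Context d {S : measurableType d} {R : realType}.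
Variable nu : {measure set S -> \bar R}.

Lemma integrable_bounded_factor (v g : S -> R) (C : R) :
  nu.-integrable setT (EFin \o v) -> measurable_fun setT g ->
  (forall s, `|g s| <= C) -> nu.-integrable setT (fun s => (v s * g s)%:E).
Proof.
move=> iv mg gC.
have mv : measurable_fun setT v.
  by apply/measurable_EFinP; exact: measurable_int iv.
apply: (@le_integrable _ _ _ nu _ measurableT _ (fun s => (C * v s)%:E)).
- by apply/measurable_EFinP; exact: measurable_funM.
- move=> s _; rewrite lee_fin !normrM mulrC ler_wpM2r//.
  by apply: le_trans (gC s) _; exact: ler_norm.
- by have := integrableZl measurableT C iv.
Qed.

End bounded_factor.

(** * Fourier transform of a weighted measure, and its derivatives *)

Section fourier.
Context d {S : measurableType d} {R : realType}.
Variables (nu : {measure set S -> \bar R}) (L : S -> R).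
Hypothesis mL : measurable_fun setT L.

Lemma measurable_cosM (x : R) : measurable_fun setT (fun s => cos (x * L s)).
Proof.
apply: measurableT_comp; first exact: continuous_measurable_fun (@continuous_cos R).
exact: measurable_funM.
Qed.

Lemma measurable_sinM (x : R) : measurable_fun setT (fun s => sin (x * L s)).
Proof.
apply: measurableT_comp; first exact: continuous_measurable_fun (@continuous_sin R).
exact: measurable_funM.
Qed.

Lemma integrable_cosM (v : S -> R) x : nu.-integrable setT (EFin \o v) ->
  nu.-integrable setT (fun s => (v s * cos (x * L s))%:E).
Proof.
move=> iv; apply: integrable_bounded_factor iv (measurable_cosM x) _ => s.
exact: cos_max.
Qed.

Lemma integrable_sinM (v : S -> R) x : nu.-integrable setT (EFin \o v) ->
  nu.-integrable setT (fun s => (v s * sin (x * L s))%:E).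
Proof.
move=> iv; apply: integrable_bounded_factor iv (measurable_sinM x) _ => s.
exact: sin_max.
Qed.

(** [cosT] and [sinT] are the real and imaginary parts of the Fourier transform of the image under
    [L] of the signed measure [v nu]; keeping them apart leaves all the calculus real. *)
Definition cosT (v : S -> R) (x : R) := \int[nu]_s (v s * cos (x * L s)).
Definition sinT (v : S -> R) (x : R) := \int[nu]_s (v s * sin (x * L s)).

Lemma is_derive_cos_mul (c l x : R) :
  is_derive x 1 (fun x : R => c * cos (x * l)) (- (c * l * sin (x * l))).
Proof.
have dxl : is_derive x 1 (fun x : R => x * l) l.
  by apply: is_derive_eq; rewrite /GRing.scale /=; ring.
have dC := @is_derive1_comp _ cos (fun x : R => x * l) x _ _ (is_derive_cos _) dxl.
by apply: is_derive_eq; rewrite /GRing.scale /=; ring.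
Qed.

Lemma is_derive_sin_mul (c l x : R) :
  is_derive x 1 (fun x : R => c * sin (x * l)) (c * l * cos (x * l)).
Proof.
have dxl : is_derive x 1 (fun x : R => x * l) l.
  by apply: is_derive_eq; rewrite /GRing.scale /=; ring.
have dC := @is_derive1_comp _ sin (fun x : R => x * l) x _ _ (is_derive_sin _) dxl.
by apply: is_derive_eq; rewrite /GRing.scale /=; ring.
Qed.

Lemma is_derive_under_integral (f f' : R -> S -> R) (G : S -> R) (x : R) :
  (forall x, nu.-integrable setT (EFin \o f x)) ->
  (forall (x : R) s, is_derive x 1 (f ^~ s) (f' x s)) ->
  nu.-integrable setT (EFin \o G) -> (forall x s, `|f' x s| <= `|G s|) ->
  is_derive x 1 (fun x => \int[nu]_s f x s) (\int[nu]_s f' x s).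
Proof.
move=> fi df iG fG.
have Ix : `]x - 1, x + 1[%classic x.
  by rewrite /= in_itv/= ltrBlDr ltrDl ltr01.
have df1 : forall (y : R) s, f' y s = partial1of2 f y s.
  by move=> y s; rewrite partial1of2E; apply/esym; exact: derive_val.
have iG' : nu.-integrable setT (EFin \o (fun s => `|G s|)).
  exact: integrable_norm.
have H1 : forall (y : R) s, `]x - 1, x + 1[%classic y -> [set: S] s ->
    derivable (f ^~ s) y 1.
  by move=> y s _ _; exact: ex_derive.
have H2 : forall (y : R) s, `]x - 1, x + 1[%classic y -> [set: S] s ->
    `|partial1of2 f y s| <= `|G s|.
  by move=> y s _ _; rewrite -df1.
have G0 : forall s, 0 <= `|G s| by [].
apply: DeriveDef.
  exact: (derivable_under_integral measurableT Ix (fun y _ => fi y) H1 G0 iG' H2).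
rewrite -derive1E.
rewrite (differentiation_under_integral measurableT Ix (fun y _ => fi y) H1 G0 iG' H2).
by apply: eq_Rintegral => s _; rewrite df1.
Qed.

Lemma is_derive_cosT (v : S -> R) (x : R) : nu.-integrable setT (EFin \o v) ->
  nu.-integrable setT (fun s => (v s * L s)%:E) ->
  is_derive x 1 (cosT v) (- sinT (fun s => v s * L s) x).
Proof.
move=> iv ivL.
have -> : - sinT (fun s => v s * L s) x =
    \int[nu]_s (- (v s * L s * sin (x * L s))).
  rewrite -mulN1r -RintegralZl//; last exact: integrable_sinM.
  by apply: eq_Rintegral => s _; rewrite mulN1r.
apply: (@is_derive_under_integral _ (fun x s => - (v s * L s * sin (x * L s))) _ x
  _ _ ivL) => [y|y s|y s]; first exact: integrable_cosM.
- exact: is_derive_cos_mul.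
- by rewrite normrN normrM -[leRHS]mulr1 ler_wpM2l// sin_max.
Qed.

Lemma is_derive_sinT (v : S -> R) (x : R) : nu.-integrable setT (EFin \o v) ->
  nu.-integrable setT (fun s => (v s * L s)%:E) ->
  is_derive x 1 (sinT v) (cosT (fun s => v s * L s) x).
Proof.
move=> iv ivL.
apply: (@is_derive_under_integral _ (fun x s => v s * L s * cos (x * L s)) _ x
  _ _ ivL) => [y|y s|y s]; first exact: integrable_sinM.
- exact: is_derive_sin_mul.
- by rewrite normrM -[leRHS]mulr1 ler_wpM2l// cos_max.
Qed.

Lemma continuous_under_integral (f : R -> S -> R) (G : S -> R) :
  (forall x, nu.-integrable setT (EFin \o f x)) ->
  (forall s, continuous (f ^~ s)) ->
  nu.-integrable setT (EFin \o G) -> (forall x s, `|f x s| <= G s) ->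
  continuous (fun x => \int[nu]_s f x s).
Proof.
move=> fi cf iG fG x.
apply: (@continuity_under_integral _ _ _ nu f setT measurableT (x - 1) (x + 1)
  (fun y _ => fi y) _ G iG).
- by apply/aeW => s _ y _; exact: cf.
- by move=> y _; apply/aeW => s _; exact: fG.
- by rewrite inE /= in_itv/= ltrBlDr ltrDl ltr01.
Qed.

Lemma continuous_cosT (v : S -> R) : nu.-integrable setT (EFin \o v) ->
  continuous (cosT v).
Proof.
move=> iv; apply: (@continuous_under_integral _ (fun s => `|v s|)).
- by move=> x; exact: integrable_cosM.
- by move=> s x; apply: cvgM; [exact: cvg_cst|exact: continuous_cosM].
- exact: integrable_norm.
- by move=> x s; rewrite normrM -[leRHS]mulr1 ler_wpM2l// cos_max.
Qed.

Lemma continuous_sinT (v : S -> R) : nu.-integrable setT (EFin \o v) ->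
  continuous (sinT v).
Proof.
move=> iv; apply: (@continuous_under_integral _ (fun s => `|v s|)).
- by move=> x; exact: integrable_sinM.
- by move=> s x; apply: cvgM; [exact: cvg_cst|exact: continuous_sinM].
- exact: integrable_norm.
- by move=> x s; rewrite normrM -[leRHS]mulr1 ler_wpM2l// sin_max.
Qed.

Variable w : S -> R.
Hypotheses (iw : nu.-integrable setT (EFin \o w))
  (iwL : nu.-integrable setT (fun s => (w s * L s)%:E))
  (iwLL : nu.-integrable setT (fun s => (w s * L s * L s)%:E)).

(** Each derivative under the integral brings down a factor [L], so integrability of [w * L] and
    [w * L * L] pays for two of them. *)
Lemma C2_cosT : C2 (cosT w).
Proof.
exists (fun x => - sinT (fun s => w s * L s) x),
  (fun x => - cosT (fun s => w s * L s * L s) x).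
split=> [x|x|x]; first exact: is_derive_cosT.
- by apply: is_deriveN; exact: is_derive_sinT.
- by apply: cvgN; exact: continuous_cosT.
Qed.

Lemma C2_sinT : C2 (sinT w).
Proof.
exists (fun x => cosT (fun s => w s * L s) x),
  (fun x => - sinT (fun s => w s * L s * L s) x).
split=> [x|x|x]; first exact: is_derive_sinT.
- exact: is_derive_cosT.
- by apply: cvgN; exact: continuous_sinT.
Qed.

End fourier.

(** * Integrability from quadratic decay, and integrals depending on a parameter *)

Section oscillatory_integrable.
Context {R : realType}.
Let mu := @lebesgue_measure R.

Lemma continuous_osc_param (lam : R) (p q : R -> R) : 0 < lam ->
  continuous p -> continuous q -> continuous (osc lam p q).
Proof.
move=> l0 cp cq.
have [A A0 HA] := continuous_bounded_itv (ltW l0) cp.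
have [B B0 HB] := continuous_bounded_itv (ltW l0) cq.
move=> x.
apply: (@continuity_under_integral _ _ _ mu
  (fun t x => p x * cos (x * t) + q x * sin (x * t)) `[0, lam] _ (x - 1) (x + 1)
  _ _ (fun=> A + B)) => //.
- by move=> y _; exact: continuous_integrable_itv (continuous_osc cp cq).
- apply/aeW => s _ y _; apply: cvgD; apply: cvgM; try exact: cvg_cst.
  + by rewrite mulrC; under eq_fun do rewrite mulrC; exact: continuous_cosM.
  + by rewrite mulrC; under eq_fun do rewrite mulrC; exact: continuous_sinM.
- by apply: continuous_integrable_itv => y; exact: cvg_cst.
- move=> y _; apply/aeW => s /=; rewrite in_itv/= => s0l.
  by apply: osc_le; [exact: HA|exact: HB].
- by rewrite inE /= in_itv/= ltrBlDr ltrDl ltr01.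
Qed.

Lemma integrable_oneDsqrV : mu.-integrable setT (fun x => ((oneDsqr x)^-1)%:E).
Proof.
apply/integrableP; split.
  apply/measurable_EFinP; apply: continuous_measurable_fun.
  exact: (@continuous_oneDsqrV R).
under eq_integral do rewrite gee0_abs ?lee_fin ?invr_ge0 ?(le_trans ler01 (oneDsqr_ge1 _))//.
rewrite ge0_symfun_integralT//.
- rewrite (_ : [set x : R | 0 <= x] = `[0%R, +oo[%classic); last first.
    by apply/seteqP; split => x /=; rewrite in_itv/= andbT.
  by rewrite integral0y_oneDsqr -EFinM ltry.
- exact: (@continuous_oneDsqrV R).
- by move=> x; rewrite /= /oneDsqr sqrrN.
Qed.

Lemma integrable_decay (k : R -> R) (C : R) : measurable_fun setT k ->
  (forall t, `|k t| <= C / oneDsqr t) -> mu.-integrable setT (EFin \o k).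
Proof.
move=> mk kC; have iC := integrableZl measurableT C integrable_oneDsqrV.
apply: (le_integrable measurableT _ _ iC); first exact/measurable_EFinP.
by move=> t _; rewrite lee_fin; apply: le_trans (kC t) (ler_norm _).
Qed.

End oscillatory_integrable.

Section parameter_integral.
Context d1 d2 {S1 : measurableType d1} {S2 : measurableType d2} {R : realType}.
Variable m2 : {sigma_finite_measure set S2 -> \bar R}.

(** Tonelli gives measurability for nonnegative integrands, hence the split into positive and
    negative parts. *)
Lemma measurable_Rintegral_param (f : S1 * S2 -> R) : measurable_fun setT f ->
  measurable_fun setT (fun x => \int[m2]_y f (x, y)).
Proof.
move=> mf; have mEf : measurable_fun setT (EFin \o f) by exact/measurable_EFinP.
apply: measurableT_comp => //.
under eq_fun => x do rewrite integralE.
apply: emeasurable_funB.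
- under eq_fun => x.
    rewrite (_ : (fun y => (f (x, y))%:E)^\+%E = (fun y => (EFin \o f)^\+%E (x, y))); last first.
      by rewrite -[RHS]/((EFin \o f)^\+%E \o pair x) -funepos_comp.
    over.
  apply: measurable_fun_fubini_tonelli_F => //; exact: measurable_funepos.
- under eq_fun => x.
    rewrite (_ : (fun y => (f (x, y))%:E)^\-%E = (fun y => (EFin \o f)^\-%E (x, y))); last first.
      by rewrite -[RHS]/((EFin \o f)^\-%E \o pair x) -funeneg_comp.
    over.
  apply: measurable_fun_fubini_tonelli_F => //; exact: measurable_funeneg.
Qed.

End parameter_integral.

(** * Division of the Fejer kernel by a Fourier transform without zeros *)

Section wiener.
Context d {S : measurableType d} {R : realType}.
Let mu := @lebesgue_measure R.
Variables (nu : {finite_measure set S -> \bar R}) (L w : S -> R).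
Hypotheses (mL : measurable_fun setT L) (iw : nu.-integrable setT (EFin \o w))
  (iwL : nu.-integrable setT (fun s => (w s * L s)%:E))
  (iwLL : nu.-integrable setT (fun s => (w s * L s * L s)%:E)).
Variable lam : R.
Hypothesis lam0 : 0 < lam.

Let mw : measurable_fun setT w.
Proof. by apply/measurable_EFinP; exact: measurable_int iw. Qed.

(** The Fejer kernel, up to normalization, as the cosine transform of a triangle: the form in which
    it can be divided by another transform. Its closed form is [fejerE]. *)
Definition fejer (t : R) : R := osc lam (fun x => 1 - x / lam) (fun=> 0) t.

Lemma Rintegral_Fubini_itv (f : R * S -> R) (C : R) : measurable_fun setT f ->
  (forall x s, 0 <= x <= lam -> `|f (x, s)| <= C * `|w s|) ->
  \int[mu]_(x in `[0, lam]) \int[nu]_s f (x, s) =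
  \int[nu]_s \int[mu]_(x in `[0, lam]) f (x, s).
Proof.
move=> mf fC; pose I := `[0, lam]%classic : set R.
pose g (z : R * S) := \1_I z.1 * f z.
have mg : measurable_fun setT g.
  apply: measurable_funM => //.
  have mI : measurable I by exact: measurable_itv.
  have mi : measurable_fun setT (\1_I : R -> R) by exact: measurable_indic.
  exact: (measurableT_comp mi measurable_fst).
have iI : mu.-integrable setT (fun x : R => (C * \1_I x)%:E).
  exact: (integrableZl measurableT C (@integrable_indic_itv R 0 lam true false)).
have gb x s : `|g (x, s)| <= `|C * \1_I x| * `|w s|.
  rewrite /g /= indicE; have [xI|] := boolP (x \in I).
    rewrite mul1r mulr1; apply: le_trans (fC _ _ _) _.
      by move: xI; rewrite inE /I /= in_itv.
    by rewrite ler_wpM2r// ler_norm.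
  by rewrite !mul0r mulr0 normr0 mul0r.
have E : \int[mu]_x \int[nu]_s g (x, s) = \int[nu]_s \int[mu]_x g (x, s).
  apply: Rintegral_Fubini.
  - apply: (@integrable_prod_bound _ _ _ _ _ mu nu g (fun x => C * \1_I x) w) => //.
    by move=> -[x s]; exact: gb.
  - move=> x; apply: (le_integrable measurableT _ _
      (integrableZl measurableT `|C * \1_I x| (integrable_norm iw))).
      by apply/measurable_EFinP; exact: measurableT_comp.
    move=> s _; rewrite /= lee_fin [leRHS]ger0_norm ?mulr_ge0//; exact: gb.
  - move=> s; apply: (le_integrable measurableT _ _
      (integrableZl measurableT `|w s| (integrable_norm iI))).
      by apply/measurable_EFinP; exact: measurableT_comp.
    move=> x _; rewrite /= lee_fin [leRHS]ger0_norm ?mulr_ge0// mulrC.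
    exact: gb.
rewrite Rintegral_mkcond.
transitivity (\int[mu]_x \int[nu]_s g (x, s)).
  apply: eq_Rintegral => x _; rewrite patchE; case: ifPn => xI.
    by apply: eq_Rintegral => s _; rewrite /g/= indicE xI mul1r.
  under eq_Rintegral do rewrite /g/= indicE (negbTE xI) mul0r.
  by rewrite Rintegral_cst// mul0r.
rewrite E; apply: eq_Rintegral => s _; rewrite [RHS]Rintegral_mkcond.
apply: eq_Rintegral => x _; rewrite patchE /g/= indicE; case: ifPn => xI.
  by rewrite mul1r.
by rewrite mul0r.
Qed.

Hypothesis FT_neq0 : forall x, cosT nu L w x ^+ 2 + sinT nu L w x ^+ 2 != 0.

(** [N] is the squared modulus of the transform, and [p x * cos (x t) + q x * sin (x t)] is the real
    part of [(1 - x / lam) * exp (- i x t)] divided by [cosT + i sinT]. *)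
Let N x := cosT nu L w x ^+ 2 + sinT nu L w x ^+ 2.
Let p x := (1 - x / lam) * (cosT nu L w x * (N x)^-1).
Let q x := - ((1 - x / lam) * (sinT nu L w x * (N x)^-1)).

Let CN : C2 (fun x => (N x)^-1).
Proof.
apply: C2V => //; rewrite /N.
by apply: C2D; under eq_fun do rewrite expr2; apply: C2M;
  (exact: C2_cosT || exact: C2_sinT).
Qed.

Let C2_triangle : C2 (fun x : R => 1 - x / lam).
Proof.
have := C2_affine 1 (- lam^-1); congr C2; apply/funext => x.
by rewrite mulNr mulrC.
Qed.

Let Cp : C2 p.
Proof. by apply: C2M => //; apply: C2M => //; exact: C2_cosT. Qed.

Let Cq : C2 q.
Proof. by apply: C2N; apply: C2M => //; apply: C2M => //; exact: C2_sinT. Qed.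

(* The kernel whose convolution with the signed measure [w nu] is the Fejer
   kernel: its Fourier transform is that of [fejer] divided by that of [w nu]. *)
Definition fejer_quotient (t : R) : R := osc lam p q t.

Let sinT0 : sinT nu L w 0 = 0.
Proof.
rewrite /sinT; under eq_Rintegral do rewrite mul0r sin0 mulr0.
by rewrite Rintegral_cst// mul0r.
Qed.

(** The boundary conditions of [osc_decay] come from two sources: the triangle vanishes at [lam],
    and [sinT] vanishes at [0]. *)
Lemma fejer_quotient_decay :
  exists2 C : R, 0 <= C & forall t, `|fejer_quotient t| <= C / oneDsqr t.
Proof.
have lamV : lam / lam = 1 by rewrite divff// gt_eqF.
apply: (osc_decay lam0 Cp Cq).
- by rewrite /p lamV subrr mul0r.
- by rewrite /q lamV subrr mul0r oppr0.
- by rewrite /q sinT0 !mul0r mulr0 oppr0.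
Qed.

Lemma continuous_fejer_quotient : continuous fejer_quotient.
Proof.
by apply: continuous_osc_param => //; [exact: C2_continuous Cp|exact: C2_continuous Cq].
Qed.

Let measurable_kappa : measurable_fun setT fejer_quotient.
Proof. exact: continuous_measurable_fun continuous_fejer_quotient. Qed.

Let integrable_kappa : mu.-integrable setT (EFin \o fejer_quotient).
Proof.
have [C _ HC] := fejer_quotient_decay.
exact: integrable_decay measurable_kappa HC.
Qed.

(** Averaging [exp (- i x (t - L s))] over [w nu] multiplies [exp (- i x t)] by the transform at
    [x], which cancels the division inside the integral over [x]. *)
Lemma fejer_quotientE (t : R) :
  fejer t = \int[nu]_s (w s * fejer_quotient (t - L s)).
Proof.
pose f (z : R * S) :=
  (p z.1 * cos (z.1 * (t - L z.2)) + q z.1 * sin (z.1 * (t - L z.2))) * w z.2.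
have mp : measurable_fun setT p by exact: continuous_measurable_fun (C2_continuous Cp).
have mq : measurable_fun setT q by exact: continuous_measurable_fun (C2_continuous Cq).
have marg : measurable_fun setT (fun z : R * S => z.1 * (t - L z.2)).
  apply: measurable_funM => //; apply: measurable_funB => //.
  exact: measurableT_comp.
have mf : measurable_fun setT f.
  apply: measurable_funM; last exact: measurableT_comp.
  have mc := measurableT_comp (continuous_measurable_fun (@continuous_cos R)) marg.
  have ms := measurableT_comp (continuous_measurable_fun (@continuous_sin R)) marg.
  by apply: measurable_funD; apply: measurable_funM => //; exact: measurableT_comp.
have [A A0 HA] := continuous_bounded_itv (ltW lam0) (C2_continuous Cp).
have [B B0 HB] := continuous_bounded_itv (ltW lam0) (C2_continuous Cq).
have fb x s : 0 <= x <= lam -> `|f (x, s)| <= (A + B) * `|w s|.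
  move=> xl; rewrite /f /= normrM ler_wpM2r//.
  by apply: osc_le; [exact: HA|exact: HB].
transitivity (\int[mu]_(x in `[0, lam]) \int[nu]_s f (x, s)).
  apply: eq_Rintegral => x _; rewrite mul0r addr0.
  transitivity (\int[nu]_s
      ((p x * cos (x * t) + q x * sin (x * t)) * (w s * cos (x * L s)) +
       (p x * sin (x * t) - q x * cos (x * t)) * (w s * sin (x * L s)))).
    have ic : nu.-integrable setT (fun s => (w s * cos (x * L s))%:E).
      exact: integrable_cosM.
    have isn : nu.-integrable setT (fun s => (w s * sin (x * L s))%:E).
      exact: integrable_sinM.
    rewrite RintegralD//; last 2 first.
    - exact: (integrableZl measurableT _ ic).
    - exact: (integrableZl measurableT _ isn).
    rewrite !RintegralZl// -/(cosT nu L w x) -/(sinT nu L w x).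
    rewrite /p /q /N; field; by rewrite FT_neq0 gt_eqF.
  apply: eq_Rintegral => s _; rewrite /f /= mulrBr cosB sinB; ring.
rewrite (Rintegral_Fubini_itv mf fb); apply: eq_Rintegral => s _.
rewrite /fejer_quotient /osc mulrC -RintegralZr//.
by apply: continuous_integrable_itv; apply: continuous_osc;
  exact: C2_continuous.
Qed.

Let integrable_wb (g : S -> R) (C : R) : measurable_fun setT g ->
  (forall s, `|g s| <= C) -> nu.-integrable setT (fun s => (w s * g s)%:E).
Proof. exact: integrable_bounded_factor. Qed.

Variables (A : R -> R) (C : R).
Hypotheses (mA : measurable_fun setT A) (AC : forall t, `|A t| <= C).

Let C0 : 0 <= C. Proof. exact: le_trans (normr_ge0 _) (AC 0). Qed.

(** The average over [w nu] moves from the kernel to [A]: expand the Fejer kernel by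
    [fejer_quotientE], exchange the integrals, translate the inner variable by [L s], and exchange
    back. *)
Lemma convolution_fejer (t : R) :
  \int[mu]_s (A (t - s) * fejer s) =
  \int[mu]_r (fejer_quotient r * \int[nu]_s (w s * A (t - r - L s))).
Proof.
have [K K0 HK] := fejer_quotient_decay.
have kb r : `|fejer_quotient r| <= K.
  apply: le_trans (HK r) _; rewrite ler_pdivrMr ?oneDsqr_gt0//.
  by rewrite ler_peMr// oneDsqr_ge1.
pose f (z : R * S) := w z.2 * (A (t - z.1) * fejer_quotient (z.1 - L z.2)).
have mf : measurable_fun setT f.
  apply: measurable_funM; first exact: measurableT_comp.
  apply: measurable_funM.
    by apply: measurableT_comp => //; exact: measurable_funB.
  apply: measurableT_comp => //; apply: measurable_funB => //.
  exact: measurableT_comp.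
have msub (c : R) : measurable_fun setT (fun s : R => c - s).
  exact: measurable_funB.
have f1 x : nu.-integrable setT (fun s => (f (x, s))%:E).
  apply: (@integrable_wb (fun s => A (t - x) * fejer_quotient (x - L s)) (C * K)).
    apply: measurable_funM => //; apply: measurableT_comp => //.
    exact: measurable_funB.
  by move=> s; rewrite normrM ler_pM.
have ik s : mu.-integrable setT (fun x => (fejer_quotient (x - L s))%:E).
  exact: (integrable_shift (- L s) integrable_kappa).
have f2 s : mu.-integrable setT (fun x => (f (x, s))%:E).
  rewrite (_ : (fun x => _) = (fun x =>
      (fejer_quotient (x - L s) * (w s * A (t - x)))%:E)); last first.
    by apply/funext => x; rewrite /f /=; congr EFin; ring.
  apply: (@integrable_bounded_factor _ _ _ mu (fun x => fejer_quotient (x - L s))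
    (fun x => w s * A (t - x)) (`|w s| * C) (ik s)).
    by apply: measurable_funM => //; exact: (measurableT_comp mA (msub t)).
  by move=> x; rewrite normrM ler_wpM2l.
(* The factor [fejer_quotient (x - L s)] mixes both variables, so a product bound does not apply
   directly; translation invariance bounds the integral over [x] uniformly up to the factor
   [|w s|]. *)
have intf : (mu \x nu)%E.-integrable setT (EFin \o f).
  apply/integrable21ltyP; first exact/measurable_EFinP.
  have ikn := integrable_norm integrable_kappa.
  apply: (@le_lt_trans _ _ (\int[nu]_s
      ((`|w s| * C)%:E * \int[mu]_x `|(fejer_quotient x)%:E|))%E).
    apply: ge0_le_integral => //.
    - by move=> s _; exact: integral_ge0.
    - apply: (@measurable_fun_fubini_tonelli_G _ _ _ _ _ mu (abse \o (EFin \o f))).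
        by apply: measurableT_comp => //; exact/measurable_EFinP.
      by move=> ?; exact: abse_ge0.
    - apply: emeasurable_funM => //; apply/measurable_EFinP.
      by apply: measurable_funM => //; exact: measurableT_comp.
    move=> s _.
    have -> : (\int[mu]_x `|(fejer_quotient x)%:E| =
               \int[mu]_x `|(fejer_quotient (x - L s))%:E|)%E.
      rewrite -(@ge0_integral_shift _ (fun x => `|(fejer_quotient x)%:E|)%E (- L s))//.
      by apply: measurableT_comp => //; exact/measurable_EFinP.
    have mk : measurable_fun setT (fun x : R => `|(fejer_quotient (x - L s))%:E|)%E.
      apply: (@measurableT_comp _ _ _ _ _ _ abse) => //.
      exact: measurable_int (ik s).
    have mf2 : measurable_fun setT (fun x : R => `|(f (x, s))%:E|)%E.
      apply: (@measurableT_comp _ _ _ _ _ _ abse) => //.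
      exact: measurable_int (f2 s).
    rewrite -ge0_integralZl//; last by rewrite lee_fin mulr_ge0.
    apply: ge0_le_integral => //.
      exact: emeasurable_funM.
    move=> x _; rewrite /f /= lee_fin !normrM mulrA ler_wpM2r//.
    by rewrite ler_wpM2l.
  rewrite ge0_integralZr//; last 3 first.
  - by apply/measurable_EFinP; apply: measurable_funM => //; exact: measurableT_comp.
  - by move=> s _; rewrite lee_fin mulr_ge0.
  - exact: integral_ge0.
  move/integrableP : integrable_kappa => [_ kfin].
  apply: lte_mul_pinfty => //.
  - by apply: integral_ge0 => s _; rewrite lee_fin mulr_ge0.
  have /integrableP[_] : nu.-integrable setT (fun s => (`|w s| * C)%:E).
    exact: (integrableZr measurableT C (integrable_norm iw)).
  rewrite ge0_fin_numE; last by apply: integral_ge0 => s _; rewrite lee_fin mulr_ge0.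
  move=> H; apply: le_lt_trans H; apply: le_integral => //.
  - exact: (integrableZr measurableT C (integrable_norm iw)).
  - apply: integrable_abse.
    exact: (integrableZr measurableT C (integrable_norm iw)).
  - by move=> s _; exact: lee_abs.
pose h (z : R * S) := w z.2 * (A (t - z.1 - L z.2) * fejer_quotient z.1).
have mh : measurable_fun setT h.
  apply: measurable_funM; first exact: measurableT_comp.
  apply: measurable_funM; last exact: measurableT_comp.
  apply: measurableT_comp => //; apply: measurable_funB.
    exact: measurable_funB.
  exact: measurableT_comp.
have iAw r : nu.-integrable setT (fun s => (w s * A (t - r - L s))%:E).
  apply: (@integrable_wb (fun s => A (t - r - L s)) C) => //.
  by apply: measurableT_comp => //; exact: measurable_funB.
have mAL s : measurable_fun setT (fun x : R => A (t - x - L s)).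
  by apply: measurableT_comp => //; apply: measurable_funB => //; exact: measurable_funB.
have ihn := integrableZl measurableT C integrable_kappa.
have inth : (mu \x nu)%E.-integrable setT (EFin \o h).
  apply: (@integrable_prod_bound _ _ _ _ _ mu nu h (fun x => C * fejer_quotient x) w) => //.
  move=> -[x s] /=.
  rewrite /h /= !normrM mulrC ler_wpM2r// ler_wpM2r//.
  by apply: le_trans (AC _) _; exact: ler_norm.
transitivity (\int[mu]_x \int[nu]_s f (x, s)).
  apply: eq_Rintegral => x _; rewrite fejer_quotientE -RintegralZl//.
    by apply: eq_Rintegral => s _; rewrite /f /=; ring.
  apply: (@integrable_wb (fun s => fejer_quotient (x - L s)) K) => //.
  apply: measurableT_comp => //.
  exact: measurable_funB.
rewrite (Rintegral_Fubini intf f1 f2).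
transitivity (\int[nu]_s \int[mu]_x h (x, s)).
  apply: eq_Rintegral => s _; rewrite /Rintegral; congr fine.
  rewrite -(integral_shift (L s) (f2 s)).
  apply: eq_integral => x _; rewrite /f /h /= addrK.
  by congr (_ * (A _ * _))%:E; ring.
rewrite -(Rintegral_Fubini inth).
- apply: eq_Rintegral => r _; rewrite -RintegralZl//; last exact: iAw.
  by apply: eq_Rintegral => s _; rewrite /h /=; ring.
- move=> x; rewrite (_ : (fun s => _) =
      (fun s => (w s * A (t - x - L s) * fejer_quotient x)%:E)).
    exact: (integrableZr measurableT (fejer_quotient x) (iAw x)).
  by apply/funext => s; rewrite /h mulrA.
- move=> s; rewrite (_ : (fun x => _) =
      (fun x => (w s * (fejer_quotient x * A (t - x - L s)))%:E)).
    have iq : mu.-integrable setT (fun x => (fejer_quotient x * A (t - x - L s))%:E).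
      apply: (@integrable_bounded_factor _ _ _ mu fejer_quotient _ C) => //.
      exact: mAL.
    exact: (integrableZl measurableT (w s) iq).
  by apply/funext => x; rewrite /h [A _ * _]mulrC.
Qed.

End wiener.

(** * Positivity, concentration and mass of the Fejer kernel *)

Section fejer.
Context {R : realType}.
Let mu := @lebesgue_measure R.
Variable lam : R.
Hypothesis lam0 : 0 < lam.

Let C2_triangle : C2 (fun x : R => 1 - x / lam).
Proof.
have := C2_affine 1 (- lam^-1); congr C2; apply/funext => x.
by rewrite mulNr mulrC.
Qed.

Let C2_0 : C2 (fun=> 0 : R).
Proof.
have := C2_affine (0 : R) 0; congr C2; apply/funext => x.
by rewrite mul0r addr0.
Qed.

Lemma continuous_fejer : continuous (fejer lam).
Proof. by apply: continuous_osc_param => //; exact: C2_continuous. Qed.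

Lemma integrable_fejer : mu.-integrable setT (EFin \o fejer lam).
Proof.
have [||| C _ HC] := osc_decay lam0 C2_triangle C2_0 => //.
  by rewrite divff ?subrr// gt_eqF.
apply: integrable_decay HC; exact: continuous_measurable_fun continuous_fejer.
Qed.

Lemma fejerE (t : R) : t != 0 ->
  fejer lam t = (1 - cos (lam * t)) / (lam * t ^+ 2).
Proof.
move=> t0; have l0 : lam != 0 by rewrite gt_eqF.
pose F (x : R) := (1 - x / lam) * (sin (x * t) * t^-1) -
  cos (x * t) * (lam * t ^+ 2)^-1.
have cm := C2_continuous C2_triangle.
rewrite /fejer /osc (_ : (fun x => _) = (fun x => (1 - x / lam) * cos (x * t))).
  transitivity (F lam - F 0).
    apply: Rintegral_is_derive => //; last first.
      by move=> x; apply: cvgM; [exact: cm|exact: continuous_cosM].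
    move=> x; have dS := is_derive_sin_mul 1 t x.
    have dC := is_derive_cos_mul 1 t x.
    rewrite (_ : F = (fun x : R => (1 - x / lam) * (1 * sin (x * t) * t^-1) -
       (1 * cos (x * t)) * (lam * t ^+ 2)^-1)); last first.
      by apply/funext => y; rewrite /F !mul1r.
    apply: is_derive_eq; rewrite /GRing.scale /=; field; exact/andP.
  rewrite /F divff// !mul0r sin0 cos0; field; exact/andP.
by apply/funext => x; rewrite mul0r addr0.
Qed.

Lemma fejer_ge0 (t : R) : 0 <= fejer lam t.
Proof.
have [->|t0] := eqVneq t 0.
  apply: Rintegral_ge0 => x /=; rewrite in_itv/= => /andP[x0 xl].
  rewrite mulr0 cos0 mulr1 mul0r addr0 subr_ge0 ler_pdivrMr// mul1r//.
by rewrite fejerE// divr_ge0 ?subr_ge0 ?cos_le1// mulr_ge0 ?sqr_ge0// ltW.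
Qed.

(** Off [[- delta, delta]] the kernel is [O(1 / lam)] with an integrable profile, so a large [lam]
    concentrates it. The constant comes from [1 - cos <= 2] and
    [(1 + t ^ 2) / t ^ 2 <= 1 + delta ^- 2]. *)
Lemma fejer_le (delta t : R) : 0 < delta -> delta <= `|t| ->
  fejer lam t <= 2 * (1 + delta ^- 2) / lam / oneDsqr t.
Proof.
move=> d0 dt; have t0 : t != 0.
  by rewrite -normr_gt0; exact: lt_le_trans dt.
rewrite fejerE//.
have dt2 : delta ^+ 2 <= t ^+ 2 by rewrite -[leRHS]real_normK ?num_real// ler_sqr ?nnegrE ?(ltW d0).
have c1 := cos_geN1 (lam * t).
have t2 : 0 < t ^+ 2 by rewrite exprn_even_gt0.
have d2 : 0 < delta ^+ 2 by rewrite exprn_gt0.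
rewrite ler_pdivlMr ?oneDsqr_gt0// /oneDsqr.
have -> : (1 - cos (lam * t)) / (lam * t ^+ 2) * (1 + t ^+ 2) =
  (1 - cos (lam * t)) * (1 + t ^- 2) / lam.
  by field; rewrite t0 gt_eqF.
rewrite ler_pM2r ?invr_gt0//; apply: ler_pM.
- by rewrite subr_ge0 cos_le1.
- by rewrite addr_ge0// invr_ge0 ltW.
- lra.
- by rewrite lerD2l lef_pV2 ?posrE.
Qed.

(** For [t] in [[0, 1 / lam]] and [x] in [[0, lam]] one has [cos (x t) >= cos 1], so the kernel is
    at least [cos 1 * lam / 2] on an interval of length [1 / lam]. The bound is uniform in [lam], so
    it outweighs the [O(1 / lam)] of [fejer_le]. *)
Lemma fejer_mass : cos 1 / 2 <= \int[mu]_t fejer lam t.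
Proof.
have l0 : lam != 0 by rewrite gt_eqF.
have i1 := @integrable_indic_itv R 0 lam^-1 true false.
have low t : t \in `[0, lam^-1]%R -> cos 1 * (lam / 2) <= fejer lam t.
  rewrite in_itv/= => /andP[t0 tl].
  have cm := C2_continuous C2_triangle.
  have E : cos 1 * (lam / 2) = \int[mu]_(x in `[0, lam]) ((1 - x / lam) * cos 1).
    pose F (x : R) := cos 1 * (x - x ^+ 2 / (2 * lam)).
    transitivity (F lam - F 0); first by rewrite /F; field.
    apply/esym; apply: Rintegral_is_derive => // x.
      by rewrite /F; apply: is_derive_eq; rewrite /GRing.scale /=; field.
    by apply: cvgM; [exact: cm|exact: cvg_cst].
  rewrite E; apply: le_Rintegral => //.
  - apply: continuous_integrable_itv => x.
    by apply: cvgM; [exact: cm|exact: cvg_cst].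
  - by apply: continuous_integrable_itv; apply: continuous_osc => // x; exact: cvg_cst.
  - move=> x /=; rewrite in_itv/= => /andP[x0 xl]; rewrite mul0r addr0.
    apply: ler_wpM2l; first by rewrite subr_ge0 ler_pdivrMr// mul1r.
    have xt : 0 <= x * t <= 1.
      rewrite mulr_ge0//=; apply: (@le_trans _ _ (lam * lam^-1)).
        exact: ler_pM.
      by rewrite divff.
    have pi1 : (1 : R) <= pi by have := @pi_ge2 R; lra.
    move/andP : xt => [xt0 xt1].
    have := @ltr_cos R 1 (x * t); rewrite !in_itv/= ler01 pi1 xt0 (le_trans xt1 pi1).
    by move=> /(_ isT isT) H; rewrite leNgt H -leNgt.
have -> : cos 1 / 2 = \int[mu]_t (cos 1 * (lam / 2) * \1_(`[0, lam^-1]%classic) t).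
  rewrite RintegralZl// /Rintegral integral_indic//= setIT.
  rewrite lebesgue_measure_itv/= lte_fin invr_gt0 lam0 sube0/=.
  by field.
apply: le_Rintegral => //.
- exact: (integrableZl measurableT _ i1).
- exact: integrable_fejer.
- move=> t _; rewrite indicE; case: (boolP (t \in _)) => ti.
    by rewrite mulr1 low//; move: ti; rewrite inE.
  by rewrite mulr0 fejer_ge0.
Qed.

End fejer.

(** * Convergence of the Fejer means *)

Section wiener_limit.
Context d {S : measurableType d} {R : realType}.
Let mu := @lebesgue_measure R.
Variables (nu : {finite_measure set S -> \bar R}) (L w : S -> R).
Hypotheses (mL : measurable_fun setT L) (iw : nu.-integrable setT (EFin \o w))
  (iwL : nu.-integrable setT (fun s => (w s * L s)%:E))
  (iwLL : nu.-integrable setT (fun s => (w s * L s * L s)%:E)).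
Hypothesis FT_neq0 : forall x, cosT nu L w x ^+ 2 + sinT nu L w x ^+ 2 != 0.
Variables (A : R -> R) (C c : R).
Hypotheses (mA : measurable_fun setT A) (AC : forall t, `|A t| <= C).
Hypothesis Ac : (\int[nu]_s (w s * A (t - L s))) @[t --> +oo] --> c.

(** By [convolution_fejer] the Fejer mean of [A] integrates a bounded convergent function against
    the integrable quotient kernel, so dominated convergence applies. *)
Lemma wiener_fejer (lam : R) : 0 < lam ->
  (\int[mu]_s (A (t - s) * fejer lam s)) @[t --> +oo] -->
  c / cosT nu L w 0 * \int[mu]_s fejer lam s.
Proof.
move=> lam0.
pose k := fejer_quotient nu L w lam.
have [K K0 HK] := fejer_quotient_decay mL iw iwL iwLL lam0 FT_neq0.
have ck : continuous k by exact: continuous_fejer_quotient.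
have mk : measurable_fun setT k by exact: continuous_measurable_fun.
have ik : mu.-integrable setT (EFin \o k) by exact: integrable_decay HK.
pose I := \int[nu]_s `|w s|.
have mw : measurable_fun setT w by apply/measurable_EFinP; exact: measurable_int iw.
pose g t := \int[nu]_s (w s * A (t - L s)).
have mg : measurable_fun setT g.
  apply: (@measurable_Rintegral_param _ _ _ _ _ nu
    (fun z : R * S => w z.2 * A (z.1 - L z.2))).
  apply: measurable_funM; first exact: measurableT_comp.
  by apply: measurableT_comp => //; apply: measurable_funB => //; exact: measurableT_comp.
have iwA t : nu.-integrable setT (fun s => (w s * A (t - L s))%:E).
  apply: (@integrable_bounded_factor _ _ _ nu w (fun s => A (t - L s)) C) => //.
  by apply: measurableT_comp => //; exact: measurable_funB.
have gb t : `|g t| <= C * I.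
  apply: le_trans (le_normr_Rintegral _ (iwA t)) _ => //.
  rewrite /I -RintegralZl//; last exact: integrable_norm.
  apply: le_Rintegral => //.
  - exact: (integrable_norm (iwA t)).
  - exact: (integrableZl measurableT C (integrable_norm iw)).
  - by move=> s _; rewrite normrM mulrC ler_wpM2r.
(* The convolution identity for the constant [A = 1] gives the mass of the quotient kernel, hence
   the constant in the limit. *)
have mass : \int[mu]_s fejer lam s = \int[mu]_r k r * \int[nu]_s w s.
  have b1 (t : R) : `|1 : R| <= 1 by rewrite normr1.
  have H := convolution_fejer mL iw iwL iwLL lam0 FT_neq0
    (measurable_cst (1 : R)) b1 0.
  transitivity (\int[mu]_s (1 * fejer lam s)).
    by apply: eq_Rintegral => s _; rewrite mul1r.
  transitivity (\int[mu]_r (k r * \int[nu]_s (w s * 1))); first exact: H.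
  have -> : \int[nu]_s w s = \int[nu]_s (w s * 1).
    by apply: eq_Rintegral => s _; rewrite mulr1.
  exact: (RintegralZr _ measurableT ik).
have cw : cosT nu L w 0 = \int[nu]_s w s.
  by apply: eq_Rintegral => s _; rewrite mul0r cos0 mulr1.
have sw : sinT nu L w 0 = 0.
  transitivity (\int[nu]_s (0 : R)); last by rewrite Rintegral_cst// mul0r.
  by apply: eq_Rintegral => s _; rewrite mul0r sin0 mulr0.
have w0 : \int[nu]_s w s != 0.
  have := FT_neq0 0; rewrite sw cw expr0n addr0.
  by apply: contra_neq => ->; rewrite expr0n.
have -> : c / cosT nu L w 0 * \int[mu]_s fejer lam s = \int[mu]_r (k r * c).
  by rewrite RintegralZr// mass cw; field.
under eq_fun => t do rewrite (convolution_fejer mL iw iwL iwLL lam0 FT_neq0 mA AC).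
apply: (@dominated_cvg_pinfty _ _ _ mu (fun t r => k r * g (t - r)) _
  (fun r => `|k r| * (C * I)) 0).
- move=> t; apply: measurable_funM => //; apply: measurableT_comp => //.
  exact: measurable_funB.
- exact: measurable_funM.
- apply/aeW => r; apply: cvgM; first exact: cvg_cst.
  apply: (@cvg_comp _ _ _ (fun t => t - r) g) Ac; exact: cvg_addrr.
- exact: (integrableZr measurableT _ (integrable_norm ik)).
- by apply/aeW => r t _; rewrite normrM ler_wpM2l.
Qed.

End wiener_limit.

(** * From Fejer means to the function itself *)

Section tauberian.
Context {R : realType}.
Let mu := @lebesgue_measure R.
Variables (A : R -> R) (C alpha l : R).
Hypotheses (mA : measurable_fun setT A) (A0 : forall t, 0 <= A t)
  (AC : forall t, A t <= C).
Hypothesis alpha0 : 0 < alpha.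
Hypothesis slow : forall delta : R, 0 < delta ->
  exists rho : R -> R, [/\ rho t @[t --> +oo] --> expR (alpha * delta),
    forall t, 0 <= rho t &
    forall t r r', t <= r -> r <= r' -> r' <= t + delta -> A r' <= rho t * A r].
Hypothesis Afejer : forall lam, 0 < lam ->
  (\int[mu]_s (A (t - s) * fejer lam s)) @[t --> +oo] -->
  l * \int[mu]_s fejer lam s.

(** The hypothesis [slow] controls growth only to the right. So [A t] is bounded above by the mean
    centred at [t - delta], whose window ends at [t], and below by the mean centred at [t + delta],
    whose window starts at [t]. *)
Lemma tauberian_fejer : A t @[t --> +oo] --> l.
Proof.
have C0 : 0 <= C by exact: le_trans (A0 0) (AC 0).
have l0 : 0 <= l.
  have F1 := @fejer_mass R 1 ltr01; have c1 := @cos1_gt0 R.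
  have F0 : 0 < \int[mu]_s fejer 1 s by apply: lt_le_trans F1; rewrite divr_gt0.
  rewrite -(pmulr_lge0 _ F0) -(cvg_lim _ (Afejer ltr01))//.
  apply: limr_ge; first by apply/cvg_ex; eexists; exact: (Afejer ltr01).
  apply: nearW => t; apply: Rintegral_ge0 => s _.
  by rewrite mulr_ge0// fejer_ge0.
apply/cvgrPdist_le => e e0.
(* [K] covers the final errors on both sides: with [e1 <= 1] they are at most [e1 * (2 * l + 4)]
   above and [e1 * (2 * C + 2)] below. *)
pose K := 3 * C + 2 * l + 5.
have K0 : 0 < K by rewrite /K; lra.
pose e1 := Num.min 1 (e / K).
have e10 : 0 < e1 by rewrite lt_min ltr01 divr_gt0.
have e11 : e1 <= 1 by rewrite ge_min lexx.
have e1K : e1 * K <= e by rewrite -ler_pdivlMr// ge_min lexx orbT.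
(* The window [[- delta, delta]] has length [2 * delta]; [delta] solves
   [exp (2 * alpha * delta) = 1 + e1], strictly below the factor [1 + 2 * e1] tolerated later. *)
have [delta d0 Hd] : exists2 delta : R, 0 < delta &
    expR (alpha * (2 * delta)) < 1 + 2 * e1.
  exists (ln (1 + e1) / (2 * alpha)).
    by rewrite divr_gt0 ?mulr_gt0// ln_gt0// ltrDl.
  rewrite (_ : alpha * _ = ln (1 + e1)); last by field; rewrite gt_eqF.
  by rewrite lnK ?posrE; lra.
have d20 : 0 < 2 * delta by rewrite mulr_gt0.
have [rho [rhoc rho0 Hrho]] := slow d20.
pose D := 2 * (1 + delta ^- 2).
have D0 : 0 <= D by rewrite mulr_ge0// addr_ge0// invr_ge0 exprn_ge0// ltW.
pose P := \int[mu]_s (oneDsqr s : R)^-1.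
have iP := @integrable_oneDsqrV R.
have P0 : 0 <= P.
  by apply: Rintegral_ge0 => x _; rewrite invr_ge0 (le_trans ler01 (oneDsqr_ge1 _)).
have c1 := @cos1_gt0 R.
(* Large enough for the part of the mean outside the window, at most [C * D / lam * P], to be below
   [e1] times the mass of the kernel. *)
pose lam := 1 + C * D * P / (e1 * (cos 1 / 2)).
have lam0 : 0 < lam.
  have Y0 : 0 < e1 * (cos 1 / 2) by rewrite mulr_gt0// divr_gt0.
  rewrite /lam; apply: ltr_pwDl => //; apply: divr_ge0; [exact: mulr_ge0 (mulr_ge0 C0 D0) P0|exact: ltW].
pose F := \int[mu]_s fejer lam s.
have F1 : cos 1 / 2 <= F := fejer_mass lam0.
have F0 : 0 < F by apply: lt_le_trans F1; rewrite divr_gt0.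
have tail : C * D / lam * P <= e1 * F.
  apply: le_trans (ler_wpM2l (ltW e10) F1).
  rewrite mulrAC ler_pdivrMr// /lam mulrDr mulr1 [X in _ + X]mulrC divfK.
    by rewrite lerDr mulr_ge0 ?divr_ge0 ?(ltW e10) ?(ltW c1).
  by rewrite mulf_neq0 ?gt_eqF// divr_gt0.
have mf : measurable_fun setT (fejer lam).
  by apply: continuous_measurable_fun; exact: continuous_fejer.
have iF := integrable_fejer lam0.
have iAf t : mu.-integrable setT (fun s => (A (t - s) * fejer lam s)%:E).
  rewrite (_ : (fun s => _) = (fun s => (fejer lam s * A (t - s))%:E)); last first.
    by apply/funext => s; rewrite mulrC.
  apply: (@integrable_bounded_factor _ _ _ mu _ (fun s => A (t - s)) C) => //.
    by apply: measurableT_comp => //; exact: measurable_funB.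
  by move=> s; rewrite ger0_norm.
pose conv t := \int[mu]_s (A (t - s) * fejer lam s).
have o0 s : 0 <= (oneDsqr s : R)^-1.
  by rewrite invr_ge0 (le_trans ler01 (oneDsqr_ge1 _)).
have CDl : 0 <= C * D / lam := divr_ge0 (mulr_ge0 C0 D0) (ltW lam0).
have tail_le u s : delta < `|s| ->
    A u * fejer lam s <= C * D / lam * (oneDsqr s)^-1.
  move=> sd; rewrite -2![C * _ * _]mulrA; apply: ler_pM => //; first exact: fejer_ge0.
  exact: fejer_le (ltW sd).
have near1 : \forall t \near +oo, rho t <= 1 + 2 * e1.
  by move/cvgr_le : rhoc; apply.
have near2 : \forall t \near +oo, `|l * F - conv t| <= e1 * F.
  by move/cvgrPdist_le : (Afejer lam0) => /(_ _ (mulr_gt0 e10 F0)).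
(* For [|s| <= delta] the point [t - delta - s] lies in [[t - 2 * delta, t]], so [A t] is at most
   [rho (t - 2 * delta)] times the value of [A] there. *)
have up t : A t * F <= rho (t - 2 * delta) * conv (t - delta) + e1 * F.
  have -> : A t * F = \int[mu]_s (A t * fejer lam s) by rewrite RintegralZl.
  apply: le_trans (lerD (lexx _) tail).
  rewrite /conv /P -(RintegralZl (rho (t - 2 * delta)) measurableT (iAf (t - delta))).
  rewrite -(RintegralZl (C * D / lam) measurableT iP) -RintegralD//.
  - apply: le_Rintegral => //.
    + exact: (integrableZl measurableT _ iF).
    + exact: (integrableD measurableT (integrableZl measurableT _ (iAf _))
        (integrableZl measurableT _ iP)).
    move=> s _.
    have [sd|sd] := lerP `|s| delta.
      apply: ler_wpDr.
        exact: mulr_ge0 CDl (o0 s).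
      rewrite mulrA ler_wpM2r ?fejer_ge0//; apply: Hrho;
        move: sd; rewrite ler_norml; lra.
    apply: ler_wpDl; last exact: tail_le.
    by rewrite ?mulr_ge0 ?fejer_ge0.
  - exact: (integrableZl measurableT _ (iAf _)).
  - exact: (integrableZl measurableT _ iP).
(* Symmetrically, [t + delta - s] lies in [[t, t + 2 * delta]], where [A] is at most
   [rho t * A t]. *)
have low t : conv (t + delta) <= rho t * A t * F + e1 * F.
  apply: le_trans (lerD (lexx _) tail).
  rewrite /F /P -(RintegralZl (rho t * A t) measurableT iF).
  rewrite -(RintegralZl (C * D / lam) measurableT iP) -RintegralD//.
  - apply: le_Rintegral => //.
    + exact: iAf.
    + exact: (integrableD measurableT (integrableZl measurableT _ iF)
        (integrableZl measurableT _ iP)).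
    move=> s _.
    have [sd|sd] := lerP `|s| delta.
      apply: ler_wpDr.
        exact: mulr_ge0 CDl (o0 s).
      rewrite ler_wpM2r ?fejer_ge0//; apply: Hrho;
        move: sd; rewrite ler_norml; lra.
    apply: ler_wpDl; last exact: tail_le.
    by rewrite ?mulr_ge0 ?fejer_ge0.
  - exact: (integrableZl measurableT _ iF).
  - exact: (integrableZl measurableT _ iP).
have n1 := cvg_addrr (- (2 * delta)) near1.
have n2 := cvg_addrr (- delta) near2.
have n3 := cvg_addrr delta near2.
near=> t.
have h1 : rho t <= 1 + 2 * e1 by near: t.
have h2 : rho (t - 2 * delta) <= 1 + 2 * e1 by near: t; exact: n1.
have h3 : `|l * F - conv (t - delta)| <= e1 * F by near: t; exact: n2.
have h4 : `|l * F - conv (t + delta)| <= e1 * F by near: t; exact: n3.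
have {h3} h3 : conv (t - delta) <= (l + e1) * F.
  by move: h3; rewrite ler_norml mulrDl; lra.
have {h4} h4 : (l - e1) * F <= conv (t + delta).
  by move: h4; rewrite ler_norml mulrBl; lra.
have U : A t <= l + e1 * K.
  have : A t * F <= ((1 + 2 * e1) * (l + e1) + e1) * F.
    apply: le_trans (up t) _.
    rewrite [leRHS](_ : _ = (1 + 2 * e1) * ((l + e1) * F) + e1 * F); last by ring.
    apply: lerD => //; apply: ler_pM => //.
    by apply: Rintegral_ge0 => s _; rewrite mulr_ge0// fejer_ge0.
  rewrite ler_pM2r// => /le_trans; apply; rewrite /K; nra.
have V : l <= A t + e1 * K.
  have : (l - e1) * F <= ((1 + 2 * e1) * A t + e1) * F.
    apply: le_trans h4 _; apply: le_trans (low t) _.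
    rewrite [leRHS](_ : _ = (1 + 2 * e1) * A t * F + e1 * F); last by ring.
    by apply: lerD => //; rewrite ler_wpM2r ?(ltW F0)// ler_wpM2r.
  rewrite ler_pM2r// /K; have := AC t; nra.
rewrite ler_norml lerNl opprB !lerBlDl.
by rewrite (le_trans U)//= ?lerD2l// (le_trans V)// lerD2l.
Unshelve. all: end_near.
Qed.

End tauberian.

Section ae_le_integrable.
Context d {S : measurableType d} {R : realType}.
Variable nu : {measure set S -> \bar R}.

Lemma ae_le_integrable (f g : S -> R) : measurable_fun setT f ->
  nu.-integrable setT (EFin \o g) -> {ae nu, forall s, `|f s| <= g s} ->
  nu.-integrable setT (EFin \o f).
Proof.
move=> mf /integrableP[mg ig] fg; apply/integrableP; split.
  exact/measurable_EFinP.
apply: le_lt_trans ig; apply: ae_ge0_le_integral => //.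
- by apply: measurableT_comp => //; exact/measurable_EFinP.
- exact: measurableT_comp.
- by apply: filterS fg => s fgs _; rewrite lee_fin (le_trans fgs)// ler_norm.
Qed.

End ae_le_integrable.

Section expR_infty.
Context {R : realType}.

Lemma cvg_expR_pinfty : expR t @[t --> +oo] --> (+oo : set_system R).
Proof.
apply/cvgryPge => a; near=> t; apply: le_trans (expR_ge1Dx t).
by apply: ler_wpDl => //; near: t; exact: nbhs_pinfty_ge.
Unshelve. all: end_near. Qed.

Lemma cvg_ln_pinfty : ln t @[t --> +oo] --> (+oo : set_system R).
Proof.
apply/cvgryPge => a; near=> t.
by rewrite -(expRK a) ler_ln ?posrE ?expR_gt0.
Unshelve. all: end_near. Qed.

End expR_infty.

(** * Mellin transforms and the converse to Breiman's theorem *)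

Section mellin.
Context {R : realType}.

(** Here the extra moment [eps] is spent. Both constants come from
    [y ^ 2 <= 2 / c ^ 2 * exp (c * y)] for [y >= 0], with [c = eps] when [v >= 1] and [c = alpha]
    when [v < 1]. *)
Lemma powR_ln_sqr_le (alpha eps v : R) : 0 < alpha -> 0 < eps -> 0 <= v ->
  v `^ alpha * (1 + ln v ^+ 2) <=
  (1 + 2 / eps ^+ 2 + 2 / alpha ^+ 2) * (1 + v `^ (alpha + eps)).
Proof.
move=> a0 e0; set K := (X in _ <= X * _).
have ke : 0 < 2 / eps ^+ 2 by rewrite divr_gt0// exprn_gt0.
have ka : 0 < 2 / alpha ^+ 2 by rewrite divr_gt0// exprn_gt0.
have K0 : 0 <= K by rewrite /K; lra.
rewrite le_eqVlt => /predU1P[<-|v0].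
  by rewrite powR0 ?gt_eqF// mul0r mulr_ge0// addr_ge0// powR_ge0.
have vE a : v `^ a = expR (a * ln v) by rewrite /powR gt_eqF.
rewrite !vE; set l := ln v.
have H (c y : R) : 0 < c -> 0 <= y -> y ^+ 2 <= 2 / c ^+ 2 * expR (c * y).
  move=> c0 y0; have cy : 0 <= c * y by rewrite mulr_ge0// ltW.
  have := expR_ge1Dxn 1 cy; rewrite exprMn (_ : (2`!)%:R = 2 :> R)// => h.
  have c2 : 0 < c ^+ 2 by rewrite exprn_gt0.
  have h2 : c ^+ 2 * y ^+ 2 <= 2 * expR (c * y) by lra.
  by rewrite [leRHS]mulrAC ler_pdivlMr// mulrC.
have E1 : 0 < expR (alpha * l) := expR_gt0 _.
have E2 : 0 < expR ((alpha + eps) * l) := expR_gt0 _.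
rewrite mulrDr mulr1 /K.
have [l0|l0] := leP 0 l.
- have e1 : expR (alpha * l) <= expR ((alpha + eps) * l).
    by rewrite ler_expR ler_wpM2r// lerDl ltW.
  have : expR (alpha * l) * l ^+ 2 <= 2 / eps ^+ 2 * expR ((alpha + eps) * l).
    apply: le_trans (ler_wpM2l (ltW E1) (H _ _ e0 l0)) _.
    by rewrite [leLHS]mulrCA -expRD (mulrDl alpha eps).
  have := mulr_gt0 ka E2; lra.
- have e1 : expR (alpha * l) <= 1 by rewrite -expR0 ler_expR mulr_ge0_le0 ?ltW.
  have : expR (alpha * l) * l ^+ 2 <= 2 / alpha ^+ 2.
    have l0' : 0 <= - l by rewrite oppr_ge0 ltW.
    have := ler_wpM2l (ltW E1) (H _ _ a0 l0'); rewrite sqrrN => /le_trans; apply.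
    by rewrite [leLHS]mulrCA -expRD mulrN subrr expR0 mulr1.
  have := mulr_gt0 ka E2; have := mulr_gt0 ke E2; lra.
Qed.

Variables (nu : {finite_measure set R -> \bar R}) (u : R -> R) (alpha eps U : R).
Hypotheses (mu_ : measurable_fun setT u) (uU : forall v, `|u v| <= U)
  (alpha0 : 0 < alpha) (eps0 : 0 < eps) (nu_ge0 : {ae nu, forall v, 0 <= v})
  (moment : nu.-integrable setT (fun v => (v `^ (alpha + eps))%:E)).

Let U0 : 0 <= U. Proof. exact: le_trans (normr_ge0 _) (uU 0). Qed.

(** With this weight [cosT] and [sinT] along [ln] are the real and imaginary parts of the Mellin
    transform of [u nu] on the line of real part [alpha]. The point [v = 0], where [ln v = 0] by
    convention, has weight [0] when [alpha > 0]. *)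
Definition mellin_weight (v : R) := u v * v `^ alpha.
Let w := mellin_weight.

Let mw : measurable_fun setT w.
Proof. by apply: measurable_funM => //; exact: measurable_powR. Qed.

Lemma integrable_mellin (g : R -> R) : measurable_fun setT g ->
  (forall v, `|g v| <= 1 + ln v ^+ 2) ->
  nu.-integrable setT (fun v => (w v * g v)%:E).
Proof.
move=> mg gb; set K := U * (1 + 2 / eps ^+ 2 + 2 / alpha ^+ 2).
have i1 : nu.-integrable setT (fun v => (1 + v `^ (alpha + eps))%:E).
  have i0 : nu.-integrable setT (EFin \o cst (1 : R)).
    exact: finite_measure_integrable_cst.
  exact: (integrableD measurableT i0 moment).
have iK := integrableZl measurableT K i1.
apply: ae_le_integrable iK _; first exact: measurable_funM.
apply: filterS nu_ge0 => v v0.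
rewrite normrM /w /mellin_weight normrM -mulrA.
rewrite (ger0_norm (powR_ge0 _ _)) /K -mulrA; apply: ler_pM => //.
  by rewrite mulr_ge0// powR_ge0.
apply: le_trans (powR_ln_sqr_le alpha0 eps0 v0).
by rewrite ler_wpM2l// powR_ge0.
Qed.

Lemma abs_le1Dsqr (x : R) : `|x| <= 1 + x ^+ 2.
Proof. by rewrite ler_norml; apply/andP; split; nra. Qed.

Lemma integrable_mellin_weight : nu.-integrable setT (EFin \o w).
Proof.
have := @integrable_mellin (fun=> 1) (measurable_cst _).
rewrite (_ : (fun v => _) = EFin \o w); last by apply/funext => v /=; rewrite mulr1.
by apply=> v; rewrite normr1 lerDl sqr_ge0.
Qed.

Lemma integrable_mellin_ln : nu.-integrable setT (fun v => (w v * ln v)%:E).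
Proof. by apply: integrable_mellin => // v; exact: abs_le1Dsqr. Qed.

Lemma integrable_mellin_lnln :
  nu.-integrable setT (fun v => (w v * ln v * ln v)%:E).
Proof.
rewrite (_ : (fun v => _) = (fun v => (w v * (ln v * ln v))%:E)); last first.
  by apply/funext => v; rewrite mulrA.
apply: integrable_mellin; first exact: measurable_funM.
by move=> v; rewrite -expr2 ger0_norm ?sqr_ge0// lerDr.
Qed.

Hypothesis mellin_neq0 : forall x,
  cosT nu (@ln R) w x ^+ 2 + sinT nu (@ln R) w x ^+ 2 != 0.
Variables (M B : R -> R) (C c x0 : R) (k : R -> R).
Hypotheses (M_gt0 : forall x, 0 < M x)
  (M_nincr : {homo M : x y /~ x <= y}) (B_nincr : {homo B : x y /~ x <= y})
  (B_ge0 : forall x, 0 <= B x) (BM : forall x, 0 < x -> B x <= C * M x)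
  (M_RV : forall y, 0 < y -> M (x * y) / M x @[x --> +oo] --> y `^ (- alpha)).
Hypotheses (ik : nu.-integrable setT (EFin \o k))
  (Bk : {ae nu, forall v x, 0 < v -> x0 <= x -> B (x / v) / M x <= k v})
  (Bc : (\int[nu]_(v in `]0, +oo[) (u v * B (x / v))) / M x @[x --> +oo] --> c).

(* A converse to Breiman's theorem: in logarithmic coordinates the hypothesis
   on [B] is a convolution equation with the measure [mellin_weight nu], whose
   Fourier transform has no zero. *)
Lemma inverse_breiman :
  B x / M x @[x --> +oo] --> c / \int[nu]_v w v.
Proof.
pose A t := B (expR t) / M (expR t).
have expR_homo : {homo (@expR R) : x y / x <= y} by move=> x y; rewrite ler_expR.
have mBe : measurable_fun setT (fun t => B (expR t)).
  by apply: nonincreasing_measurable => // x y xy; exact/B_nincr/expR_homo.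
have mMe : measurable_fun setT (fun t => (M (expR t))^-1).
  apply: nondecreasing_measurable => // x y xy.
  by rewrite lef_pV2 ?posrE//; exact/M_nincr/expR_homo.
have mA : measurable_fun setT A by exact: measurable_funM.
have A0 t : 0 <= A t by rewrite divr_ge0// ltW.
have AC t : A t <= C by rewrite ler_pdivrMr// BM// expR_gt0.
have C0 : 0 <= C := le_trans (A0 0) (AC 0).
have AC' t : `|A t| <= C by rewrite ger0_norm.
(* The numerator [B] does not increase, so [A] can grow only through [1 / M], whose growth over a
   window tends to [exp (alpha * delta)] by regular variation. *)
have slow delta : 0 < delta ->
    exists rho : R -> R, [/\ rho t @[t --> +oo] --> expR (alpha * delta),
    forall t, 0 <= rho t &
    forall t r r', t <= r -> r <= r' -> r' <= t + delta -> A r' <= rho t * A r].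
  move=> d0; exists (fun t => M (expR t) / M (expR (t + delta))); split.
  - have H := M_RV (expR_gt0 delta).
    have e1 : (M (x * expR delta) / M x)^-1 @[x --> +oo] --> expR (alpha * delta).
      rewrite -[X in _ --> X]invrK; apply: cvgV.
        by rewrite invr_neq0// gt_eqF// expR_gt0.
      move: H; rewrite /powR gt_eqF ?expR_gt0// expRK mulNr expRN.
      by [].
    rewrite (_ : (fun t => _) =
      (fun x => (M (x * expR delta) / M x)^-1) \o expR); last first.
      by apply/funext => t; rewrite /= invf_div expRD.
    exact: cvg_comp (@cvg_expR_pinfty R) e1.
  - by move=> t; rewrite divr_ge0// ltW.
  - move=> t r r' tr rr' r't.
    have -> : M (expR t) / M (expR (t + delta)) * A r =
        M (expR t) / M (expR r) * (B (expR r) / M (expR (t + delta))).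
      by rewrite /A; field; rewrite !gt_eqF.
    have rt : r <= t + delta by exact: le_trans r't.
    have h1 : A r' <= B (expR r) / M (expR (t + delta)).
      apply: ler_pM => //; first by rewrite invr_ge0 ltW.
        exact/B_nincr/expR_homo.
      by rewrite lef_pV2 ?posrE//; exact/M_nincr/expR_homo.
    apply: le_trans h1 _; rewrite ler_peMl//; first by rewrite divr_ge0// ltW.
    by rewrite ler_pdivlMr// mul1r; exact/M_nincr/expR_homo.
(* With [x = exp t], the ratio [B (x / v) / M x] is [A (t - ln v)] times [M (x / v) / M x], and the
   last factor tends to [v ^ alpha]. Replacing it by its limit costs an integral [f] that vanishes
   by domination by [k]. *)
have Ac : (\int[nu]_v (w v * A (t - ln v))) @[t --> +oo] --> c.
  (* The indicator of [D] discards [v = 0], where [exp (t - ln v)] is no longer [exp t / v]; the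
     weight [w] vanishes there too. *)
  pose D := `]0, +oo[%classic : set R.
  pose g t v := \1_D v * (u v * (B (expR (t - ln v)) / M (expR t))).
  pose f t v := g t v - w v * A (t - ln v).
  pose t0 := ln (Num.max 1 x0).
  have t0x t : t0 <= t -> x0 <= expR t.
    rewrite -ler_expR lnK ?posrE ?lt_max ?ltr01// => H; apply: le_trans H.
    by rewrite le_max lexx orbT.
  have Bexp t v : 0 < v -> B (expR (t - ln v)) = B (expR t / v).
    by move=> v0; rewrite expRB lnK.
  have mg t : measurable_fun setT (g t).
    have mD : measurable D by exact: measurable_itv.
    have mI : measurable_fun setT (\1_D : R -> R) by exact: measurable_indic.
    apply: measurable_funM => //.
    apply: measurable_funM => //; apply: measurable_funM => //.
    by apply: (measurableT_comp mBe); exact: measurable_funB.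
  have gk : {ae nu, forall v t, t0 <= t -> `|g t v| <= U * `|k v|}.
    apply: filterS Bk => v kv t tt; rewrite /g indicE.
    have [|_] := boolP (v \in D); last by rewrite mul0r normr0 mulr_ge0.
    rewrite inE /D /= in_itv/= andbT => v0.
    rewrite mul1r normrM ler_pM// Bexp// ger0_norm ?divr_ge0// ?(ltW (M_gt0 _))//.
    by apply: le_trans (ler_norm _); apply: kv => //; exact: t0x.
  have ig t : t0 <= t -> nu.-integrable setT (EFin \o g t).
    move=> tt; have iN := integrableZl measurableT U (integrable_norm ik).
    by apply: ae_le_integrable iN _ => //; apply: filterS gk => v; exact.
  have mwA t : measurable_fun setT (fun v => A (t - ln v)).
    by apply: measurableT_comp => //; exact: measurable_funB.
  have iA t : nu.-integrable setT (fun v => (w v * A (t - ln v))%:E).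
    apply: (@integrable_bounded_factor _ _ _ nu w (fun v => A (t - ln v)) C) => //.
    exact: integrable_mellin_weight.
  have f0 : (\int[nu]_v f t v) @[t --> +oo] --> \int[nu]_v (0 : R).
    apply: (@dominated_cvg_pinfty _ _ _ nu f (fun=> 0)
      (fun v => U * `|k v| + `|w v| * C) t0).
    - by move=> t; apply: measurable_funB => //; exact: measurable_funM.
    - exact: measurable_cst.
    - apply: filterS nu_ge0 => v; rewrite le_eqVlt => /predU1P[<-|v0].
        rewrite (_ : f ^~ 0 = cst 0); first exact: cvg_cst.
        apply/funext => t; rewrite /f /g indicE memNset ?mul0r; last first.
          by rewrite /D/= in_itv/= ltxx.
        by rewrite /w /mellin_weight powR0 ?gt_eqF// mulr0 mul0r subr0.
      have vV0 : 0 < v^-1 by rewrite invr_gt0.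
      have H := cvg_comp _ _ (@cvg_expR_pinfty R) (M_RV vV0).
      have vE : v^-1 `^ (- alpha) = v `^ alpha.
        by rewrite /powR !gt_eqF// lnV ?posrE// mulrNN.
      rewrite vE in H.
      have {}H : C * U * `|M (expR t * v^-1) / M (expR t) - v `^ alpha|
          @[t --> +oo] --> 0.
        rewrite -[X in _ --> X](mulr0 (C * U)) -(normr0 R) -(subrr (v `^ alpha)).
        apply: cvgM; first exact: cvg_cst.
        by apply: cvg_norm; apply: cvgB; [exact: H|exact: cvg_cst].
      apply: norm_cvg0; apply: squeeze_cvgr (cvg_cst 0) H.
      apply: nearW => t; rewrite normr_ge0/= /f /g indicE mem_set; last first.
        by rewrite /D/= in_itv/= v0.
      have -> : 1%:R * (u v * (B (expR (t - ln v)) / M (expR t))) -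
          w v * A (t - ln v) =
          A (t - ln v) * u v * (M (expR t * v^-1) / M (expR t) - v `^ alpha).
        rewrite /w /mellin_weight /A -[expR t / v](_ : expR (t - ln v) = _); last first.
          by rewrite expRB lnK.
        by field; rewrite !gt_eqF.
      by rewrite normrM ler_wpM2r// normrM ler_pM.
    - have iK := integrableZl measurableT U (integrable_norm ik).
      have iW := integrableZr measurableT C (integrable_norm integrable_mellin_weight).
      exact: (integrableD measurableT iK iW).
    - apply: filterS gk => v gv t tt; apply: le_trans (ler_normB _ _) _.
      by apply: lerD; [exact: gv|rewrite normrM ler_wpM2l].
  rewrite Rintegral_cst// mul0r in f0.
  have Bc' := cvg_comp _ _ (@cvg_expR_pinfty R) Bc.
  pose b x := (\int[nu]_(v in `]0, +oo[) (u v * B (x / v))) / M x.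
  have {Bc'} Bc' : b (expR t) - \int[nu]_v f t v @[t --> +oo] --> c.
    by rewrite -[X in _ --> X]subr0; exact: cvgB Bc' f0.
  apply: cvg_trans Bc'; apply: near_eq_cvg; rewrite /b.
  near=> t; have tt : t0 <= t by near: t; exact: (nbhs_pinfty_ge (num_real t0)).
  rewrite /f RintegralB//; [|exact: ig|exact: iA].
  have -> : \int[nu]_v g t v =
      (\int[nu]_(v in `]0, +oo[) (u v * B (expR t / v))) / M (expR t).
    have gE : {in D, forall v, g t v = u v * B (expR t / v) * (M (expR t))^-1}.
      move=> v vD; rewrite /g indicE vD mul1r Bexp ?mulrA//.
      by move: vD; rewrite inE /D/= in_itv/= andbT.
    have -> : \int[nu]_(v in `]0, +oo[) (u v * B (expR t / v)) =
        \int[nu]_(v in D) (g t v * M (expR t)).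
      by apply: eq_Rintegral => v vD; rewrite gE// divfK// gt_eqF.
    have mD : measurable D by exact: measurable_itv.
    rewrite RintegralZr//; last exact: (integrableS measurableT mD (@subsetT _ _) (ig t tt)).
    rewrite mulfK ?gt_eqF// [RHS]Rintegral_mkcond; apply: eq_Rintegral => v _.
    by rewrite patchE; case: ifPn => // vD; rewrite /g indicE (negbTE vD) mul0r.
  by rewrite /=; ring.
have H lam : 0 < lam -> _ := @wiener_fejer _ _ _ nu (@ln R) w (@measurable_ln R)
  integrable_mellin_weight integrable_mellin_ln integrable_mellin_lnln
  mellin_neq0 A C c mA AC' Ac lam.
have := tauberian_fejer mA A0 AC alpha0 slow H.
have -> : cosT nu (@ln R) w 0 = \int[nu]_v w v.
  by apply: eq_Rintegral => v _; rewrite mul0r cos0 mulr1.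
move=> Al; have := cvg_comp _ _ (@cvg_ln_pinfty R) Al; apply: cvg_trans.
apply: near_eq_cvg; near=> x.
by rewrite /A /= lnK// posrE; near: x; exact: nbhs_pinfty_gt.
Unshelve. all: end_near.
Qed.

End mellin.

(** * Integrals over independent variables and over variables with the same law *)

Section independent_pair.
Context d d1 d2 {T : measurableType d} {V1 : measurableType d1}
  {V2 : measurableType d2} {R : realType}.
Variables (P : probability T R) (U : T -> V1) (W : T -> V2).
Hypotheses (mU : measurable_fun setT U) (mW : measurable_fun setT W)
  (indUW : forall A B, measurable A -> measurable B ->
     P (U @^-1` A `&` W @^-1` B) = (P (U @^-1` A) * P (W @^-1` B))%E).

Let Um : {mfun T >-> V1} := mfun_Sub (mem_set mU : U \in mfun).
Let Wm : {mfun T >-> V2} := mfun_Sub (mem_set mW : W \in mfun).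
Let UWm : {mfun T >-> (V1 * V2)%type} :=
  mfun_Sub (mem_set (measurable_fun_pair mU mW) : (fun w => (U w, W w)) \in mfun).

Let law_pair (A : set (V1 * V2)) : measurable A ->
  (distribution P Um \x distribution P Wm)%E A = distribution P UWm A.
Proof.
apply: product_measure_unique => B C mB mC.
rewrite /distribution /pushforward /=.
rewrite -indUW//; congr (P _).
Qed.

Lemma ge0_integral_independent (h : V1 * V2 -> \bar R) :
  measurable_fun setT h -> (forall z, (0 <= h z)%E) ->
  (\int[P]_w h (U w, W w) = \int[P]_w \int[P]_w' h (U w, W w'))%E.
Proof.
move=> mh h0.
transitivity (\int[distribution P UWm]_z h z)%E.
  by rewrite ge0_integral_distribution.
transitivity (\int[distribution P Um \x distribution P Wm]_z h z)%E.
  by apply: eq_measure_integral => A mA _; apply/esym; exact: law_pair.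
rewrite fubini_tonelli1// /fubini_F ge0_integral_distribution//; last 2 first.
- exact: measurable_fun_fubini_tonelli_F.
- by move=> x; exact: integral_ge0.
apply: eq_integral => w _ /=; rewrite ge0_integral_distribution//.
exact: measurableT_comp.
Qed.

Lemma integral_independentM (f : V1 -> R) (g : V2 -> R) :
  measurable_fun setT f -> measurable_fun setT g ->
  P.-integrable setT (EFin \o (f \o U)) -> P.-integrable setT (EFin \o (g \o W)) ->
  P.-integrable setT (fun w => (f (U w) * g (W w))%:E) /\
  \int[P]_w (f (U w) * g (W w)) = \int[P]_w f (U w) * \int[P]_w g (W w).
Proof.
move=> mf mg fi gi.
have mfE : measurable_fun setT (EFin \o f) by exact/measurable_EFinP.
have mgE : measurable_fun setT (EFin \o g) by exact/measurable_EFinP.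
pose h (z : V1 * V2) := f z.1 * g z.2.
have mh : measurable_fun setT h.
  by apply: measurable_funM; exact: measurableT_comp.
have fi' : (distribution P Um).-integrable setT (EFin \o f).
  exact: integrable_pushforward.
have gi' : (distribution P Wm).-integrable setT (EFin \o g).
  exact: integrable_pushforward.
have ih : (distribution P Um \x distribution P Wm)%E.-integrable setT (EFin \o h).
  by apply: (integrable_prod_bound mh fi' gi') => z; rewrite normrM.
have ih2 : (distribution P UWm).-integrable setT (EFin \o h).
  move/integrableP : ih => [mEh ih]; apply/integrableP; split => //.
  by rewrite -(eq_measure_integral _ (fun A mA _ => law_pair mA)).
have ih3 : P.-integrable setT (fun w => (f (U w) * g (W w))%:E).
  move/integrableP : ih2 => [mEh ih2]; apply/integrableP; split.
    by apply/measurable_EFinP; apply: measurable_funM; exact: measurableT_comp.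
  by move: ih2; rewrite ge0_integral_distribution//; exact: measurableT_comp.
split=> //.
transitivity (\int[distribution P UWm]_z h z).
  by rewrite /Rintegral integral_distribution//; exact/measurable_EFinP.
transitivity (\int[(distribution P Um \x distribution P Wm)%E]_z h z).
  rewrite /Rintegral; congr fine.
  by apply: eq_measure_integral => A mA _; apply/esym; exact: law_pair.
rewrite /Rintegral -integral12_prod_meas1// /fubini_F.
have E x : (\int[distribution P Wm]_y (EFin \o h) (x, y) =
    (f x)%:E * (fine (\int[distribution P Wm]_y (g y)%:E))%:E)%E.
  rewrite fineK; last exact: integrable_fin_num gi'.
  by rewrite -integralZl.
set c := fine _ in E.
transitivity (fine (\int[distribution P Um]_x ((f x)%:E * c%:E)%E)).
  by congr fine; apply: eq_integral => x _; exact: E.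
rewrite integralZr//= fineM//; last first.
  exact: integrable_fin_num fi'.
rewrite /Rintegral /c; congr (fine _ * fine _).
- exact: (@integral_distribution _ _ _ _ _ P Um _ mfE fi).
- rewrite fineK; last exact: integrable_fin_num gi'.
  exact: (@integral_distribution _ _ _ _ _ P Wm _ mgE gi).
Qed.

End independent_pair.

Section same_law.
Context d {T : measurableType d} {R : realType}.
Variables (P : probability T R) (Z Z' : T -> R * R).
Hypotheses (mZ : measurable_fun setT Z) (mZ' : measurable_fun setT Z')
  (ZZ' : same_law P Z Z').

Let Zm : {mfun T >-> (R * R)%type} := mfun_Sub (mem_set mZ : Z \in mfun).
Let Zm' : {mfun T >-> (R * R)%type} := mfun_Sub (mem_set mZ' : Z' \in mfun).

Lemma same_law_integral (h : R * R -> \bar R) : measurable_fun setT h ->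
  (forall z, (0 <= h z)%E) -> (\int[P]_w h (Z w) = \int[P]_w h (Z' w))%E.
Proof.
move=> mh h0.
transitivity (\int[distribution P Zm]_z h z)%E.
  by rewrite ge0_integral_distribution.
transitivity (\int[distribution P Zm']_z h z)%E.
  by apply: eq_measure_integral => A mA _; exact: ZZ'.
by rewrite ge0_integral_distribution.
Qed.

Lemma same_law_integrable (h : R * R -> R) : measurable_fun setT h ->
  P.-integrable setT (EFin \o (h \o Z')) ->
  P.-integrable setT (EFin \o (h \o Z)) /\
  \int[P]_w h (Z w) = \int[P]_w h (Z' w).
Proof.
move=> mh /[dup] ih' /integrableP[mhZ' ih].
have mhE : measurable_fun setT (EFin \o h) by exact/measurable_EFinP.
have iZ : P.-integrable setT (EFin \o (h \o Z)).
  apply/integrableP; split; first by apply/measurable_EFinP; exact: measurableT_comp.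
  have mah : measurable_fun setT (abse \o (EFin \o h)) by exact: measurableT_comp.
  by have /= -> := same_law_integral mah (fun z => abse_ge0 _).
split=> //; rewrite /Rintegral; congr fine.
transitivity (\int[distribution P Zm]_z (h z)%:E)%E.
  by rewrite integral_distribution.
transitivity (\int[distribution P Zm']_z (h z)%:E)%E.
  by apply: eq_measure_integral => A mA _; exact: ZZ'.
by rewrite integral_distribution.
Qed.

End same_law.

(** * Independence of a vector from the past of the sequence *)

Section past.
Context d {T : measurableType d} {R : realType}.
Variables (P : probability T R) (Z : nat -> T -> R * R).
Hypotheses (mZ : forall i, measurable_fun setT (Z i))
  (indZ : mutually_independent P Z).

(** Cylinder events of the first [k] vectors: a family stable under intersection that generates the
    sigma-algebra of the past and on which two measures can be compared. *)
Definition past (k : nat) : set (set T) :=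
  [set A | exists B : nat -> set (R * R), (forall i, measurable (B i)) /\
     A = \bigcap_(i in `I_k) (Z i @^-1` B i)].

Lemma past_measurable (k : nat) (A : set T) : past k A -> measurable A.
Proof.
move=> [B [mB ->]]; apply: bigcap_measurableType => i _.
by rewrite -[X in measurable X]setTI; exact: mZ.
Qed.

Lemma past_setI (k : nat) : setI_closed (past k).
Proof.
move=> _ _ [B [mB ->]] [C [mC ->]]; exists (fun i => B i `&` C i).
split; first by move=> i; exact: measurableI.
by rewrite -bigcapI.
Qed.

Lemma mutually_independent_prefix (k : nat) (B : nat -> set (R * R)) :
  (forall i, measurable (B i)) ->
  P (\bigcap_(i in `I_k) (Z i @^-1` B i)) =
  (\prod_(0 <= i < k) P (Z i @^-1` B i))%E.
Proof.
move=> mB; pose J := seq_fset tt (iota 0 k).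
have -> : `I_k = [set` J].
  by apply/seteqP; split => i /=; rewrite seq_fsetE mem_iota /= add0n.
rewrite indZ// /index_iota subn0; apply: perm_big.
by apply: uniq_perm; [exact: fset_uniq|exact: iota_uniq|move=> i; rewrite seq_fsetE].
Qed.

(** As functions of [A] both sides are finite measures agreeing on the cylinder events, hence on the
    sigma-algebra these generate. *)
Lemma past_independent (k : nat) (A : set T) (C : set (R * R)) :
  <<s past k >> A -> measurable C ->
  P (A `&` Z k @^-1` C) = (P A * P (Z k @^-1` C))%E.
Proof.
move=> sA mC.
have mZC : measurable (Z k @^-1` C).
  by rewrite -[X in measurable X]setTI; exact: mZ.
have pC : fine (P (Z k @^-1` C)) >= 0 by exact: fine_ge0.
pose m1 := mrestr P mZC.
pose m2 := mscale (NngNum pC) P.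
transitivity (m1 A); first by [].
transitivity (m2 A); last first.
  rewrite /m2 /mscale /= muleC fineK//; exact: fin_num_measure.
apply: (@g_sigma_algebra_measure_unique _ _ _ (past k) _ (fun=> setT)) => //.
- exact: past_measurable.
- move=> _; exists (fun=> setT); split => //.
  by apply/seteqP; split.
- by apply/seteqP; split => // x _; exists 0%N.
- exact: past_setI.
- move=> _ [B [mB ->]].
  (* Placing [C] in slot [k] turns the intersection into a cylinder of length [k + 1], to which
     mutual independence applies. *)
  pose B' i := if i == k then C else B i.
  have mB' i : measurable (B' i) by rewrite /B'; case: ifP.
  transitivity (P (\bigcap_(i in `I_k.+1) (Z i @^-1` B' i))).
    rewrite /m1 /mrestr; congr (P _); apply/seteqP; split.
      move=> w [Bw Cw] i /=; rewrite ltnS leq_eqVlt /B' => /predU1P[->|ik].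
        by rewrite eqxx.
      by rewrite ltn_eqF//; exact: Bw.
    move=> w Bw; split => [i /= ik|].
      by have := Bw i (ltnW ik); rewrite /B' /= ltn_eqF.
    by have := Bw k (ltnSn k); rewrite /B' /= eqxx.
  rewrite mutually_independent_prefix// big_nat_recr//= {2}/B' eqxx.
  rewrite /m2 /mscale /= fineK; last exact: fin_num_measure.
  rewrite muleC mutually_independent_prefix//; congr (_ * _)%E.
  by apply: eq_big_nat => i /andP[_ ik]; rewrite /B' ltn_eqF.
- move=> _; rewrite (_ : (_ < +oo)%E = (P (setT `&` Z k @^-1` C) < +oo)%E)// setTI.
  exact: le_lt_trans (probability_le1 P mZC) (ltry _).
Qed.

Lemma past_coordinate (k i : nat) : (i < k)%N ->
  measurable_fun [set: g_sigma_algebraType (past k)] (Z i).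
Proof.
move=> ik _ C mC; rewrite setTI.
apply: sub_sigma_algebra.
exists (fun j => if j == i then C else setT); split.
  by move=> j; case: ifP.
apply/seteqP; split => [w Cw j _ /=|w /(_ i ik)]/=.
  by case: eqP => [->|].
by rewrite eqxx.
Qed.

End past.

Section nondecreasing_emeasurable.
Context {R : realType}.

Lemma nondecreasing_emeasurable (f : R -> \bar R) :
  {homo f : x y / (x <= y)%R >-> (x <= y)%E} -> measurable_fun setT f.
Proof.
move=> ndf; apply: (measurability _ (ErealGenCInfty.measurableE R)) => //.
move=> _ [_ [y ->] <-]; rewrite setTI.
apply: is_interval_measurable => a b /= fa fb z /andP[az zb].
move: fa; rewrite !in_itv/= !andbT => /le_trans; apply; exact: ndf.
Qed.

End nondecreasing_emeasurable.

(** * Tails, and the supremum of tail ratios *)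

Section tails.
Context d {T : measurableType d} {R : realType}.
Variable P : probability T R.
Implicit Types X Y : {mfun T >-> R}.

Lemma measurable_gt X (x : R) : measurable [set w | x < X w].
Proof.
have := measurable_funPTI X (measurable_itv `]x, +oo[).
by congr measurable; apply/seteqP; split => w /=;
  rewrite in_itv/= andbT.
Qed.

Lemma tailE X (x : R) : (tail P X x)%:E = P [set w | x < X w].
Proof.
rewrite /tail /ccdf /distribution /pushforward fineK; last first.
  by apply: fin_num_measure; exact: measurable_funPTI.
by congr (P _); apply/seteqP; split => w /=; rewrite in_itv/= andbT.
Qed.

Lemma tail_ge0 X x : 0 <= tail P X x.
Proof. exact: fine_ge0. Qed.

Lemma tail_le1 X x : tail P X x <= 1.
Proof.
by rewrite -lee_fin tailE; exact: probability_le1 (measurable_gt X x).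
Qed.

Lemma tail_nincr X : {homo tail P X : x y /~ x <= y}.
Proof.
move=> x y xy; rewrite -lee_fin !tailE le_measure ?inE//; try exact: measurable_gt.
by move=> w /=; exact: le_lt_trans.
Qed.

Lemma measurable_tail X : measurable_fun setT (tail P X).
Proof. by apply: nonincreasing_measurable => // x y; exact: tail_nincr. Qed.

Lemma tail_le X Y x : {ae P, forall w, X w <= Y w} -> tail P X x <= tail P Y x.
Proof.
move=> XY; rewrite -lee_fin !tailE.
have [N [mN N0 HN]] := XY.
rewrite -[leRHS]adde0 -N0; apply: le_trans (measureU2 P (measurable_gt Y x) mN).
rewrite le_measure ?inE//; first exact: measurable_gt.
  by apply: measurableU => //; exact: measurable_gt.
move=> w /= xX; have [XYw|XYw] := pselect (X w <= Y w).
  by left; exact: lt_le_trans XYw.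
by right; exact: HN.
Qed.

End tails.

Section tail_ratio.
Context d {T : measurableType d} {R : realType}.
Variables (P : probability T R) (V : {mfun T >-> R}).
Hypothesis V_gt0 : forall x, 0 < tail P V x.

(** Extending [tail_ratio_sup] by [0] to [v <= 0] makes it nondecreasing on the whole line, hence
    measurable, and keeps the bound on products valid when a factor vanishes. *)
Definition ratio_sup (v : R) : \bar R :=
  if 0 < v then tail_ratio_sup P V v else 0%E.

Lemma ratio_supP (x v : R) : 0 < x -> 0 < v ->
  ((tail P V (x / v) / tail P V x)%:E <= ratio_sup v)%E.
Proof.
move=> x0 v0; rewrite /ratio_sup v0; apply: ereal_sup_ubound.
by exists x => //=; rewrite in_itv/= x0.
Qed.

Lemma ratio_sup_le (v : R) (z : \bar R) : 0 < v ->
  (forall x, 0 < x -> ((tail P V (x / v) / tail P V x)%:E <= z)%E) ->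
  (ratio_sup v <= z)%E.
Proof.
move=> v0 H; rewrite /ratio_sup v0; apply: ge_ereal_sup => _ [x /= x0 <-].
by apply: H; move: x0; rewrite in_itv/= andbT.
Qed.

Lemma ratio_sup_ge0 v : (0 <= ratio_sup v)%E.
Proof.
have [v0|v0] := ltP 0 v; last by rewrite /ratio_sup ltNge v0.
apply: le_trans (ratio_supP ltr01 v0).
by rewrite lee_fin divr_ge0// tail_ge0.
Qed.

Lemma ratio_sup_ndecr : {homo ratio_sup : u v / u <= v >-> (u <= v)%E}.
Proof.
move=> u v uv; have [u0|u0] := ltP 0 u; last first.
  by rewrite {1}/ratio_sup ltNge u0 ratio_sup_ge0.
have v0 := lt_le_trans u0 uv.
apply: ratio_sup_le => // x x0; apply: le_trans (ratio_supP x0 v0).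
rewrite lee_fin ler_pM2r ?invr_gt0//; apply: tail_nincr.
by rewrite ler_pM2l// lef_pV2.
Qed.

Lemma measurable_ratio_sup : measurable_fun setT ratio_sup.
Proof. by apply: nondecreasing_emeasurable => u v; exact: ratio_sup_ndecr. Qed.

(** Passing through [x / u] factors the ratio. Submultiplicativity carries the integrability
    assumption from [Y] to products of independent copies. *)
Lemma ratio_supM (u v : R) : 0 < u -> 0 < v ->
  (ratio_sup (u * v) <= ratio_sup u * ratio_sup v)%E.
Proof.
move=> u0 v0; apply: ratio_sup_le; first exact: mulr_gt0.
move=> x x0; have xu0 : 0 < x / u by exact: divr_gt0.
have -> : tail P V (x / (u * v)) / tail P V x =
    (tail P V (x / u) / tail P V x) * (tail P V (x / u / v) / tail P V (x / u)).
  have -> : x / (u * v) = x / u / v by rewrite invfM mulrA.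
  by field; rewrite !gt_eqF.
rewrite EFinM; apply: lee_pmul; rewrite ?lee_fin ?divr_ge0 ?tail_ge0//.
- exact: ratio_supP.
- exact: ratio_supP.
Qed.

Lemma ratio_sup1 : (ratio_sup 1 <= 1)%E.
Proof.
by apply: ratio_sup_le => // x x0; rewrite divr1 divff// gt_eqF.
Qed.

End tail_ratio.

Lemma cvg_sum_ord0 {R : realType} (n : nat) (f : nat -> R -> R) :
  (forall k, (k < n)%N -> f k x @[x --> +oo] --> 0) ->
  \sum_(k < n) f k x @[x --> +oo] --> 0.
Proof.
elim: n => [_|n IH fn]; first by under eq_fun do rewrite big_ord0; exact: cvg_cst.
have H1 : \sum_(k < n) f k x @[x --> +oo] --> 0.
  by apply: IH => k kn; apply: fn; exact: ltnW.
have H2 : \sum_(k < n) f k x + f n x @[x --> +oo] --> (0 + 0 : R).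
  exact: cvgD H1 (fn n (ltnSn n)).
rewrite addr0 in H2; apply: cvg_trans H2; apply: near_eq_cvg.
by apply: nearW => x; rewrite big_ord_recr.
Qed.

(** * The weighted sum: a single large term *)

Section perpetuity.
Context d {T : measurableType d} {R : realType}.
Variables (P : probability T R) (X Y : {mfun T >-> R})
  (Xs Ys : nat -> {mfun T >-> R}).
Let Z i := rvpair (Xs i) (Ys i).
Hypotheses (indep : mutually_independent P Z)
  (ident : forall i, same_law P (Z i) (rvpair X Y))
  (X_ge0 : {ae P, forall w, 0 <= X w}) (Y_ge0 : {ae P, forall w, 0 <= Y w}).

Lemma measurable_rvpair (U V : {mfun T >-> R}) :
  measurable_fun setT (rvpair U V).
Proof. exact: measurable_fun_pair. Qed.

Let mZ i : measurable_fun setT (Z i). Proof. exact: measurable_rvpair. Qed.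

Lemma same_law_ae (U V : T -> R * R) (C : set (R * R)) :
  measurable_fun setT U -> measurable_fun setT V -> same_law P U V ->
  measurable C -> {ae P, forall w, C (V w)} -> {ae P, forall w, C (U w)}.
Proof.
move=> mU mV UV mC CV.
have mpre (W : T -> R * R) : measurable_fun setT W -> measurable (W @^-1` ~` C).
  by move=> mW; rewrite -[X in measurable X]setTI; apply: mW => //; exact: measurableC.
apply/(negligibleP _ (mpre U mU)).
by rewrite [LHS]UV; [exact/(negligibleP _ (mpre V mV))|exact: measurableC].
Qed.

Lemma Xs_ge0 i : {ae P, forall w, 0 <= Xs i w}.
Proof.
have mC : measurable [set p : R * R | 0 <= p.1].
  rewrite -[X in measurable X]setTI.
  rewrite (_ : [set p | _] = fst @^-1` `[0, +oo[%classic).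
    exact: measurable_fst.
  by apply/seteqP; split => p /=; rewrite in_itv/= andbT.
exact: (same_law_ae (mZ i) (measurable_rvpair X Y) (ident i) mC).
Qed.

Lemma Ys_ge0 i : {ae P, forall w, 0 <= Ys i w}.
Proof.
have mC : measurable [set p : R * R | 0 <= p.2].
  rewrite -[X in measurable X]setTI.
  rewrite (_ : [set p | _] = snd @^-1` `[0, +oo[%classic).
    exact: measurable_snd.
  by apply/seteqP; split => p /=; rewrite in_itv/= andbT.
exact: (same_law_ae (mZ i) (measurable_rvpair X Y) (ident i) mC).
Qed.

Definition prodY (k : nat) (w : T) : R := \prod_(j < k) Ys j w.

Lemma prodYS k w : prodY k.+1 w = prodY k w * Ys k w.
Proof. by rewrite /prodY big_ord_recr. Qed.

Lemma prodY_ge0 : {ae P, forall w k, 0 <= prodY k w}.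
Proof.
have : {ae P, forall w i, 0 <= Ys i w} by apply/ae_foralln => i; exact: Ys_ge0.
by apply: filterS => w H k; apply: prodr_ge0 => j _; exact: H.
Qed.

Lemma measurable_prodY k : measurable_fun setT (prodY k).
Proof. by apply: measurable_prod => j _. Qed.

Lemma past_Xs k i : (i < k)%N ->
  measurable_fun [set: g_sigma_algebraType (past Z k)] (Xs i).
Proof.
move=> ik; have H := @past_coordinate _ _ _ Z _ _ ik.
exact: (@measurableT_comp _ _ _ (g_sigma_algebraType (past Z k)) _ _ fst setT (Z i)).
Qed.

Lemma past_Ys k i : (i < k)%N ->
  measurable_fun [set: g_sigma_algebraType (past Z k)] (Ys i).
Proof.
move=> ik; have H := @past_coordinate _ _ _ Z _ _ ik.
exact: (@measurableT_comp _ _ _ (g_sigma_algebraType (past Z k)) _ _ snd setT (Z i)).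
Qed.

Lemma past_prodY k m : (m <= k)%N ->
  measurable_fun [set: g_sigma_algebraType (past Z k)] (prodY m).
Proof.
move=> mk; apply: measurable_prod => j _; apply: past_Ys.
exact: leq_trans (ltn_ord j) mk.
Qed.

(** The factors are grouped by independence: [prodY k] belongs to the past, and [Xs k * Ys k], whose
    own factors may be dependent, is independent of it. *)
Definition term (k : nat) (w : T) : R := prodY k w * (Xs k w * Ys k w).

Lemma measurable_term k : measurable_fun setT (term k).
Proof.
apply: measurable_funM; first exact: measurable_prodY.
exact: measurable_funM.
Qed.

Lemma measurable_term_gt k (x : R) : measurable [set w | x < term k w].
Proof.
rewrite (_ : [set w | _] = setT `&` term k @^-1` `]x, +oo[%classic).
  by apply: measurable_term => //; exact: measurable_itv.
by rewrite setTI; apply/seteqP; split => w /=; rewrite in_itv/= andbT.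
Qed.

Lemma past_term k i : (i < k)%N ->
  measurable_fun [set: g_sigma_algebraType (past Z k)] (term i).
Proof.
move=> ik; apply: measurable_funM; first by apply: past_prodY; exact: ltnW.
by apply: measurable_funM; [exact: past_Xs|exact: past_Ys].
Qed.

Lemma past_term_gt k i (x : R) : (i < k)%N ->
  <<s past Z k >> [set w | x < term i w].
Proof.
move=> ik; rewrite (_ : [set w | _] = setT `&` term i @^-1` `]x, +oo[%classic).
  by apply: (past_term ik) => //; exact: measurable_itv.
by rewrite setTI; apply/seteqP; split => w /=; rewrite in_itv/= andbT.
Qed.

Let H := tail P (X * Y).

(** For [x > 0] and [u >= 0], the conditional probability of [x < term k] given [prodY k = u]; at
    [u = 0] the term cannot exceed [x]. *)
Definition scaled_tail (x u : R) : R := if 0 < u then H (x / u) else 0.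

Lemma scaled_tail_ge0 x u : 0 <= scaled_tail x u.
Proof. by rewrite /scaled_tail; case: ifP => // _; exact: tail_ge0. Qed.

Lemma scaled_tail_le1 x u : scaled_tail x u <= 1.
Proof. by rewrite /scaled_tail; case: ifP => // _; exact: tail_le1. Qed.

Lemma measurable_scaled_tail x : 0 < x -> measurable_fun setT (scaled_tail x).
Proof.
move=> x0; apply: nondecreasing_measurable => // u v uv.
rewrite {1}/scaled_tail; case: ifPn => [u0|_]; last exact: scaled_tail_ge0.
rewrite /scaled_tail (lt_le_trans u0 uv); apply: tail_nincr.
by rewrite ler_pM2l// lef_pV2 ?posrE// (lt_le_trans u0 uv).
Qed.

(** Conditioning on the past. Allowing an event [E] of the past gives the law of one term restricted
    to the event that an earlier term is large. *)
Lemma term_probE k (E : set T) (x : R) : 0 < x ->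
  <<s past Z k >> E -> measurable E ->
  P (E `&` [set w | x < term k w]) =
  (\int[P]_w (\1_E w * scaled_tail x (prodY k w))%:E)%E.
Proof.
move=> x0 sE mE.
pose I (y : R) := \1_(`]y, +oo[%classic : set R) : R -> R.
have mI y : measurable_fun setT (I y).
  have my : measurable (`]y, +oo[%classic : set R) by exact: measurable_itv.
  exact: measurable_indic.
have IE y z : I y z = (y < z)%R%:R.
  by rewrite /I indicE; congr (_%:R); congr nat_of_bool; apply/idP/idP;
    rewrite inE/= in_itv/= andbT.
(* The past enters as one pair of reals: [E] is encoded by its indicator and recovered by the factor
   [I 0] in [h]. *)
pose U w : R * R := (\1_E w, prodY k w).
have mUp : measurable_fun [set: g_sigma_algebraType (past Z k)] U.
  apply: measurable_fun_pair; last exact: past_prodY.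
  by apply: (@measurable_indic _ (g_sigma_algebraType (past Z k))).
have mU : measurable_fun setT U.
  by apply: measurable_fun_pair; [exact: measurable_indic|exact: measurable_prodY].
have indUZ A B : measurable A -> measurable B ->
    P (U @^-1` A `&` Z k @^-1` B) = (P (U @^-1` A) * P (Z k @^-1` B))%E.
  move=> mA mB; apply: (past_independent mZ indep) => //.
  by have := mUp measurableT A mA; rewrite setTI.
pose h (p : (R * R) * (R * R)) : R :=
  I 0 p.1.1 * I x (p.1.2 * (p.2.1 * p.2.2)).
have mprod : measurable_fun setT
    (fun p : (R * R) * (R * R) => p.1.2 * (p.2.1 * p.2.2)).
  apply: measurable_funM; first exact: (measurableT_comp measurable_snd measurable_fst).
  apply: measurable_funM; first exact: (measurableT_comp measurable_fst measurable_snd).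
  exact: (measurableT_comp measurable_snd measurable_snd).
have mh : measurable_fun setT h.
  apply: measurable_funM; last exact: measurableT_comp.
  apply: measurableT_comp => //.
  exact: (measurableT_comp measurable_fst measurable_fst).
have h0 p : (0 <= (h p)%:E)%E by rewrite lee_fin /h !IE mulr_ge0.
have mhE : measurable_fun setT (EFin \o h) by exact/measurable_EFinP.
have mEx : measurable (E `&` [set w | x < term k w]).
  by apply: measurableI => //; exact: measurable_term_gt.
transitivity (\int[P]_w (h (U w, Z k w))%:E)%E.
  rewrite -[X in P X]setIT -integral_indic//; apply: eq_integral => w _.
  rewrite /h !IE /U /=; congr EFin; rewrite !indicE in_setI.
  rewrite (_ : (w \in [set w | x < term k w]) = (x < term k w)); last first.
    by apply/idP/idP; rewrite inE.
  by case: (w \in E); rewrite /= ?ltr01 ?ltxx ?mul1r ?mul0r.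
rewrite (ge0_integral_independent mU (mZ k) indUZ mhE)//.
have inner w : 0 <= prodY k w -> (\int[P]_w' (h (U w, Z k w'))%:E =
    (\1_E w * scaled_tail x (prodY k w))%:E)%E.
  move=> p0; have mhU : measurable_fun setT (fun z => (h (U w, z))%:E).
    exact: (measurableT_comp mhE).
  rewrite (same_law_integral (mZ k) (measurable_rvpair X Y) (ident k) mhU)//.
  have -> : \1_E w = (0 < (\1_E w : R))%R%:R :> R.
    by rewrite indicE; case: (w \in E); rewrite ?ltr01 ?ltxx.
  move: p0; rewrite le_eqVlt => /predU1P[p0|p0].
    rewrite /scaled_tail -p0 ltxx mulr0; apply: integral0_eq => z _.
    by rewrite /h !IE /U /= -p0 mul0r (ltNge x) (ltW x0) mulr0.
  rewrite /scaled_tail p0 EFinM.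
  have mG := measurable_gt (X * Y) (x / prodY k w).
  have -> : ((H (x / prodY k w))%:E =
      \int[P]_z (\1_[set z | x / prodY k w < (X * Y) z] z)%:E)%E.
    by rewrite tailE integral_indic// setIT.
  rewrite -ge0_integralZl//; last first.
    by apply/measurable_EFinP; exact: measurable_indic.
  apply: eq_integral => z _; rewrite -EFinM /h !IE /U /= indicE; congr (_ * _%:R)%:E.
  rewrite (_ : (z \in _) = (x / prodY k w < (X * Y) z)); last first.
    by apply/idP/idP; rewrite inE.
  by rewrite ltr_pdivrMr// mulrC.
have mint : measurable_fun setT (fun w => \int[P]_w' (h (U w, Z k w'))%:E)%E.
  have mhZ : measurable_fun setT (fun q : (R * R) * T => (h (q.1, Z k q.2))%:E).
    apply: (measurableT_comp mhE); apply: measurable_fun_pair => //.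
    exact: (measurableT_comp (mZ k) measurable_snd).
  have mq := measurable_fun_fubini_tonelli_F (m2 := P) _ mhZ (fun q => h0 _).
  exact: (measurableT_comp mq mU).
apply: ge0_ae_eq_integral => //.
- apply/measurable_EFinP; apply: measurable_funM; first exact: measurable_indic.
  exact: (measurableT_comp (measurable_scaled_tail x0) (measurable_prodY k)).
- by move=> w _; apply: integral_ge0 => z _; exact: h0.
- by move=> w _; rewrite lee_fin mulr_ge0// scaled_tail_ge0.
- by apply: filterS prodY_ge0 => w p0 _; exact: inner.
Qed.

Lemma prodY_independent k (A : set R) (B : set (R * R)) :
  measurable A -> measurable B ->
  P (prodY k @^-1` A `&` Z k @^-1` B) =
  (P (prodY k @^-1` A) * P (Z k @^-1` B))%E.
Proof.
move=> mA mB; apply: (past_independent mZ indep) => //.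
by have := @past_prodY k k (leqnn k) measurableT A mA; rewrite setTI.
Qed.

Let K := ratio_sup P (X * Y).
Hypotheses (H_gt0 : forall x, 0 < H x) (KY : (\int[P]_w K (Y w) < +oo)%E).

Let mK : measurable_fun setT K. Proof. exact: measurable_ratio_sup. Qed.
Let K_ge0 v : (0 <= K v)%E. Proof. exact: ratio_sup_ge0. Qed.

(** By submultiplicativity and independence each new factor multiplies the integral by at most that
    of [K (Y)]. *)
Lemma integral_ratio_sup_prodY k : (\int[P]_w K (prodY k w) < +oo)%E.
Proof.
have mKp m : measurable_fun setT (fun w => K (prodY m w)).
  exact: (measurableT_comp mK (measurable_prodY m)).
elim: k => [|k IH].
  apply: (@le_lt_trans _ _ (\int[P]_w (1 : \bar R))%E); last first.
    by rewrite integral_cst//= mul1e probability_setT ltry.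
  apply: ge0_le_integral => // w _.
  by rewrite /prodY big_ord0; exact: ratio_sup1.
pose h (p : R * (R * R)) := (K p.1 * K p.2.2)%E.
have mh : measurable_fun setT h.
  apply: emeasurable_funM; first exact: (measurableT_comp mK measurable_fst).
  apply: (measurableT_comp mK).
  exact: (measurableT_comp measurable_snd measurable_snd).
have h0 p : (0 <= h p)%E by exact: mule_ge0.
apply: (@le_lt_trans _ _ (\int[P]_w h (prodY k w, Z k w))%E).
  apply: ae_ge0_le_integral => //.
    apply: (measurableT_comp mh).
    by apply: measurable_fun_pair => //; exact: measurable_prodY.
  apply: filterS2 prodY_ge0 (Ys_ge0 k) => w p0 y0 _; rewrite prodYS /h /=.
  move: (p0 k) y0; rewrite le_eqVlt => /predU1P[<-|pk].
    by rewrite mul0r {1}/K /ratio_sup ltxx mule_ge0.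
  rewrite le_eqVlt => /predU1P[<-|yk].
    by rewrite mulr0 {1}/K /ratio_sup ltxx mule_ge0.
  exact: ratio_supM.
rewrite (ge0_integral_independent (measurable_prodY k) (mZ k)
  (@prodY_independent k) mh h0).
have mK2 : measurable_fun setT (fun z : R * R => K z.2).
  exact: (measurableT_comp mK measurable_snd).
have inner w : (\int[P]_w' h (prodY k w, Z k w') =
    K (prodY k w) * \int[P]_w' K (Y w'))%E.
  have mKZ : measurable_fun setT (fun w => K (Z k w).2).
    exact: (measurableT_comp mK2 (mZ k)).
  transitivity (K (prodY k w) * \int[P]_w' K (Z k w').2)%E.
    exact: (ge0_integralZl P measurableT mKZ (fun w' _ => K_ge0 _) (K_ge0 _)).
  congr (_ * _)%E.
  exact: (same_law_integral (mZ k) (measurable_rvpair X Y) (ident k) mK2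
    (fun z => K_ge0 z.2)).
under eq_integral do rewrite inner.
have iY0 : (0 <= \int[P]_w K (Y w))%E by apply: integral_ge0 => w _; exact: K_ge0.
have ip0 : (0 <= \int[P]_w K (prodY k w))%E by apply: integral_ge0 => w _; exact: K_ge0.
rewrite (ge0_integralZr P measurableT (mKp k) (fun w _ => K_ge0 _) iY0).
by apply: (lte_mul_pinfty ip0 _ KY); rewrite (ge0_fin_numE ip0).
Qed.

Definition dom (k : nat) (w : T) : R := fine (K (prodY k w)).

Lemma dom_ge0 k w : 0 <= dom k w. Proof. exact: fine_ge0. Qed.

Lemma integrable_ratio_sup k : P.-integrable setT (fun w => K (prodY k w)).
Proof.
apply/integrableP; split.
  exact: (measurableT_comp mK (measurable_prodY k)).
by under eq_integral do rewrite gee0_abs//; exact: integral_ratio_sup_prodY.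
Qed.

Lemma domE k : {ae P, forall w, K (prodY k w) = (dom k w)%:E}.
Proof.
have := integrable_ae measurableT (integrable_ratio_sup k).
by apply: filterS => w /(_ I) f; rewrite /dom fineK.
Qed.

Lemma integrable_dom k : P.-integrable setT (EFin \o dom k).
Proof.
apply/integrableP; split.
  apply/measurable_EFinP; apply: measurableT_comp => //.
  exact: (measurableT_comp mK (measurable_prodY k)).
apply: le_lt_trans (integral_ratio_sup_prodY k).
apply: ae_ge0_le_integral => //.
- apply: measurableT_comp => //; apply/measurable_EFinP.
  apply: measurableT_comp => //.
  exact: (measurableT_comp mK (measurable_prodY k)).
- exact: (measurableT_comp mK (measurable_prodY k)).
- apply: filterS (domE k) => w -> _.
  by rewrite /= ger0_norm// dom_ge0.
Qed.

Lemma scaled_tail_dom k : {ae P, forall w x, 0 < x ->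
  scaled_tail x (prodY k w) / H x <= dom k w}.
Proof.
apply: filterS (domE k) => w Kw x x0; rewrite /scaled_tail.
case: ifPn => p0; last by rewrite mul0r dom_ge0.
rewrite -lee_fin -Kw; exact: ratio_supP.
Qed.

(** Conditioning on the past of [j] leaves the indicator of a large earlier term times
    [scaled_tail x (prodY j) / H x]: the indicator tends to [0] pointwise and the ratio is dominated
    by [dom j]. *)
Lemma joint_term_small i j : (i < j)%N ->
  fine (P ([set w | x < term i w] `&` [set w | x < term j w])) / H x
    @[x --> +oo] --> 0.
Proof.
move=> ij; pose m (x : R) := Num.max 1 x.
have m0 x : 0 < m x by rewrite lt_max ltr01.
pose E x := [set w | m x < term i w].
pose f x w := (\1_(E x) w : R) * scaled_tail (m x) (prodY j w) / H (m x).
have mE x : measurable (E x) by exact: measurable_term_gt.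
have ms x : measurable_fun setT (fun w => scaled_tail (m x) (prodY j w)).
  exact: (measurableT_comp (measurable_scaled_tail (m0 x)) (measurable_prodY j)).
have mI x : measurable_fun setT (\1_(E x) : T -> R) by exact: measurable_indic.
have mf x : measurable_fun setT (f x).
  by apply: measurable_funM => //; exact: measurable_funM.
have I01 (A : set T) w : 0 <= (\1_A w : R) <= 1.
  by rewrite indicE; case: (w \in A); rewrite /= ?lexx ?ler01.
have f0 : (\int[P]_w f x w) @[x --> +oo] --> \int[P]_w (0 : R).
  apply: (@dominated_cvg_pinfty _ _ _ P f (fun=> 0) (dom j) 1) => //.
  - apply/aeW => w; have : \forall x \near +oo, term i w <= x.
      exact: nbhs_pinfty_ge (num_real _).
    move=> nx; apply: cvg_near_cst; apply: filterS nx => x tx.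
    rewrite /f indicE memNset ?mul0r// /E /=; apply/negP.
    by rewrite -leNgt le_max tx orbT.
  - exact: integrable_dom.
  - apply: filterS (scaled_tail_dom j) => w sd x x1.
    rewrite /f; have /andP[I0 I1] := I01 (E x) w.
    have s0 := scaled_tail_ge0 (m x) (prodY j w).
    rewrite ger0_norm ?divr_ge0 ?mulr_ge0 ?(ltW (H_gt0 _))//.
    apply: le_trans (sd (m x) (m0 x)).
    by rewrite ler_pM2r ?invr_gt0// ler_piMl.
rewrite Rintegral_cst// mul0r in f0.
apply: cvg_trans f0; apply: near_eq_cvg; near=> x.
have mx : m x = x by apply/max_idPr; near: x; exact: nbhs_pinfty_ge (num_real _).
have x0 : 0 < x by rewrite -mx.
have mterm : measurable [set w | x < term i w] by exact: measurable_term_gt.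
rewrite (term_probE x0 (past_term_gt x ij) mterm).
have ib : P.-integrable setT
    (EFin \o (fun w => \1_[set w | x < term i w] w * scaled_tail x (prodY j w))).
  apply: (ae_le_integrable (g := cst 1)).
  - by have := mI x; have := ms x; rewrite /E mx => ? ?; exact: measurable_funM.
  - exact: finite_measure_integrable_cst.
  - apply/aeW => w; have /andP[I0 I1] := I01 [set w | x < term i w] w.
    by rewrite ger0_norm ?mulr_ge0 ?scaled_tail_ge0// mulr_ile1 ?scaled_tail_ge0 ?scaled_tail_le1.
rewrite -/(Rintegral P setT (fun w => _)) -RintegralZr//.
by apply: eq_Rintegral => w _; rewrite /f /E mx.
Unshelve. all: end_near. Qed.

Variable (n : nat) (alpha : R).
Let S := weighted_sum Xs Ys n.
Let M := tail P S.
Hypotheses (n_ge1 : (1 <= n)%N) (M_gt0 : forall x, 0 < M x)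
  (M_RV : forall y, 0 < y -> M (x * y) / M x @[x --> +oo] --> y `^ (- alpha)).

Lemma weighted_sumE w : S w = \sum_(i < n) term i w.
Proof.
have prodE m : (\prod_(j < m) Ys j : {mfun T >-> R}) w = prodY m w.
  by rewrite /prodY; elim/big_rec2: _ => //= j y ? _ <-.
rewrite /S /weighted_sum mfun_sum; apply: eq_bigr => i _.
transitivity (Xs i w * (\prod_(j < i.+1) Ys j : {mfun T >-> R}) w) => //.
by rewrite prodE prodYS /term; ring.
Qed.

Lemma term_ge0 : {ae P, forall w k, 0 <= term k w}.
Proof.
have Ys0 : {ae P, forall w i, 0 <= Ys i w} by apply/ae_foralln => i; exact: Ys_ge0.
have Xs0 : {ae P, forall w i, 0 <= Xs i w} by apply/ae_foralln => i; exact: Xs_ge0.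
apply: filterS2 Xs0 Ys0 => w X0 Y0 k; rewrite mulr_ge0 ?mulr_ge0//.
by apply: prodr_ge0 => j _.
Qed.

Let p (A : set T) : R := fine (P A).
Let E k x := [set w | x < term k w].
Let pE k x := p (E k x).
Let J x := \sum_(k < n) \sum_(i < k) p (E i x `&` E k x).

Let mE k x : measurable (E k x). Proof. exact: measurable_term_gt. Qed.

Let p_EFin A : measurable A -> (p A)%:E = P A.
Proof. by move=> mA; rewrite fineK// fin_num_measure. Qed.

Let p_ge0 A : 0 <= p A. Proof. exact: fine_ge0. Qed.

Let p_setU A B : measurable A -> measurable B -> p (A `|` B) <= p A + p B.
Proof.
move=> mA mB; rewrite -lee_fin EFinD !p_EFin//; last exact: measurableU.
exact: measureU2.
Qed.

Let p_bigU m (F : nat -> set T) : (forall i, measurable (F i)) ->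
  p (\big[setU/set0]_(i < m) F i) <= \sum_(i < m) p (F i).
Proof.
move=> mF; elim: m => [|m IH]; first by rewrite !big_ord0 /p measure0.
rewrite !big_ord_recr/=; apply: le_trans (p_setU _ _) _ => //.
  exact: bigsetU_measurable.
by rewrite lerD2r.
Qed.

Let bonferroni m (F : nat -> set T) : (forall i, measurable (F i)) ->
  \sum_(k < m) p (F k) <=
  p (\big[setU/set0]_(k < m) F k) + \sum_(k < m) \sum_(i < k) p (F i `&` F k).
Proof.
move=> mF; elim: m => [|m IH]; first by rewrite !big_ord0 addr0.
rewrite !big_ord_recr/=; set U := \big[setU/set0]_(k < m) F k.
have mU : measurable U by exact: bigsetU_measurable.
have UF : p (U `|` F m) = p U + p (F m) - p (U `&` F m).
  apply: EFin_inj; rewrite EFinB EFinD !p_EFin//; [|exact: measurableI|exact: measurableU].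
  by rewrite measureUfinl// (le_lt_trans (probability_le1 P mU))// ltry.
have UI : p (U `&` F m) <= \sum_(i < m) p (F i `&` F m).
  rewrite /U big_distrl/=; apply: (@p_bigU _ (fun i => F i `&` F m)) => i.
  exact: measurableI.
rewrite UF; move: IH UI; rewrite -/U; lra.
Qed.

(** The terms are nonnegative almost surely, so the sum exceeds [x] as soon as one term does;
    Bonferroni's inequality for this union costs the pairs counted in [J]. *)
Lemma sum_terms_le x : \sum_(k < n) pE k x <= M x + J x.
Proof.
apply: le_trans (bonferroni n (fun k => mE k x)) _; rewrite lerD2r.
have [N [mN N0 HN]] := term_ge0.
have mU : measurable (\big[setU/set0]_(k < n) E k x) by exact: bigsetU_measurable.
rewrite -lee_fin p_EFin// /M tailE -[leRHS]adde0 -N0.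
apply: le_trans (measureU2 P (measurable_gt S x) mN).
rewrite le_measure ?inE//; first by apply: measurableU => //; exact: measurable_gt.
rewrite -(bigcup_mkord n (fun k => E k x)) => w [k /= kn xk].
have [t0|t0] := pselect (forall k, 0 <= term k w); last by right; exact: HN.
left; rewrite /= weighted_sumE (bigD1 (Ordinal kn))//=.
by apply: lt_le_trans xk _; rewrite lerDl sumr_ge0.
Qed.

(** With [eta = (y - 1) / n * x], if all terms are at most [x] and at most one exceeds [eta], the
    sum is at most [x + (n - 1) * eta], which is below [y * x]. *)
Lemma tail_sum_le x y : 0 < x -> 1 < y ->
  M (x * y) <= \sum_(k < n) pE k x + J ((y - 1) / n%:R * x).
Proof.
move=> x0 y1; set eta := (y - 1) / n%:R * x.
have n0 : (0 : R) < n%:R by rewrite ltr0n.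
have eta0 : 0 < eta by rewrite mulr_gt0// divr_gt0// subr_gt0.
pose U1 := \big[setU/set0]_(k < n) E k x.
pose U2 := \big[setU/set0]_(k < n) \big[setU/set0]_(i < k) (E i eta `&` E k eta).
have mU2k k : measurable (\big[setU/set0]_(i < k) (E i eta `&` E k eta)).
  by apply: bigsetU_measurable => i _; exact: measurableI.
have mU1 : measurable U1 by exact: bigsetU_measurable.
have mU2 : measurable U2 by exact: bigsetU_measurable.
apply: (@le_trans _ _ (p (U1 `|` U2))).
  have mU12 : measurable (U1 `|` U2) by exact: measurableU.
  rewrite -lee_fin {1}/M tailE p_EFin//.
  rewrite le_measure ?inE//; first exact: measurable_gt.
  move=> w /=; rewrite weighted_sumE => xS; apply: contrapT => /not_orP[nU1 nU2].
  have le1 (k : 'I_n) : term k w <= x.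
    rewrite leNgt; apply/negP => xk; apply: nU1.
    rewrite /U1 -(bigcup_mkord n (fun k => E k x)).
    by exists (k : nat) => //=.
  have pair (i k : 'I_n) : (i < k)%N -> eta < term i w -> eta < term k w -> False.
    move=> ik ei ek; apply: nU2; rewrite /U2.
    rewrite -(bigcup_mkord n (fun k => \big[setU/set0]_(i < k) (E i eta `&` E k eta))).
    exists (k : nat) => //=.
    rewrite -(bigcup_mkord k (fun i => E i eta `&` E k eta)).
    by exists (i : nat).
  have netaE : n%:R * eta = (y - 1) * x by rewrite /eta; field; rewrite gt_eqF.
  move: xS; apply/negP; rewrite -leNgt.
  have [[k ek]|none] := pselect (exists k : 'I_n, eta < term k w).
    rewrite (bigD1 k)//=.
    have : \sum_(i < n | i != k) term i w <= \sum_(i < n | i != k) eta.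
      apply: ler_sum => i ik; rewrite leNgt; apply/negP => ei.
      move: ik; rewrite neq_ltn => /orP[ik|ki].
        exact: (pair i k).
      exact: (pair k i).
    rewrite [X in _ <= X -> _](_ : _ = n%:R * eta - eta); last first.
      have : \sum_(i < n) eta = n%:R * eta by rewrite sumr_const card_ord mulr_natl.
      by rewrite (bigD1 k)//=; lra.
    have := le1 k; rewrite netaE; lra.
  apply: (@le_trans _ _ (\sum_(i < n) eta)).
    apply: ler_sum => i _; rewrite leNgt; apply/negP => ei; apply: none.
    by exists i.
  by rewrite sumr_const card_ord -mulr_natl netaE; nra.
apply: le_trans (p_setU mU1 mU2) _; apply: lerD.
  exact: (@p_bigU _ (fun k => E k x)).
apply: le_trans (@p_bigU n (fun k => \big[setU/set0]_(i < k) (E i eta `&` E k eta)) mU2k) _.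
apply: ler_sum => k _.
apply: (@p_bigU _ (fun i => E i eta `&` E k eta)) => i; exact: measurableI.
Qed.

Lemma tail_term_le k x : (k < n)%N -> pE k x <= M x.
Proof.
move=> kn; have [N [mN N0 HN]] := term_ge0.
rewrite -lee_fin p_EFin// /M tailE -[leRHS]adde0 -N0.
apply: le_trans (measureU2 P (measurable_gt S x) mN).
rewrite le_measure ?inE//; first by apply: measurableU => //; exact: measurable_gt.
move=> w /= xk.
have [t0|t0] := pselect (forall k, 0 <= term k w); last by right; exact: HN.
left; rewrite /= weighted_sumE (bigD1 (Ordinal kn))//=.
by apply: lt_le_trans xk _; rewrite lerDl sumr_ge0.
Qed.

Lemma tail_termE k x : 0 < x -> pE k x = \int[P]_w scaled_tail x (prodY k w).
Proof.
move=> x0; have sT : <<s past Z k >> [set: T].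
  exact: (@measurableT _ (g_sigma_algebraType (past Z k))).
have := term_probE x0 sT measurableT; rewrite setTI => H1.
rewrite /pE /p H1 /Rintegral; congr fine; apply: eq_integral => w _.
by rewrite indicT mul1r.
Qed.

(** The empty product [prodY 0] is [1], so the first term already has tail [H]. This turns estimates
    relative to [H] into estimates relative to [M]. *)
Lemma product_tail_le x : 0 < x -> H x <= M x.
Proof.
move=> x0; apply: le_trans (tail_term_le x n_ge1); rewrite tail_termE//.
rewrite (_ : (fun w => _) = cst (H x)); last first.
  by apply/funext => w; rewrite /prodY big_ord0 /scaled_tail ltr01 divr1.
have P1 : fine (P [set: T]) = 1 by rewrite probability_setT.
by rewrite Rintegral_cst// P1 mulr1.
Qed.

Let J_small : J x / M x @[x --> +oo] --> 0.
Proof.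
have H1 : J x / H x @[x --> +oo] --> 0.
  under eq_fun => x do rewrite /J mulr_suml.
  apply: (cvg_sum_ord0 (f := fun k x => (\sum_(i < k) p (E i x `&` E k x)) / H x)).
  move=> k _; under eq_fun => x do rewrite mulr_suml.
  apply: (cvg_sum_ord0 (f := fun i x => p (E i x `&` E k x) / H x)) => i ik.
  exact: joint_term_small.
apply: squeeze_cvgr (cvg_cst 0) H1.
have J0 x : 0 <= J x by apply: sumr_ge0 => k _; apply: sumr_ge0.
near=> x; have x0 : 0 < x by [].
rewrite divr_ge0//= ?(ltW (M_gt0 _))// ler_wpM2l// lef_pV2 ?posrE//.
exact: product_tail_le.
Unshelve. all: end_near. Qed.

(* A single large summand: for [y > 1], [S > y * x] forces one term above [x] or
   two terms above a fixed multiple of [x], and the latter event is negligible. *)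
Lemma sum_terms_equiv :
  (\sum_(k < n) \int[P]_w scaled_tail x (prodY k w)) / M x @[x --> +oo] --> (1 : R).
Proof.
suff H1 : (\sum_(k < n) pE k x) / M x @[x --> +oo] --> (1 : R).
  apply: cvg_trans H1; apply: near_eq_cvg; near=> x.
  by congr (_ / _); apply: eq_bigr => k _; rewrite tail_termE.
apply/cvgrPdist_le => e e0.
(* Above [1], yet close enough to it that [y ^ (- alpha) >= 1 - e / 2]; the other half of [e] pays
   for the limit along [x * y] and for [J]. *)
pose y := expR (e / (2 * (1 + `|alpha|))).
have a1 : 0 < 1 + `|alpha| by rewrite ltr_pwDl.
have y1 : 1 < y by rewrite expR_gt1 divr_gt0// mulr_gt0.
have y0 : 0 < y := expR_gt0 _.
pose c := (y - 1) / n%:R.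
have n0 : (0 : R) < n%:R by rewrite ltr0n.
have c0 : 0 < c by rewrite divr_gt0// subr_gt0.
have ya : 1 - e / 2 <= y `^ (- alpha).
  rewrite /powR gt_eqF// expRK; apply: le_trans (expR_ge1Dx _).
  rewrite lerD2l mulNr lerN2 -[leRHS](_ : (1 + `|alpha|) * (e / (2 * (1 + `|alpha|))) = _).
    rewrite ler_wpM2r//; first by rewrite divr_ge0 ?mulr_ge0// ltW.
    by rewrite (le_trans (ler_norm _))// lerDr.
  by field; rewrite gt_eqF.
(* Regular variation of [M] makes up for the change of scale: [M (c * x) / M x] has a finite
   limit. *)
have Jc : J (c * x) / M x @[x --> +oo] --> 0.
  have cxoo : x * c @[x --> +oo] --> (+oo : set_system R).
    by apply: gt0_cvgMly c0 _; exact: cvg_id.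
  have H1 := cvg_comp _ _ cxoo J_small.
  have H2 : J (x * c) / M (x * c) * (M (x * c) / M x) @[x --> +oo]
      --> 0 * c `^ (- alpha).
    exact: cvgM H1 (M_RV c0).
  rewrite mul0r in H2.
  apply: cvg_trans H2; apply: near_eq_cvg; apply: nearW => x /=.
  by rewrite [c * x]mulrC; field; rewrite !gt_eqF.
have e40 : 0 < e / 4 by rewrite divr_gt0.
have n1 : \forall x \near +oo, `|y `^ (- alpha) - M (x * y) / M x| <= e / 4.
  by move/cvgrPdist_le : (M_RV y0); apply.
have n2 : \forall x \near +oo, `|0 - J (c * x) / M x| <= e / 4.
  by move/cvgrPdist_le : Jc; apply.
have n3 : \forall x \near +oo, `|0 - J x / M x| <= e / 4.
  by move/cvgrPdist_le : J_small; apply.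
near=> x.
have x0 : 0 < x by [].
have h1 : `|y `^ (- alpha) - M (x * y) / M x| <= e / 4 by near: x.
have h2 : `|0 - J (c * x) / M x| <= e / 4 by near: x.
have h3 : `|0 - J x / M x| <= e / 4 by near: x.
have U : (\sum_(k < n) pE k x) / M x <= 1 + J x / M x.
  rewrite -[X in X + _](divff (x := M x)) ?gt_eqF// -mulrDl ler_pM2r ?invr_gt0//.
  exact: sum_terms_le.
have L : M (x * y) / M x <= (\sum_(k < n) pE k x) / M x + J (c * x) / M x.
  rewrite -mulrDl ler_pM2r ?invr_gt0//; exact: tail_sum_le.
move: h1 h2 h3; rewrite !ler_norml => /andP[? ?] /andP[? ?] /andP[? ?].
apply/andP; split; lra.
Unshelve. all: end_near. Qed.

End perpetuity.

Section ae_eq_Rintegral.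
Context d {S : measurableType d} {R : realType}.
Variable nu : {measure set S -> \bar R}.

Lemma ae_eq_Rintegral (f g : S -> R) : measurable_fun setT f ->
  measurable_fun setT g -> {ae nu, forall s, f s = g s} ->
  \int[nu]_s f s = \int[nu]_s g s.
Proof.
move=> mf mg fg; rewrite /Rintegral; congr fine.
apply: ae_eq_integral => //; try exact/measurable_EFinP.
by apply: filterS fg => s -> .
Qed.

End ae_eq_Rintegral.

(** * Complex moments of products of independent copies of [Y] *)

Section product_moments.
Context d {T : measurableType d} {R : realType}.
Variables (P : probability T R) (X Y : {mfun T >-> R})
  (Xs Ys : nat -> {mfun T >-> R}).
Hypotheses (indep : mutually_independent P (fun i => rvpair (Xs i) (Ys i)))
  (ident : forall i, same_law P (rvpair (Xs i) (Ys i)) (rvpair X Y))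
  (Y_ge0 : {ae P, forall w, 0 <= Y w}).

Let prodY0 := prodY_ge0 ident Y_ge0.

Let mp k : measurable_fun setT (prodY Ys k). Proof. exact: measurable_prodY. Qed.

Lemma integral_prodYM (f g : R -> R) k : measurable_fun setT f ->
  measurable_fun setT g -> P.-integrable setT (EFin \o (f \o prodY Ys k)) ->
  P.-integrable setT (EFin \o (g \o Y)) ->
  P.-integrable setT (fun w => (f (prodY Ys k w) * g (Ys k w))%:E) /\
  \int[P]_w (f (prodY Ys k w) * g (Ys k w)) =
  \int[P]_w f (prodY Ys k w) * \int[P]_w g (Y w).
Proof.
move=> mf mg fi gi.
have mg2 : measurable_fun setT (fun z : R * R => g z.2) by exact: measurableT_comp.
have [gi' gE] := same_law_integrable (measurable_rvpair (Xs k) (Ys k))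
  (measurable_rvpair X Y) (ident k) mg2 gi.
have [fgi ->] := integral_independentM (mp k) (measurable_rvpair (Xs k) (Ys k))
  (@prodY_independent _ _ _ _ _ _ indep k) mf mg2 fi gi'.
by split=> //; rewrite gE.
Qed.

Variable a : R.
Hypotheses (a_gt0 : 0 < a).

Lemma integrable_prodY_powR k :
  P.-integrable setT (fun w => (Y w `^ a)%:E) ->
  P.-integrable setT (fun w => (prodY Ys k w `^ a)%:E).
Proof.
move=> iY; elim: k => [|k IH].
  rewrite (_ : (fun w => _) = EFin \o cst (1 : R)); last first.
    by apply/funext => w; rewrite /prodY big_ord0 powR1.
  exact: finite_measure_integrable_cst.
have mpow := measurable_powR a.
have [ik _] := @integral_prodYM (fun x => x `^ a) (fun x => x `^ a) k mpow mpow IH iY.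
apply: ae_le_integrable ik _.
  exact: (measurableT_comp mpow (mp k.+1)).
apply: filterS2 prodY0 (Ys_ge0 ident Y_ge0 k) => w p0 y0.
by rewrite prodYS powRM// ger0_norm// mulr_ge0// powR_ge0.
Qed.

Lemma measurable_powR_cos (b : R) :
  measurable_fun setT (fun x : R => x `^ a * cos (b * ln x)).
Proof.
apply: measurable_funM; first exact: measurable_powR.
exact: measurable_cosM.
Qed.

Lemma measurable_powR_sin (b : R) :
  measurable_fun setT (fun x : R => x `^ a * sin (b * ln x)).
Proof.
apply: measurable_funM; first exact: measurable_powR.
exact: measurable_sinM.
Qed.

(** Real part of the multiplicativity of [u ^ (a + i b)]. If a factor is [0] the rule for
    [ln (u * v)] fails, but both sides vanish because [a > 0]. *)
Lemma powR_cosM (b u v : R) : 0 <= u -> 0 <= v ->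
  (u * v) `^ a * cos (b * ln (u * v)) =
  u `^ a * cos (b * ln u) * (v `^ a * cos (b * ln v)) -
  u `^ a * sin (b * ln u) * (v `^ a * sin (b * ln v)).
Proof.
move=> u0 v0; rewrite powRM//.
move: u0; rewrite le_eqVlt => /predU1P[<-|u0]; first by rewrite powR0 ?gt_eqF//; ring.
move: v0; rewrite le_eqVlt => /predU1P[<-|v0]; first by rewrite powR0 ?gt_eqF//; ring.
by rewrite lnM ?posrE// mulrDr cosD; ring.
Qed.

Lemma powR_sinM (b u v : R) : 0 <= u -> 0 <= v ->
  (u * v) `^ a * sin (b * ln (u * v)) =
  u `^ a * cos (b * ln u) * (v `^ a * sin (b * ln v)) +
  u `^ a * sin (b * ln u) * (v `^ a * cos (b * ln v)).
Proof.
move=> u0 v0; rewrite powRM//.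
move: u0; rewrite le_eqVlt => /predU1P[<-|u0]; first by rewrite powR0 ?gt_eqF//; ring.
move: v0; rewrite le_eqVlt => /predU1P[<-|v0]; first by rewrite powR0 ?gt_eqF//; ring.
by rewrite lnM ?posrE// mulrDr sinD; ring.
Qed.

(** Independence factors the four real products of sines and cosines, which recombine as one complex
    multiplication per step of the induction. *)
Lemma mellin_prodY (b : R) k : P.-integrable setT (fun w => (Y w `^ a)%:E) ->
  Complex (\int[P]_w (prodY Ys k w `^ a * cos (b * ln (prodY Ys k w))))
          (\int[P]_w (prodY Ys k w `^ a * sin (b * ln (prodY Ys k w)))) =
  Complex (\int[P]_w (Y w `^ a * cos (b * ln (Y w))))
          (\int[P]_w (Y w `^ a * sin (b * ln (Y w)))) ^+ k.
Proof.
move=> iY.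
pose fc (x : R) := x `^ a * cos (b * ln x); pose fs (x : R) := x `^ a * sin (b * ln x).
have mfc : measurable_fun setT fc := measurable_powR_cos b.
have mfs : measurable_fun setT fs := measurable_powR_sin b.
have ic (V : T -> R) : measurable_fun setT V ->
    P.-integrable setT (fun w => (V w `^ a)%:E) ->
    P.-integrable setT (EFin \o (fc \o V)).
  move=> mV iV; apply: (@integrable_bounded_factor _ _ _ P (fun w => V w `^ a)
      (fun w => cos (b * ln (V w))) 1 iV).
    by apply: measurable_cosM; exact: measurableT_comp.
  by move=> s; exact: cos_max.
have is_ (V : T -> R) : measurable_fun setT V ->
    P.-integrable setT (fun w => (V w `^ a)%:E) ->
    P.-integrable setT (EFin \o (fs \o V)).
  move=> mV iV; apply: (@integrable_bounded_factor _ _ _ P (fun w => V w `^ a)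
      (fun w => sin (b * ln (V w))) 1 iV).
    by apply: measurable_sinM; exact: measurableT_comp.
  by move=> s; exact: sin_max.
have mY : measurable_fun setT Y by [].
elim: k => [|k IH].
  rewrite expr0.
  have P1 : fine (P [set: T]) = 1 by rewrite probability_setT.
  under eq_Rintegral do rewrite /prodY big_ord0 powR1 ln1 mulr0 cos0 mul1r.
  under [X in Complex _ X]eq_Rintegral do rewrite /prodY big_ord0 powR1 ln1 mulr0 sin0 mul1r.
  by rewrite !Rintegral_cst// P1 mulr1 mul0r.
have ip := integrable_prodY_powR k iY.
have [icc Ecc] := integral_prodYM mfc mfc (ic _ (mp k) ip) (ic _ mY iY).
have [ics Ecs] := integral_prodYM mfc mfs (ic _ (mp k) ip) (is_ _ mY iY).
have [isc Esc] := integral_prodYM mfs mfc (is_ _ (mp k) ip) (ic _ mY iY).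
have [iss Ess] := integral_prodYM mfs mfs (is_ _ (mp k) ip) (is_ _ mY iY).
have mcomp (f : R -> R) (V : T -> R) : measurable_fun setT f ->
    measurable_fun setT V -> measurable_fun setT (fun w => f (V w)).
  by move=> mf mV; exact: measurableT_comp.
rewrite exprSr -IH.
have -> : \int[P]_w (prodY Ys k.+1 w `^ a * cos (b * ln (prodY Ys k.+1 w))) =
    \int[P]_w (fc (prodY Ys k w) * fc (Ys k w) - fs (prodY Ys k w) * fs (Ys k w)).
  apply: ae_eq_Rintegral.
  - exact: (mcomp fc _ mfc (mp k.+1)).
  - by apply: measurable_funB; apply: measurable_funM; exact: mcomp.
  - apply: filterS2 prodY0 (Ys_ge0 ident Y_ge0 k) => w p0 y0.
    by rewrite prodYS powR_cosM.
have -> : \int[P]_w (prodY Ys k.+1 w `^ a * sin (b * ln (prodY Ys k.+1 w))) =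
    \int[P]_w (fc (prodY Ys k w) * fs (Ys k w) + fs (prodY Ys k w) * fc (Ys k w)).
  apply: ae_eq_Rintegral.
  - exact: (mcomp fs _ mfs (mp k.+1)).
  - by apply: measurable_funD; apply: measurable_funM; exact: mcomp.
  - apply: filterS2 prodY0 (Ys_ge0 ident Y_ge0 k) => w p0 y0.
    by rewrite prodYS powR_sinM.
by rewrite RintegralB// RintegralD// Ecc Ecs Esc Ess.
Qed.

End product_moments.

(** * A measure on the line is carried by its support *)

Section support.
Context {R : realType}.
Variable nu : {measure set R -> \bar R}.

(** The complement of the support is covered by the null intervals with rational endpoints, which
    are countably many; [unpickle] enumerates the pairs of endpoints. *)
Lemma ae_support : {ae nu, forall x : R, Defs.support nu x}.
Proof.
pose I (q : rat * rat) : set R := `]ratr q.1, ratr q.2[%classic.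
pose F n : set R := if @choice.unpickle (rat * rat)%type n is Some q then
  (if `[< nu (I q) = 0%E >] then I q else set0) else set0.
have Fneg n : nu.-negligible (F n).
  rewrite /F; case: choice.unpickle => [q|]; last exact: negligible_set0.
  case: asboolP => [q0|_]; last exact: negligible_set0.
  by apply/negligibleP => //; exact: measurable_itv.
apply: negligibleS (negligible_bigcup Fneg) => x /= nx.
move/existsNP : nx => [U] /not_implyP[oU] /not_implyP[Ux /negP].
rewrite -leNgt measure_le0 => /eqP U0.
have [e /= e0 eU] : \forall e \near 0^'+, ball x e `<=` U.
  exact: open_subball.
have [d d0 dU] : exists2 d : R, 0 < d & ball x d `<=` U.
  exists (e / 2); first by rewrite divr_gt0.
  apply: eU => //=; last by rewrite divr_gt0.
  by rewrite sub0r normrN gtr0_norm ?divr_gt0// ltr_pdivrMr// ltr_pMr// ltr1n.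
have xd1 : x - d < x by rewrite ltrBlDr ltrDl.
have xd2 : x < x + d by rewrite ltrDl.
have [p] := rat_in_itvoo xd1; rewrite in_itv/= => /andP[px1 px2].
have [q] := rat_in_itvoo xd2; rewrite in_itv/= => /andP[qx1 qx2].
exists (choice.pickle (p, q)); first exact: Logic.I.
rewrite /F choice.pickleK.
have IU : I (p, q) `<=` U.
  move=> y /=; rewrite /I /= in_itv/= => /andP[py yq]; apply: dU.
  by rewrite /ball /= ltr_norml; apply/andP; split; lra.
have q0 : nu (I (p, q)) = 0%E.
  apply: subset_measure0 IU U0 => //; first exact: measurable_itv.
  exact: open_measurable.
by rewrite asboolT//; rewrite /I /= in_itv/= px2 qx1.
Qed.

End support.

(** * A bounded kernel for the Sarmanov density *)

Section sarmanov_density.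
Context d {T : measurableType d} {R : realType}.
Variables (P : probability T R) (X Y : {mfun T >-> R})
  (phi1 phi2 : R -> R) (theta d1 : R).
Hypotheses (sarm : sarmanov P X Y phi1 phi2 theta)
  (phi1_lim : phi1 @ +oo --> d1) (F_gt0 : forall x, 0 < tail P X x).
Let F := distribution P X.
Let G := distribution P Y.

(** Positivity of the tail puts points of any set of full measure arbitrarily far out, so the limit
    [d1] of [phi1] can be read along such points. *)
Lemma ae_unbounded (Q : R -> Prop) (x : R) : {ae F, forall u, Q u} ->
  exists2 u, x < u & Q u.
Proof.
move=> [N [mN N0 HN]]; apply: contrapT => H.
have : F `]x, +oo[%classic = 0%E.
  apply: subset_measure0 mN _ N0; first exact: measurable_itv.
  move=> u /=; rewrite in_itv/= andbT => xu; apply: HN => Qu; apply: H.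
  by exists u.
have := F_gt0 x; rewrite /tail /ccdf -/F => /[swap] ->.
by rewrite ltxx.
Qed.

(* [psi] is a bounded substitute for [theta * phi2]. If [theta * phi1] takes both
   signs on the support of [X], the positivity of the density bounds
   [theta * phi2] on the support of [Y]; otherwise [theta * phi1], which has mean
   zero, vanishes almost everywhere and [psi = 0] will do. *)
Lemma sarmanov_density : exists (psi : R -> R) (K : R), [/\
  measurable_fun setT psi /\ (forall v, `|psi v| <= K),
  {ae G, forall v, theta * d1 * phi2 v = d1 * psi v},
  {ae G, forall v, 0 <= 1 + d1 * psi v} &
  {ae (F \x G)%E, forall z, theta * phi1 z.1 * phi2 z.2 = phi1 z.1 * psi z.2}].
Proof.
have [[m1 m2] _ [[i1 E1] _] pos _] := sarm.
have suppG := ae_support G; have suppF := ae_support F.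
have near_d1 (Q : R -> Prop) : {ae F, forall u, Q u} ->
   forall e : R, 0 < e -> exists2 u, Q u & `|d1 - phi1 u| < e.
  move=> HQ e e0; have /cvgrPdist_lt/(_ _ e0)[x [_ Hx]] := phi1_lim.
  by have [u xu Qu] := ae_unbounded x HQ; exists u => //; exact: Hx.
have prod_ae (Q : R -> Prop) : {ae F, forall u, Q u} ->
    {ae (F \x G)%E, forall z : R * R, Q z.1}.
  move=> [N [mN N0 HN]]; exists (N `*` setT); split.
  - exact: measurableX.
  - transitivity (F N * G setT)%E; first exact: product_measure1E.
    by rewrite N0 mul0e.
  - by move=> z /= nQ; split => //; exact: HN.
have prod_ae2 (Q : R -> Prop) : {ae G, forall u, Q u} ->
    {ae (F \x G)%E, forall z : R * R, Q z.2}.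
  move=> [N [mN N0 HN]]; exists (setT `*` N); split.
  - exact: measurableX.
  - transitivity (F setT * G N)%E; first exact: product_measure1E.
    by rewrite N0 mule0.
  - by move=> z /= nQ; split => //; exact: HN.
have [[[x1 s1 p1] [x2 s2 p2]]|] := pselect ((exists2 x, Defs.support F x & 0 < theta * phi1 x) /\
    (exists2 x, Defs.support F x & theta * phi1 x < 0)).
  pose c1 := theta * phi1 x1; pose c2 := - (theta * phi1 x2).
  have c10 : 0 < c1 by []. have c20 : 0 < c2 by rewrite oppr_gt0.
  (* Positivity of the density at [x1] and at [x2] reads [1 + c1 * phi2 v >= 0] and
     [1 - c2 * phi2 v >= 0], hence [- 1 / c1 <= phi2 v <= 1 / c2]. *)
  pose B := c1^-1 + c2^-1.
  have bnd v : Defs.support G v -> `|theta * phi2 v| <= `|theta| * B.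
    move=> sv; rewrite normrM ler_wpM2l// ler_norml.
    have h1 := pos x1 v s1 sv; have h2 := pos x2 v s2 sv.
    have h1' : - c1^-1 <= phi2 v.
      by rewrite -(ler_pM2l c10) mulrN divff ?gt_eqF//; rewrite /c1; lra.
    have h2' : phi2 v <= c2^-1.
      by rewrite -(ler_pM2l c20) divff ?gt_eqF//; rewrite /c2; lra.
    have i10 : 0 < c1^-1 by rewrite invr_gt0.
    have i20 : 0 < c2^-1 by rewrite invr_gt0.
    by rewrite /B; apply/andP; split; lra.
  set K := `|theta| * B in bnd.
  have K0 : 0 <= K.
    by rewrite mulr_ge0// addr_ge0// invr_ge0 ltW.
  (* Truncation bounds [psi] everywhere and changes nothing on the support of [Y]. *)
  pose psi v := Num.max (- K) (Num.min K (theta * phi2 v)).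
  have psiE v : Defs.support G v -> psi v = theta * phi2 v.
    move=> /bnd; rewrite ler_norml => /andP[h1 h2].
    by rewrite /psi (min_idPr h2) (max_idPr h1).
  exists psi, K; split.
  - split; last first.
      move=> v; rewrite ler_norml /psi le_max lexx/= ge_max ge_min lexx/= andbT.
      by rewrite (le_trans _ K0)// oppr_le0.
    by apply: measurable_maxr => //; apply: measurable_minr => //; exact: measurable_funM.
  - by apply: filterS suppG => v /psiE ->; ring.
  - apply: filterS suppG => v sv; rewrite psiE//; apply: contrapT => /negP.
    rewrite -ltNge => neg.
    (* If [1 + d1 * psi v] were negative, a point [u] of the support of [X] with [phi1 u] within [e]
       of [d1] would make the density itself negative at [(u, v)]. *)
    pose e := - (1 + d1 * (theta * phi2 v)) / (1 + `|theta * phi2 v|).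
    have t1 : 0 < 1 + `|theta * phi2 v| by rewrite ltr_pwDl.
    have e0 : 0 < e by rewrite divr_gt0// oppr_gt0.
    have [u su ue] := near_d1 _ suppF e e0.
    have := pos u v su sv; apply/negP; rewrite -ltNge.
    have : (phi1 u - d1) * (theta * phi2 v) < - (1 + d1 * (theta * phi2 v)).
      apply: le_lt_trans (ler_norm _) _; rewrite normrM distrC.
      apply: (@le_lt_trans _ _ (`|d1 - phi1 u| * (1 + `|theta * phi2 v|))).
        by rewrite ler_wpM2l// lerDr.
      by rewrite -ltr_pdivlMr.
    by lra.
  - apply: filterS (prod_ae2 _ suppG) => z /psiE ->; ring.
move=> /not_andP nsign.
have ifF : F.-integrable setT (EFin \o phi1).
  by apply: integrable_pushforward => //; exact/measurable_EFinP.
have F0 : (\int[F]_u (theta * phi1 u)%:E = 0)%E.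
  have -> : (\int[F]_u (theta * phi1 u)%:E = theta%:E * \int[F]_u (phi1 u)%:E)%E.
    by rewrite -integralZl.
  rewrite integral_distribution//; last exact/measurable_EFinP.
  by move: E1; rewrite unlock => ->; rewrite mule0.
have mt : measurable_fun setT (EFin \o (fun u => theta * phi1 u)).
  by apply/measurable_EFinP; exact: measurable_funM.
have sign : {ae F, forall u, 0 <= theta * phi1 u} \/
    {ae F, forall u, theta * phi1 u <= 0}.
  case: nsign => H; [right|left]; apply: filterS suppF => u su;
    rewrite leNgt; apply/negP => hu; apply: H; by exists u.
have zero : {ae F, forall u, theta * phi1 u = 0}.
  pose f u := theta * phi1 u.
  have abs0 : (\int[F]_(u in setT) `|(EFin \o f) u| = 0)%E.
    case: sign => sg.
      rewrite -F0; apply: ae_eq_integral => //; first exact: measurableT_comp.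
      by apply: filterS sg => u su _; rewrite /= ger0_norm.
    transitivity ((-1)%:E * \int[F]_u (f u)%:E)%E; last by rewrite F0 mule0.
    have ift : F.-integrable setT (EFin \o f) := integrableZl measurableT theta ifF.
    rewrite -integralZl//; apply: ae_eq_integral => //.
    - exact: measurableT_comp.
    - by apply: emeasurable_funM => //; exact: measurable_cst.
    - by apply: filterS sg => u su _; rewrite /= ler0_norm// mulN1e.
  have /(ae_eq_integral_abs F measurableT mt) := abs0.
  by apply: filterS => u /(_ Logic.I)[].
(* For [theta] nonzero, [phi1] vanishes at points arbitrarily far out, so its limit is [0]. *)
have td0 : theta * d1 = 0.
  have [->|t0] := eqVneq theta 0; first by rewrite mul0r.
  rewrite (_ : d1 = 0) ?mulr0//; apply/eqP; rewrite -normr_le0.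
  apply/ler_addgt0Pl => e e0; rewrite addr0.
  have [u fu0 ue] := near_d1 _ zero e e0.
  have p0 : phi1 u = 0.
    by apply/eqP; move/eqP : fu0; rewrite mulf_eq0 (negbTE t0).
  by rewrite p0 subr0 in ue; exact: ltW.
exists (fun=> 0), 0; split.
- by split; [exact: measurable_cst|move=> v; rewrite normr0].
- by apply/aeW => v; rewrite td0 mul0r mulr0.
- by apply/aeW => v; rewrite mulr0 addr0.
- by apply: filterS (prod_ae _ zero) => z ->; rewrite mul0r mulr0.
Qed.

End sarmanov_density.

(** * Separating the limit [d1] from the kernel [phi1] *)

Section sarmanov_tail.
Context d {T : measurableType d} {R : realType}.
Variables (P : probability T R) (X Y : {mfun T >-> R})
  (phi1 phi2 : R -> R) (theta d1 : R).
Hypotheses (sarm : sarmanov P X Y phi1 phi2 theta)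
  (phi1_lim : phi1 @ +oo --> d1).
Let F := distribution P X.
Let G := distribution P Y.
Variables (psi : R -> R) (K : R).
Hypotheses (mpsi : measurable_fun setT psi) (psiK : forall v, `|psi v| <= K)
  (psi_dens : {ae (F \x G)%E, forall z, theta * phi1 z.1 * phi2 z.2 = phi1 z.1 * psi z.2}).

Let m1 : measurable_fun setT phi1. Proof. by case: sarm => -[]. Qed.
Let m2 : measurable_fun setT phi2. Proof. by case: sarm => -[]. Qed.

Let iphi1 : F.-integrable setT (EFin \o phi1).
Proof.
case: sarm => _ _ [[i _] _] _ _.
by apply: integrable_pushforward => //; exact/measurable_EFinP.
Qed.

Lemma integrable_centered : F.-integrable setT (fun u => (phi1 u - d1)%:E).
Proof.
have i0 : F.-integrable setT (EFin \o cst d1) by exact: finite_measure_integrable_cst.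
exact: (integrableB measurableT iphi1 i0).
Qed.

Lemma indic_le1 d' (S : measurableType d') (A : set S) s : `|(\1_A s : R)| <= 1.
Proof. by rewrite indicE; case: (s \in A); rewrite ?normr1 ?normr0. Qed.

Lemma measurable_section (A : set (R * R)) v : measurable A ->
  measurable_fun setT (fun u => \1_A (u, v) : R).
Proof.
move=> mA; have mI : measurable_fun setT (\1_A : R * R -> R) by exact: measurable_indic.
by apply: (measurableT_comp mI).
Qed.

(** The density [1 + phi1 u * psi v] is split as [(1 + d1 * psi v) + psi v * (phi1 u - d1)]: a
    limiting density in [v] alone, and a correction that is small for large [u]. *)
Lemma sarmanov_event (A : set (R * R)) : measurable A ->
  fine (P (rvpair X Y @^-1` A)) =
  \int[G]_v (\int[F]_u \1_A (u, v) * (1 + d1 * psi v) +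
             psi v * \int[F]_u (\1_A (u, v) * (phi1 u - d1))).
Proof.
move=> mA; have [_ _ _ _ ->] := sarm => //.
pose h (z : R * R) : R := \1_A z * (1 + phi1 z.1 * psi z.2).
have mI : measurable_fun setT (\1_A : R * R -> R) by exact: measurable_indic.
have mp1 : measurable_fun setT (fun z : R * R => phi1 z.1) by exact: measurableT_comp.
have mp2 : measurable_fun setT (fun z : R * R => phi2 z.2) by exact: measurableT_comp.
have mps : measurable_fun setT (fun z : R * R => psi z.2) by exact: measurableT_comp.
have md : measurable_fun setT (fun z : R * R => 1 + phi1 z.1 * psi z.2).
  by apply: measurable_funD => //; exact: measurable_funM.
have md2 : measurable_fun setT (fun z : R * R => 1 + theta * phi1 z.1 * phi2 z.2).
  by apply: measurable_funD => //; apply: measurable_funM => //; exact: measurable_funM.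
have mh : measurable_fun setT h by exact: measurable_funM.
have K0 : 0 <= K := le_trans (normr_ge0 _) (psiK 0).
have i1 : F.-integrable setT (EFin \o (fun u => 1 + `|phi1 u| * K)).
  have i0 : F.-integrable setT (EFin \o cst (1 : R)) by exact: finite_measure_integrable_cst.
  exact: (integrableD measurableT i0 (integrableZr measurableT K (integrable_norm iphi1))).
have i0 : G.-integrable setT (EFin \o cst (1 : R)) by exact: finite_measure_integrable_cst.
have ih : (F \x G)%E.-integrable setT (EFin \o h).
  apply: (@integrable_prod_bound _ _ _ _ _ F G h _ _ mh i1 i0) => z.
  rewrite normr1 mulr1 [leRHS]ger0_norm; last by rewrite addr_ge0// mulr_ge0.
  rewrite /h normrM -[leRHS]mul1r; apply: ler_pM => //; first exact: indic_le1.
  apply: le_trans (ler_normD _ _) _; rewrite normr1 lerD2l normrM.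
  by rewrite ler_wpM2l.
transitivity (fine (\int[(F \x G)%E]_z (EFin \o h) z)).
  congr fine.
  rewrite integral_mkcond; apply: ae_eq_integral => //.
  - by apply/(measurable_restrictT _ mA); apply: measurable_funTS; exact/measurable_EFinP.
  - exact/measurable_EFinP.
  - apply: filterS psi_dens => z ze _; rewrite patchE /h /= indicE.
    by case: ifPn => _; rewrite ?mul1r ?mul0r// ze.
rewrite -integral21_prod_meas1// /fubini_G /Rintegral; congr fine.
apply: eq_integral => v _.
have iIA : F.-integrable setT (EFin \o (fun u => \1_A (u, v) : R)).
  apply: (ae_le_integrable (g := cst 1)) => //.
  - exact: measurable_section.
  - exact: finite_measure_integrable_cst.
  - by apply/aeW => u; exact: indic_le1.
have iIA2 : F.-integrable setT (EFin \o (fun u => \1_A (u, v) * (phi1 u - d1))).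
  rewrite (_ : _ \o _ = (fun u => ((phi1 u - d1) * \1_A (u, v))%:E)); last first.
    by apply/funext => u; rewrite /= mulrC.
  apply: (@integrable_bounded_factor _ _ _ F _ (fun u => \1_A (u, v)) 1 integrable_centered).
    exact: measurable_section.
  by move=> u; exact: indic_le1.
rewrite -(fineK (_ : \int[F]_x (EFin \o h) (x, v) \is a fin_num)%E).
  congr EFin.
  transitivity (\int[F]_u (\1_A (u, v) * (1 + d1 * psi v) +
     psi v * (\1_A (u, v) * (phi1 u - d1)))).
    by rewrite /Rintegral; congr fine; apply: eq_integral => u _; rewrite /h /=; congr EFin; ring.
  rewrite RintegralD//.
  - by rewrite RintegralZr// RintegralZl.
  - exact: (integrableZr measurableT _ iIA).
  - exact: (integrableZl measurableT _ iIA2).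
have -> : (fun x => (EFin \o h) (x, v)) = (fun u => (\1_A (u, v) * (1 + d1 * psi v))%:E +
     (psi v * (\1_A (u, v) * (phi1 u - d1)))%:E)%E.
  by apply/funext => u; rewrite /h /= -EFinD; congr EFin; ring.
apply: integrable_fin_num => //; apply: integrableD => //.
- exact: (integrableZr measurableT _ iIA).
- exact: (integrableZl measurableT _ iIA2).
Qed.

(** The error made by replacing [phi1] by its limit on the event [X > z]: bounded in general, and
    negligible with respect to the tail of [X] at infinity. *)
Definition excess (z : R) := \int[F]_u (\1_(`]z, +oo[%classic) u * (phi1 u - d1)).

Lemma integrable_excess z :
  F.-integrable setT (EFin \o (fun u => \1_(`]z, +oo[%classic) u * (phi1 u - d1))).
Proof.
rewrite (_ : _ \o _ = (fun u => ((phi1 u - d1) * \1_(`]z, +oo[%classic) u)%:E)); last first.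
  by apply/funext => u; rewrite /= mulrC.
have mz : measurable (`]z, +oo[%classic : set R) by exact: measurable_itv.
apply: (@integrable_bounded_factor _ _ _ F _ (\1_(`]z, +oo[%classic)) 1 integrable_centered).
  exact: measurable_indic.
by move=> u; exact: indic_le1.
Qed.

Lemma tail_RintegralE z : tail P X z = \int[F]_u \1_(`]z, +oo[%classic) u.
Proof.
have mz : measurable (`]z, +oo[%classic : set R) by exact: measurable_itv.
rewrite /Rintegral integral_indic//.
by rewrite setIT.
Qed.

Lemma integrable_indic_ray z : F.-integrable setT (EFin \o (\1_(`]z, +oo[%classic) : R -> R)).
Proof.
have mz : measurable (`]z, +oo[%classic : set R) by exact: measurable_itv.
exact: integrable_indic.
Qed.

Lemma excess_le : exists2 C, 0 <= C & forall z, `|excess z| <= C.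
Proof.
exists (\int[F]_u `|phi1 u - d1|); first exact: Rintegral_ge0.
move=> z; apply: le_trans (le_normr_Rintegral measurableT (integrable_excess z)) _.
apply: le_Rintegral => //.
- exact: (integrable_norm (integrable_excess z)).
- exact: (integrable_norm integrable_centered).
- move=> u _; rewrite normrM ler_piMl//; exact: indic_le1.
Qed.

Lemma excess_small e : 0 < e -> exists z0, forall z, z0 <= z ->
  `|excess z| <= e * tail P X z.
Proof.
move=> e0; have /cvgrPdist_lt/(_ _ e0)[z0 [_ Hz]] := phi1_lim.
exists z0 => z zz; apply: le_trans (le_normr_Rintegral measurableT (integrable_excess z)) _.
rewrite tail_RintegralE -RintegralZl//; last exact: integrable_indic_ray.
apply: le_Rintegral => //.
- exact: (integrable_norm (integrable_excess z)).
- exact: (integrableZl measurableT _ (integrable_indic_ray z)).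
- move=> u _; rewrite indicE; case: (boolP (u \in _)); last by rewrite mul0r normr0 mulr0.
  rewrite inE/= in_itv/= andbT => zu; rewrite mul1r mulr1 distrC ltW//.
  by apply: Hz; exact: le_lt_trans zz zu.
Qed.

End sarmanov_tail.

Section tail_bounds.
Context d {T : measurableType d} {R : realType}.
Variable P : probability T R.

Lemma distribution_ae (Y : {mfun T >-> R}) (D : set R) : measurable D ->
  {ae P, forall w, D (Y w)} -> {ae distribution P Y, forall v, D v}.
Proof.
move=> mD YD; apply/negligibleP; first exact: measurableC.
have mYD : measurable (Y @^-1` ~` D) by apply: measurable_funPTI; exact: measurableC.
exact/(negligibleP _ mYD).
Qed.

Lemma distribution_ge0 (Y : {mfun T >-> R}) :
  {ae P, forall w, 0 <= Y w} -> {ae distribution P Y, forall v, 0 <= v}.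
Proof.
move=> Y0; have : {ae distribution P Y, forall v, `[0, +oo[%classic v}.
  apply: distribution_ae; first exact: measurable_itv.
  by apply: filterS Y0 => w Yw; rewrite /= in_itv/= andbT.
by apply: filterS => v /=; rewrite in_itv/= andbT.
Qed.

Lemma dominated_bound (X : {mfun T >-> R}) y : dominatedly_varying P X ->
  0 < y < 1 -> exists C x0, forall x, x0 <= x -> tail P X (x * y) <= C * tail P X x.
Proof.
move=> [F0 /[apply]] /ereal_inf_lt[_ [V [x1 [_ Vx1]] <-] Voo].
pose s := ereal_sup [set (tail P X (x * y) / tail P X x)%:E | x in V].
exists (fine s), (x1 + 1) => x xx.
have Vx : V x by apply: Vx1; rewrite (lt_le_trans _ xx)// ltrDl.
have ub : ((tail P X (x * y) / tail P X x)%:E <= s)%E.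
  by apply: ereal_sup_ubound; exists x.
rewrite -ler_pdivrMr// -lee_fin fineK//.
by rewrite fin_real// Voo andbT (lt_le_trans _ ub)// ltNyr.
Qed.

End tail_bounds.

(** * The tail of the product [X * Y] *)

Section sarmanov_product.
Context d {T : measurableType d} {R : realType}.
Variables (P : probability T R) (X Y : {mfun T >-> R})
  (phi1 phi2 : R -> R) (theta d1 : R).
Hypotheses (sarm : sarmanov P X Y phi1 phi2 theta)
  (phi1_lim : phi1 @ +oo --> d1).
Let F := distribution P X.
Let G := distribution P Y.
Variables (psi : R -> R) (K : R).
Hypotheses (mpsi : measurable_fun setT psi) (psiK : forall v, `|psi v| <= K)
  (psi_ge0 : {ae G, forall v, 0 <= 1 + d1 * psi v})
  (psi_dens : {ae (F \x G)%E, forall z, theta * phi1 z.1 * phi2 z.2 = phi1 z.1 * psi z.2}).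
Let H := tail P (X * Y).
Let u v := 1 + d1 * psi v.
Let e := excess P X phi1 d1.

Let K0 : 0 <= K. Proof. exact: le_trans (normr_ge0 _) (psiK 0). Qed.

Let mu_ : measurable_fun setT u.
Proof. by apply: measurable_funD => //; exact: measurable_funM. Qed.

Lemma density_le v : `|u v| <= 1 + `|d1| * K.
Proof.
by apply: le_trans (ler_normD _ _) _; rewrite normr1 lerD2l normrM ler_wpM2l.
Qed.

Lemma integrable_bounded (f : R -> R) (C : R) : measurable_fun setT f ->
  (forall v, `|f v| <= C) -> G.-integrable setT (EFin \o f).
Proof.
move=> mf fC; apply: (ae_le_integrable (g := cst C)) => //.
- exact: finite_measure_integrable_cst.
- exact/aeW.
Qed.

Let mI z : measurable_fun setT (\1_(`]z, +oo[%classic) : R -> R).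
Proof.
have mz : measurable (`]z, +oo[%classic : set R) by exact: measurable_itv.
exact: measurable_indic.
Qed.

Lemma indic_rayE (z v : R) : \1_(`]z, +oo[%classic) v = (z < v)%R%:R :> R.
Proof.
by rewrite indicE; congr (_%:R); congr nat_of_bool; apply/idP/idP;
  rewrite inE/= in_itv/= andbT.
Qed.

Let Iu z v := \1_(`]z, +oo[%classic) v * u v.

Let iIu z : G.-integrable setT (EFin \o Iu z).
Proof.
apply: (@integrable_bounded _ (1 * (1 + `|d1| * K))).
  exact: measurable_funM.
by move=> v; rewrite normrM; apply: ler_pM => //; [exact: indic_le1|exact: density_le].
Qed.

(** Since [u >= 0] almost everywhere, vanishing of its integrals over the rays from [1 / (k + 2)]
    would force [u = 0] almost everywhere on the positive axis. The bound [z < 1] puts [z] in the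
    range where dominated variation applies. *)
Lemma density_mass : ~ {ae G, forall v, 0 < v -> u v = 0} ->
  exists2 z : R, 0 < z < 1 & 0 < \int[G]_v Iu z v.
Proof.
move=> nu0; apply: contrapT => Hz; apply: nu0.
pose z k : R := k.+2%:R^-1.
have z01 k : 0 < z k < 1.
  by rewrite invr_gt0 ltr0n/= invf_lt1 ?ltr0n// ltr1n.
have zero k : {ae G, forall v, Iu (z k) v = 0}.
  have Iu0 : {ae G, forall v, 0 <= Iu (z k) v}.
    by apply: filterS psi_ge0 => v uv; rewrite /Iu indic_rayE mulr_ge0.
  have I0 : (\int[G]_v (Iu (z k) v)%:E <= 0)%E.
    have : \int[G]_v Iu (z k) v <= 0.
      by rewrite leNgt; apply/negP => h; apply: Hz; exists (z k).
    by rewrite /Rintegral -lee_fin fineK//; apply: integrable_fin_num => //; exact: iIu.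
  have mIu : measurable_fun setT (EFin \o Iu (z k)).
    by apply/measurable_EFinP; exact: measurable_funM.
  have abs0 : (\int[G]_(v in setT) `|(EFin \o Iu (z k)) v| = 0)%E.
    apply/eqP; rewrite eq_le integral_ge0// andbT; apply: le_trans I0.
    rewrite le_eqVlt; apply/orP; left; apply/eqP; apply: ae_eq_integral => //.
      exact: measurableT_comp.
    by apply: filterS Iu0 => v v0 _; rewrite /= ger0_norm.
  have /(ae_eq_integral_abs G measurableT mIu) := abs0.
  by apply: filterS => v /(_ Logic.I)[].
have /ae_foralln : forall k, {ae G, forall v, Iu (z k) v = 0} by exact: zero.
apply: filterS => v Hv v0.
pose k := Num.trunc (v^-1).
have := Hv k; rewrite /Iu indic_rayE.
suff -> : z k < v by rewrite mul1r.
rewrite /z -[ltRHS]invrK ltf_pV2 ?posrE ?invr_gt0 ?ltr0n//.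
have : v^-1 < k.+1%:R by apply: Num.Theory.truncnS_gt.
by move/lt_trans; apply; rewrite ltr_nat.
Qed.

(** The left side is the probability of the rectangle [X > x / z], [Y > z], on which [X * Y > x]. *)
Lemma product_tail_ge z x : 0 < z -> 0 <= x ->
  tail P X (x / z) * \int[G]_v Iu z v +
  e (x / z) * \int[G]_v (\1_(`]z, +oo[%classic) v * psi v) <= H x.
Proof.
move=> z0 x0; pose A : set (R * R) := `]x / z, +oo[%classic `*` `]z, +oo[%classic.
have mA : measurable A by apply: measurableX; exact: measurable_itv.
have IA a b : \1_A (a, b) = \1_(`]x / z, +oo[%classic) a * \1_(`]z, +oo[%classic) b :> R.
  by rewrite /A !indicE in_setX/= -natrM mulnb.
have iIp : G.-integrable setT (EFin \o (fun v => \1_(`]z, +oo[%classic) v * psi v)).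
  apply: (@integrable_bounded _ (1 * K)); first exact: measurable_funM.
  by move=> v; rewrite normrM; apply: ler_pM => //; exact: indic_le1.
have <- : fine (P (rvpair X Y @^-1` A)) = tail P X (x / z) * \int[G]_v Iu z v +
  e (x / z) * \int[G]_v (\1_(`]z, +oo[%classic) v * psi v).
  rewrite (sarmanov_event d1 sarm mpsi psiK psi_dens mA).
  rewrite -(RintegralZl _ measurableT (iIu z)) -(RintegralZl _ measurableT iIp).
  rewrite -(RintegralD measurableT).
  - apply: eq_Rintegral => v _; rewrite tail_RintegralE /e /excess /Iu /u -/F.
    have -> : \int[F]_s \1_A (s, v) =
        \int[F]_s \1_(`]x / z, +oo[%classic) s * \1_(`]z, +oo[%classic) v.
      rewrite -RintegralZr//; last exact: integrable_indic_ray.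
      by apply: eq_Rintegral => s _; rewrite IA.
    have -> : \int[F]_s (\1_A (s, v) * (phi1 s - d1)) = \1_(`]z, +oo[%classic) v *
        \int[F]_s (\1_(`]x / z, +oo[%classic) s * (phi1 s - d1)).
      rewrite -RintegralZl//; last exact: (integrable_excess d1 sarm).
      by apply: eq_Rintegral => s _; rewrite IA; ring.
    by ring.
  - exact: (integrableZl measurableT _ (iIu z)).
  - exact: (integrableZl measurableT _ iIp).
rewrite -lee_fin /H tailE fineK; last first.
  apply: fin_num_measure; rewrite -[X in measurable X]setTI.
  exact: measurable_rvpair.
rewrite le_measure ?inE//.
- by rewrite -[X in measurable X]setTI; exact: measurable_rvpair.
- exact: measurable_gt.
move=> w [] /=; rewrite !in_itv/= !andbT => xX zY.
have X0 : 0 < X w by apply: le_lt_trans xX; rewrite divr_ge0// ltW.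
by apply: (@lt_trans _ _ (X w * z)); [rewrite -ltr_pdivrMr|rewrite ltr_pM2l].
Qed.


Hypotheses (F_dom : dominatedly_varying P X)
  (nondeg : ~ {ae G, forall v, 0 < v -> u v = 0}).

(** For large [x], [product_tail_ge] bounds [H x] below by a multiple of the tail of [X] at [x / z],
    the excess being negligible, and dominated variation compares that tail with the one at [x]. *)
Lemma tail_le_product_tail :
  (forall x, 0 < H x) /\ exists2 C : R, 0 < C & forall x, 0 < x -> tail P X x <= C * H x.
Proof.
have F0 := F_dom.1.
have [z /andP[z0 z1]] := density_mass nondeg.
set m := \int[G]_v Iu z v => m0.
pose m2 := \int[G]_v (\1_(`]z, +oo[%classic) v * psi v).
(* Small enough for the excess term to consume at most half of the main coefficient [m]. *)
pose t := m / (2 * (1 + `|m2|)).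
have m20 : 0 < 1 + `|m2| by rewrite ltr_pwDl.
have t0 : 0 < t by rewrite divr_gt0// mulr_gt0.
have tm : t * `|m2| <= m / 2.
  apply: (@le_trans _ _ (t * (1 + `|m2|))); first by rewrite ler_wpM2l ?lerDr// ltW.
  by rewrite le_eqVlt /t; apply/orP; left; apply/eqP; field; rewrite gt_eqF.
have [s0 Hs] := excess_small sarm phi1_lim t0.
have [|C1 [s1 HD]] := dominated_bound (y := z) F_dom; first by rewrite z0 z1.
pose s2 := Num.max 1 (Num.max s0 s1).
have s20 : 0 < s2 by rewrite lt_max ltr01.
have low x : s2 <= x -> tail P X x <= 2 * (1 + `|C1|) / m * H x.
  move=> sx; have x0 : 0 < x := lt_le_trans s20 sx.
  have xz : x <= x / z by rewrite ler_pdivlMr// ler_piMr// ltW.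
  move: sx; rewrite !ge_max => /and3P[_ s0x s1x].
  have h1 := product_tail_ge z0 (ltW x0).
  rewrite -/m -/m2 in h1.
  have h2 : `|e (x / z)| <= t * tail P X (x / z) by apply: Hs; exact: le_trans s0x xz.
  have h3 : tail P X x <= C1 * tail P X (x / z).
    by have := HD (x / z) (le_trans s1x xz); rewrite divfK// gt_eqF.
  have tz0 : 0 < tail P X (x / z) := F0 _.
  have h4 : - (m / 2 * tail P X (x / z)) <= e (x / z) * m2.
    rewrite lerNl; apply: le_trans (ler_norm _) _; rewrite normrN normrM.
    apply: (@le_trans _ _ (t * tail P X (x / z) * `|m2|)); first by rewrite ler_wpM2r.
    by rewrite mulrAC ler_wpM2r// ltW.
  have h5 : m / 2 * tail P X (x / z) <= H x by lra.
  have h6 : tail P X (x / z) <= 2 / m * H x.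
    have -> : tail P X (x / z) = 2 / m * (m / 2 * tail P X (x / z)).
      by field; rewrite gt_eqF.
    by rewrite ler_wpM2l// divr_ge0// ltW.
  apply: le_trans h3 _; apply: (@le_trans _ _ ((1 + `|C1|) * tail P X (x / z))).
    by rewrite ler_wpM2r ?(ltW tz0)// (le_trans (ler_norm _))// lerDr.
  have -> : 2 * (1 + `|C1|) / m * H x = (1 + `|C1|) * (2 / m * H x) by ring.
  by rewrite ler_wpM2l// addr_ge0.
have c0 : 0 < 2 * (1 + `|C1|) / m by rewrite divr_gt0// mulr_gt0// ltr_pwDl.
have H0 x : 0 < H x.
  have Hm : 0 < H (Num.max s2 x).
    by rewrite -(pmulr_rgt0 _ c0); apply: lt_le_trans (F0 _) (low _ _); rewrite le_max lexx.
  by apply: lt_le_trans Hm _; apply: tail_nincr; rewrite le_max lexx orbT.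
(* The second summand serves [x < s2], where the tail of [X] is at most [1] and [H x >= H s2]. *)
split=> //; exists (2 * (1 + `|C1|) / m + (H s2)^-1).
  by rewrite addr_gt0// invr_gt0.
move=> x x0; rewrite mulrDl; have [sx|xs] := leP s2 x.
  by rewrite (le_trans (low _ sx))// lerDl mulr_ge0 ?tail_ge0// invr_ge0 ltW.
apply: (@le_trans _ _ 1); first exact: tail_le1.
apply: (@le_trans _ _ ((H s2)^-1 * H x)); last first.
  by rewrite lerDr mulr_ge0 ?tail_ge0// ltW.
by rewrite mulrC ler_pdivlMr// mul1r; apply: tail_nincr; exact: ltW.
Qed.

Let H_gt0 : forall x, 0 < H x. Proof. by case: tail_le_product_tail. Qed.

Hypothesis H_int : (\int[G]_(v in `]0%R, +oo[)
  tail_ratio_sup P (X * Y)%R v < +oo)%E.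

Let D : set R := `]0, +oo[%classic.
Let mD : measurable D. Proof. exact: measurable_itv. Qed.

Let DE v : D v <-> 0 < v. Proof. by rewrite /D /= in_itv/= andbT. Qed.

Lemma measurable_comp_divr (f : R -> R) x : measurable_fun setT f ->
  measurable_fun D (fun v => f (x / v)).
Proof.
move=> mf; apply: (eq_measurable_fun (fun v => f (x * v `^ (- 1)))).
  by move=> v; rewrite inE => /DE v0; rewrite powR_inv1// ltW.
apply: measurable_funTS; apply: (measurableT_comp mf).
apply: measurable_funM => //; exact: measurable_powR.
Qed.

Lemma integrable_boundedD (f : R -> R) (C : R) : measurable_fun D f ->
  (forall v, `|f v| <= C) -> G.-integrable D (EFin \o f).
Proof.
move=> mf fC; apply: (@le_integrable _ _ _ G D mD _ (EFin \o cst C)).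
- exact/measurable_EFinP.
- by move=> v _; rewrite /= lee_fin (le_trans (fC v))// ler_norm.
- exact: finite_measure_integrable_cst.
Qed.

Let iH x : G.-integrable D (EFin \o (fun v => H (x / v))).
Proof.
apply: (@integrable_boundedD _ 1);
  first exact: (measurable_comp_divr x (@measurable_tail _ _ _ P (X * Y))).
by move=> v; rewrite ger0_norm ?tail_ge0 ?tail_le1.
Qed.

Lemma integral_tail_div x : 0 < x ->
  \int[G]_(v in D) H (x / v) <=
  fine (\int[G]_(v in D) tail_ratio_sup P (X * Y)%R v)%E * H x.
Proof.
move=> x0.
have RE v : D v -> tail_ratio_sup P (X * Y)%R v = ratio_sup P (X * Y)%R v.
  by move=> /DE v0; rewrite /ratio_sup v0.
have mR : measurable_fun D (tail_ratio_sup P (X * Y)%R).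
  apply: (eq_measurable_fun (ratio_sup P (X * Y)%R)).
    by move=> v; rewrite inE => /RE.
  by apply: measurable_funTS; exact: measurable_ratio_sup.
rewrite -ler_pdivrMr//.
have -> : (\int[G]_(v in D) H (x / v)) / H x = \int[G]_(v in D) (H (x / v) / H x).
  by rewrite (RintegralZr _ mD (iH x)).
apply: fine_le.
- by apply: integrable_fin_num => //; exact: (integrableZr mD _ (iH x)).
- rewrite ge0_fin_numE// integral_ge0// => v Dv.
  by rewrite RE// ratio_sup_ge0.
- apply: ge0_le_integral => //.
  + by move=> v _; rewrite lee_fin divr_ge0 ?tail_ge0.
  + apply/measurable_EFinP; apply: measurable_funM => //.
    exact: (measurable_comp_divr x (@measurable_tail _ _ _ P (X * Y))).
  + by move=> v Dv; rewrite RE//; apply: ratio_supP => //; exact/DE.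
Qed.

(** The excess need not be monotone, since [phi1 - d1] may change sign; writing [c] as
    [(c + |c|) - |c|] makes it a difference of two nonincreasing functions. *)
Lemma measurable_excess : measurable_fun setT e.
Proof.
pose c s := phi1 s - d1.
have ic : F.-integrable setT (EFin \o c) := integrable_centered d1 sarm.
have m1 : measurable_fun setT c by apply/measurable_EFinP; case/integrableP : ic.
have inc z : F.-integrable setT
    (EFin \o (fun s : R => \1_(`]z, +oo[%classic) s * `|c s|)).
  apply: (ae_le_integrable (g := fun s => `|c s|)).
  - by apply: measurable_funM => //; exact: measurableT_comp.
  - exact: (integrable_norm ic).
  - apply/aeW => s; rewrite normrM normr_id ler_piMl//; exact: indic_le1.
have mono (g : R -> R) : (forall s, 0 <= g s) ->
    (forall z : R, F.-integrable setT
      (EFin \o (fun s : R => \1_(`]z, +oo[%classic) s * g s))) ->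
    measurable_fun setT (fun z : R => \int[F]_s (\1_(`]z, +oo[%classic) s * g s)).
  move=> g0 ig; apply: nonincreasing_measurable => // a b ab.
  apply: le_Rintegral => // s _; rewrite ler_wpM2r// !indic_rayE ler_nat.
  by case: (ltP b s) => // bs; rewrite (le_lt_trans ab bs).
rewrite (_ : e = (fun z : R => \int[F]_s (\1_(`]z, +oo[%classic) s * (c s + `|c s|)) -
   \int[F]_s (\1_(`]z, +oo[%classic) s * `|c s|))); last first.
  apply/funext => z; rewrite -[e z](addrK (\int[F]_s (\1_(`]z, +oo[%classic) s * `|c s|))).
  congr (_ - _); rewrite /e /excess -(RintegralD measurableT (integrable_excess d1 sarm z) (inc z)).
  by apply: eq_Rintegral => s _; rewrite -mulrDr.
apply: measurable_funB; last exact: mono.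
apply: mono => [s|z]; first by have := ler_norm (- c s); rewrite normrN; lra.
rewrite (_ : _ \o _ = (EFin \o (fun s : R => \1_(`]z, +oo[%classic) s * (phi1 s - d1))) \+
  (EFin \o (fun s : R => \1_(`]z, +oo[%classic) s * `|c s|))).
  exact: (integrableD measurableT (integrable_excess d1 sarm z) (inc z)).
by apply/funext => s; rewrite /= -EFinD mulrDr.
Qed.

Let iF x : G.-integrable D (EFin \o (fun v => u v * tail P X (x / v))).
Proof.
apply: (@integrable_boundedD _ ((1 + `|d1| * K) * 1)).
  apply: measurable_funM; first exact: measurable_funTS.
  exact: (measurable_comp_divr x (@measurable_tail _ _ _ P X)).
move=> v; rewrite normrM; apply: ler_pM => //; first exact: density_le.
by rewrite ger0_norm ?tail_ge0 ?tail_le1.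
Qed.

Let ie x : G.-integrable D (EFin \o (fun v => psi v * e (x / v))).
Proof.
have [C C0 eC] := excess_le d1 sarm.
apply: (@integrable_boundedD _ (K * C)).
  apply: measurable_funM; first exact: measurable_funTS.
  exact: (measurable_comp_divr x measurable_excess).
by move=> v; rewrite normrM ler_pM.
Qed.

(** Since [x > 0] and [Y >= 0] almost surely, the event [X * Y > x] forces [Y > 0], so integrating
    over [D] loses nothing and the division by [v] is legitimate. *)
Lemma product_tailE x : 0 < x -> H x =
  \int[G]_(v in D) (u v * tail P X (x / v)) + \int[G]_(v in D) (psi v * e (x / v)).
Proof.
move=> x0.
pose A : set (R * R) := (setT `*` D) `&` ((fun p => p.1 * p.2) @^-1` `]x, +oo[%classic).
have mA : measurable A.
  apply: measurableI; first exact: measurableX.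
  by rewrite -[X in measurable X]setTI; apply: measurable_funM => //; exact: measurable_itv.
have mYA : measurable (rvpair X Y @^-1` A).
  by rewrite -[X in measurable X]setTI; exact: measurable_rvpair.
have -> : H x = fine (P (rvpair X Y @^-1` A)).
  rewrite -[LHS]/(fine (H x)%:E) /H tailE; congr fine.
  have [_ [N [mN N0 HN]] _ _ _] := sarm.
  apply/eqP; rewrite eq_le; apply/andP; split.
    rewrite -[leRHS]adde0 -N0; apply: le_trans (measureU2 P mYA mN).
    rewrite le_measure ?inE//; [exact: measurable_gt|exact: measurableU|].
    move=> w /= xw; have [Yw|Yw] := pselect (0 <= Y w); last by right; exact: HN.
    left; rewrite /rvpair /=; split; last by rewrite /= in_itv/= andbT.
    split=> //; apply/DE; rewrite lt_neqAle Yw andbT; apply/eqP => /= Y0.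
    by have : x < X w * Y w := xw; rewrite -Y0 mulr0 ltNge (ltW x0).
  rewrite le_measure ?inE//; first exact: measurable_gt.
  by move=> w [_] /=; rewrite in_itv/= andbT.
rewrite (sarmanov_event d1 sarm mpsi psiK psi_dens mA).
rewrite -(RintegralD mD (iF x) (ie x)) [RHS]Rintegral_mkcond.
apply: eq_Rintegral => v _; rewrite patchE; case: ifPn => [|vD].
  rewrite inE => /DE v0.
  have IA s : \1_A (s, v) = \1_(`]x / v, +oo[%classic) s :> R.
    rewrite indic_rayE indicE; congr (_%:R); congr nat_of_bool.
    rewrite ltr_pdivrMr//; apply/idP/idP.
      by rewrite inE => -[_] /=; rewrite in_itv/= andbT.
    by move=> xs; rewrite inE; split; [split => //; exact/DE|rewrite /= in_itv/= andbT].
  rewrite tail_RintegralE /e /excess /u -/F mulrC; congr (_ * _ + _ * _).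
    by apply: eq_Rintegral => s _; rewrite IA.
  by apply: eq_Rintegral => s _; rewrite IA.
have IA s : \1_A (s, v) = 0 :> R.
  rewrite indicE memNset// => -[[_ /= vD']] _.
  by move/negP : vD; apply; rewrite inE.
rewrite (_ : (fun s => \1_A (s, v)) = cst (0 : R)); last by apply/funext => s; exact: IA.
rewrite (_ : (fun s => \1_A (s, v) * _) = cst (0 : R)); last first.
  by apply/funext => s; rewrite IA mul0r.
by rewrite Rintegral_cst// !mul0r mulr0 addr0.
Qed.

Hypothesis G_o_F : (fun x => tail P Y x / tail P X x) @ +oo --> (0 : R).

(** The integral is split according to [x / v]. Where [x / v >= z0] the excess is a small multiple
    of the tail of [X], hence of [H (x / v)], whose integral is [O(H x)]. Elsewhere the excess is
    merely bounded, but [Y > x / z0], an event negligible against [H x] because the tail of [Y] is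
    [o] of that of [X]. *)
Lemma excess_term_small :
  (\int[G]_(v in D) (psi v * e (x / v))) / H x @[x --> +oo] --> 0.
Proof.
have F0 := F_dom.1.
have [_ [C C0 FC]] := tail_le_product_tail.
have [Ce Ce0 eC] := excess_le d1 sarm.
set kap := fine (\int[G]_(v in D) tail_ratio_sup P (X * Y)%R v)%E.
have Hkap := integral_tail_div; rewrite -/kap in Hkap.
have bound (t : R) : 0 < t -> exists2 z0, 1 < z0 & forall x, 0 < x ->
    `|\int[G]_(v in D) (psi v * e (x / v))| <=
    K * t * C * (kap * H x) + K * Ce * tail P Y (x / z0).
  move=> t0; have [s0 Hs] := excess_small sarm phi1_lim t0.
  pose z0 := Num.max 2 s0; have z01 : 1 < z0 by rewrite lt_max ltr1n.
  have z00 : 0 < z0 := lt_trans ltr01 z01.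
  exists z0 => // x x0.
  apply: le_trans (le_normr_Rintegral mD (ie x)) _.
  have i1 := integrableZl mD (K * t * C) (iH x).
  have iI : G.-integrable D (EFin \o (\1_(`]x / z0, +oo[%classic) : R -> R)).
    apply: (@integrable_boundedD _ 1); first by apply: measurable_funTS; exact: mI.
    by move=> v; exact: indic_le1.
  have i2 := integrableZl mD (K * Ce) iI.
  apply: (@le_trans _ _ (\int[G]_(v in D) (K * t * C * H (x / v) +
      K * Ce * \1_(`]x / z0, +oo[%classic) v))).
    apply: le_Rintegral => //.
    - exact: (integrable_norm (ie x)).
    - exact: (integrableD mD i1 i2).
    - move=> v /DE v0; rewrite normrM.
      have xv0 : 0 < x / v by rewrite divr_gt0.
      rewrite -!mulrA -mulrDr; apply: ler_pM => //.
      rewrite indic_rayE ltr_pdivrMr//.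
      have [z0x|xz] := leP z0 (x / v).
        apply: (@le_trans _ _ (t * (C * H (x / v)))); last by rewrite lerDl mulr_ge0.
        apply: le_trans (Hs _ _) _; first by apply: le_trans z0x; rewrite le_max lexx orbT.
        by rewrite ler_pM2l// FC.
      rewrite (_ : x < v * z0); last by rewrite mulrC -ltr_pdivrMr.
      rewrite mulr1; apply: le_trans (eC _) _.
      by rewrite lerDr mulr_ge0 ?(ltW t0)// mulr_ge0 ?(ltW C0)// tail_ge0.
  rewrite (RintegralD mD i1 i2) (RintegralZl _ mD (iH x)) (RintegralZl _ mD iI).
  apply: lerD; first by rewrite ler_wpM2l ?Hkap// !mulr_ge0// ltW.
  rewrite ler_wpM2l ?mulr_ge0//.
  have mz : measurable (`]x / z0, +oo[%classic : set R) by exact: measurable_itv.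
  rewrite /Rintegral integral_indic//; apply: fine_le.
  - by apply: fin_num_measure; exact: measurableI.
  - exact: fin_num_measure.
  - by rewrite le_measure ?inE//; exact: measurableI.
have small (z0 : R) : 1 < z0 -> tail P Y (x / z0) / H x @[x --> +oo] --> 0.
  move=> z1; have z00 : 0 < z0 := lt_trans ltr01 z1.
  have [|C1 [s1 HD]] := dominated_bound (y := z0^-1) F_dom.
    by rewrite invr_gt0 z00 invf_lt1.
  have L0 : x / z0 @[x --> +oo] --> (+oo : set_system R).
    by apply: gt0_cvgMly; [rewrite invr_gt0|exact: cvg_id].
  have L1 := cvg_comp _ _ L0 G_o_F.
  have L2 : C1 * C * (tail P Y (x / z0) / tail P X (x / z0)) @[x --> +oo] --> C1 * C * 0.
    by apply: cvgM L1; exact: cvg_cst.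
  rewrite mulr0 in L2.
  apply: squeeze_cvgr (cvg_cst 0) L2.
  near=> x; have x0 : 0 < x by [].
  rewrite divr_ge0 ?tail_ge0//=.
  have Fz := F0 (x / z0); have Hx := H_gt0 x.
  have h1 : tail P X (x / z0) <= C1 * tail P X x
    by apply: HD; near: x; apply: nbhs_pinfty_ge; rewrite num_real.
  have C10 : 0 < C1 by rewrite -(pmulr_lgt0 _ (F0 x)); exact: lt_le_trans h1.
  have h2 : tail P X (x / z0) <= C1 * C * H x.
    by apply: le_trans h1 _; rewrite -mulrA ler_pM2l// FC.
  have -> : C1 * C * (tail P Y (x / z0) / tail P X (x / z0)) =
      tail P Y (x / z0) * (C1 * C / tail P X (x / z0)) by ring.
  by rewrite ler_wpM2l ?tail_ge0// ler_pdivlMr// mulrC ler_pdivrMr.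
have kap0 : 0 <= kap.
  have := Hkap 1 ltr01; have : 0 <= \int[G]_(v in D) H (1 / v).
    by apply: Rintegral_ge0 => v _; exact: tail_ge0.
  by move=> /le_trans /[apply]; rewrite pmulr_lge0.
apply/cvgr0Pnorm_le => t t0.
(* The relative size of the excess for which the first part uses only half of [t]. *)
pose s := t / (2 * (1 + K * C * kap)).
have q0 : 0 < 1 + K * C * kap.
  by rewrite ltr_pwDl// !mulr_ge0// ltW.
have s0 : 0 < s by rewrite divr_gt0// mulr_gt0.
have [z0 z01 Hb] := bound s s0.
have L : K * Ce * (tail P Y (x / z0) / H x) @[x --> +oo] --> K * Ce * 0.
  by apply: cvgM (small _ z01); exact: cvg_cst.
rewrite mulr0 in L; have t20 : 0 < t / 2 by rewrite divr_gt0.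
have /cvgr0Pnorm_le/(_ _ t20) Lt := L.
near=> x; have x0 : 0 < x by [].
have Hx := H_gt0 x.
have h1 : `|K * Ce * (tail P Y (x / z0) / H x)| <= t / 2 by near: x.
rewrite normrM normfV (gtr0_norm Hx) ler_pdivrMr//.
apply: le_trans (Hb x x0) _.
have h2 : K * Ce * tail P Y (x / z0) <= t / 2 * H x.
  have -> : K * Ce * tail P Y (x / z0) = K * Ce * (tail P Y (x / z0) / H x) * H x.
    by field; rewrite gt_eqF.
  by rewrite ler_pM2r// (le_trans (ler_norm _)).
have h3 : K * s * C * (kap * H x) <= t / 2 * H x.
  rewrite mulrA ler_pM2r//.
  have -> : t / 2 = s * (1 + K * C * kap) by rewrite /s; field; rewrite gt_eqF.
  have -> : K * s * C * kap = s * (K * C * kap) by ring.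
  by rewrite ler_pM2l// lerDr.
lra.
Unshelve. all: end_near. Qed.

Lemma product_tail_equiv :
  (\int[G]_(v in D) (u v * tail P X (x / v))) / H x @[x --> +oo] --> (1 : R).
Proof.
have L : 1 - (\int[G]_(v in D) (psi v * e (x / v))) / H x @[x --> +oo] --> (1 - 0 : R).
  by apply: cvgB excess_term_small; exact: cvg_cst.
rewrite subr0 in L; apply: cvg_trans L; apply: near_eq_cvg.
near=> x; have x0 : 0 < x by [].
rewrite /= -[X in X - _](divff (x := H x)) ?gt_eqF// -mulrBl; congr (_ / _).
by rewrite (product_tailE x0) addrK.
Unshelve. all: end_near. Qed.

End sarmanov_product.

(** * Sums of laws as a single finite measure *)

Section law_sum.
Context d {T : measurableType d} {R : realType}.
Variables (P : probability T R) (Z : nat -> {mfun T >-> R}) (n : nat).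

(** Adding the laws turns a sum of expectations into one integral, so that [inverse_breiman] applies
    to the sum over the terms of [S_n]. *)
Definition law_sum : set R -> \bar R := msum (fun k => distribution P (Z k)) n.

HB.instance Definition _ := Measure.on law_sum.

Let law_sum_finite : fin_num_fun law_sum.
Proof.
by move=> A mA; apply/sum_fin_numP => k _ _; exact: fin_num_measure.
Qed.

HB.instance Definition _ := Measure_isFinite.Build _ _ _ law_sum law_sum_finite.

Lemma ge0_integral_law_sum (g : R -> \bar R) : measurable_fun setT g ->
  (forall v, 0 <= g v)%E ->
  (\int[law_sum]_v g v = \sum_(k < n) \int[P]_w g (Z k w))%E.
Proof.
move=> mg g0.
transitivity (\sum_(k < n) \int[distribution P (Z k)]_v g v)%E.
  exact: (@ge0_integral_measure_sum _ _ _ (fun k => distribution P (Z k))).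
by apply: eq_bigr => k _; exact: ge0_integral_distribution.
Qed.

Lemma integrable_law_sum (g : R -> \bar R) : measurable_fun setT g ->
  (forall k, P.-integrable setT (g \o Z k)) -> law_sum.-integrable setT g.
Proof.
move=> mg ig; apply/integrableP; split=> //.
rewrite ge0_integral_law_sum//; last exact: measurableT_comp.
by rewrite lte_sum_pinfty// => k _; case/integrableP : (ig k).
Qed.

Lemma Rintegral_law_sum (g : R -> R) : measurable_fun setT g ->
  (forall k, P.-integrable setT (fun w => (g (Z k w))%:E)) ->
  \int[law_sum]_v g v = \sum_(k < n) \int[P]_w g (Z k w).
Proof.
move=> mg ig.
have mgE : measurable_fun setT (EFin \o g) by exact/measurable_EFinP.
have split (nu : {measure set R -> \bar R}) : nu.-integrable setT (EFin \o g) ->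
   \int[nu]_v g v = fine (\int[nu]_v ((EFin \o g)^\+)%E v)%E -
     fine (\int[nu]_v ((EFin \o g)^\-)%E v)%E.
  move=> i; rewrite /Rintegral integralE fineB//.
  - exact: integrable_pos_fin_num.
  - exact: integrable_neg_fin_num.
rewrite split; last exact: integrable_law_sum.
rewrite !ge0_integral_law_sum//; [|exact: measurable_funeneg|exact: measurable_funepos].
have ipos k : P.-integrable setT ((EFin \o g \o Z k)^\+)%E
  by apply: integrable_funepos => //; exact: ig.
have ineg k : P.-integrable setT ((EFin \o g \o Z k)^\-)%E
  by apply: integrable_funeneg => //; exact: ig.
have iposZ k : P.-integrable setT (((EFin \o g)^\+)%E \o Z k) by rewrite -funepos_comp.
have inegZ k : P.-integrable setT (((EFin \o g)^\-)%E \o Z k) by rewrite -funeneg_comp.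
rewrite -!sum_fine.
- rewrite -sumrB; apply: eq_bigr => k _.
  rewrite [RHS]/Rintegral [X in _ = fine X]integralE [RHS]fineB//.
  + by congr (fine _ - fine _); apply: eq_integral => w _; rewrite ?funeposE ?funenegE.
  + by apply: integrable_fin_num => //; exact: ipos.
  + by apply: integrable_fin_num => //; exact: ineg.
- by move=> k _; apply: integrable_fin_num => //; exact: (inegZ k).
- by move=> k _; apply: integrable_fin_num => //; exact: (iposZ k).
Qed.

Lemma law_sum_ae (D : set R) : measurable D ->
  (forall k, {ae P, forall w, D (Z k w)}) -> {ae law_sum, forall v, D v}.
Proof.
move=> mD ZD; apply/negligibleP; first exact: measurableC.
rewrite [LHS]big1// => k _.
by apply/negligibleP; [exact: measurableC|exact: distribution_ae].
Qed.

End law_sum.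

(** * Regular variation of tails *)

Section regular_variation.
Context d {T : measurableType d} {R : realType}.
Variable P : probability T R.
Implicit Types (V X Y : {mfun T >-> R}) (alpha : R).

Lemma Rintegral_distribution V (g : R -> R) : measurable_fun setT g ->
  P.-integrable setT (fun w => (g (V w))%:E) ->
  \int[distribution P V]_v g v = \int[P]_w g (V w).
Proof.
move=> mg ig; congr fine; apply: (@integral_distribution _ _ _ _ _ _ _ (EFin \o g)) => //.
exact/measurable_EFinP.
Qed.

Lemma integrable_distribution V (g : R -> \bar R) : measurable_fun setT g ->
  P.-integrable setT (g \o V) -> (distribution P V).-integrable setT g.
Proof. by move=> mg ig; apply: integrable_pushforward. Qed.

Lemma regularly_varyingP V alpha : regularly_varying P alpha V ->
  (forall x, 0 < tail P V x) /\
  (forall y, 0 < y -> tail P V (x * y) / tail P V x @[x --> +oo] --> y `^ (- alpha)).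
Proof.
(* Scale [1] already forces positivity: a zero of the tail would give the ratio the value [0]
   arbitrarily far out, while its limit is [1]. *)
move=> RV; have V0 x : 0 < tail P V x.
  have := RV 1 ltr01 => /cvgrPdist_lt/(_ _ ltr01)[x0 [_ Hx]].
  pose z := Num.max x (x0 + 1).
  have /Hx : x0 < z by rewrite lt_max ltrDl ltr01 orbT.
  have : tail P V z <= tail P V x by apply: tail_nincr; rewrite le_max lexx.
  rewrite le_eqVlt => /predU1P[<-|h _]; last exact: le_lt_trans (tail_ge0 _ _ _) h.
  rewrite mulr1 => h; rewrite lt_neqAle tail_ge0 andbT; apply/eqP => z0.
  by move: h; rewrite -z0 mul0r subr0 normr1 ltxx.
split=> // y y0.
have L : y `^ (- alpha) * (tail P V (x * y) / (y `^ (- alpha) * tail P V x)) @[x --> +oo]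
    --> y `^ (- alpha) * 1.
  by apply: cvgM; [exact: cvg_cst|exact: RV].
rewrite mulr1 in L; apply: cvg_trans L; apply: near_eq_cvg; apply: nearW => x.
by field; rewrite !gt_eqF ?powR_gt0.
Qed.

Lemma regularly_varying_equiv V X alpha (c : R) : c != 0 ->
  (forall x, 0 < tail P X x) -> regularly_varying P alpha V ->
  tail P X x / tail P V x @[x --> +oo] --> c -> regularly_varying P alpha X.
Proof.
move=> c0 X0 /regularly_varyingP[V0 RV] L y y0.
have xy : x * y @[x --> +oo] --> (+oo : set_system R).
  by apply: gt0_cvgMly => //; exact: cvg_id.
have L1 := cvg_comp _ _ xy L.
have ya : y `^ (- alpha) != 0 by rewrite gt_eqF// powR_gt0.
have L2 : (tail P X (x * y) / tail P V (x * y)) * (tail P V (x * y) / tail P V x) *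
   (tail P X x / tail P V x)^-1 * (y `^ (- alpha))^-1 @[x --> +oo] -->
   c * y `^ (- alpha) * c^-1 * (y `^ (- alpha))^-1.
  apply: cvgM; last exact: cvg_cst.
  by apply: cvgM; [apply: cvgM; [exact: L1|exact: RV]|exact: cvgV].
have E : c * y `^ (- alpha) * c^-1 * (y `^ (- alpha))^-1 = 1 by field; rewrite c0 ya.
rewrite E in L2; apply: cvg_trans L2; apply: near_eq_cvg; apply: nearW => x /=.
by field; rewrite ya !gt_eqF.
Qed.

Lemma same_law_tail X Y X' Y' : same_law P (rvpair X' Y') (rvpair X Y) ->
  tail P X' = tail P X.
Proof.
move=> XY; apply/funext => x; apply/eqP; rewrite -eqe !tailE; apply/eqP.
have mA : measurable [set p : R * R | x < p.1].
  rewrite -[X in measurable X]setTI.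
  rewrite (_ : [set p | _] = fst @^-1` `]x, +oo[%classic).
    exact: measurable_fst.
  by apply/seteqP; split => p /=; rewrite in_itv/= andbT.
exact: XY mA.
Qed.

End regular_variation.

Lemma sum_Complex {R : realType} n (a b : nat -> R) :
  \sum_(k < n) Complex (a k) (b k) = Complex (\sum_(k < n) a k) (\sum_(k < n) b k).
Proof. by elim/big_rec3: _ => // k x y z _ ->. Qed.

Lemma Complex_neq0 {R : realType} (a b : R) :
  Complex a b != 0 -> a ^+ 2 + b ^+ 2 != 0.
Proof.
apply: contraNneq => /eqP; rewrite paddr_eq0 ?sqr_ge0// !sqrf_eq0.
by move=> /andP[/eqP-> /eqP->].
Qed.

Lemma powR_le1D {R : realType} (v a b : R) : 0 <= a -> a <= b -> v `^ a <= 1 + v `^ b.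
Proof.
move=> a0 ab; have [v1|v1] := leP 1 v.
  by apply: le_trans (ler_powR v1 ab) _; rewrite lerDr.
apply: (@le_trans _ _ 1); last by rewrite lerDl powR_ge0.
have [v0|v0] := ltP 0 v; last first.
  rewrite /powR; case: ifPn => _; first by case: (a == 0).
  by rewrite ln0// mulr0 expR0.
by rewrite -(powRr0 v); apply: ger_powR => //; rewrite v0 ltW.
Qed.

(** * First inversion: from the sum to the product [X * Y] *)

Section inversion.
Context d {T : measurableType d} {R : realType}.
Variables (P : probability T R) (X Y : {mfun T >-> R})
  (Xs Ys : nat -> {mfun T >-> R}) (n : nat) (alpha eps : R).
Hypotheses (indep : mutually_independent P (fun i => rvpair (Xs i) (Ys i)))
  (ident : forall i, same_law P (rvpair (Xs i) (Ys i)) (rvpair X Y))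
  (X_ge0 : {ae P, forall w, 0 <= X w}) (Y_ge0 : {ae P, forall w, 0 <= Y w})
  (alpha_gt0 : 0 < alpha) (eps_gt0 : 0 < eps) (n_ge1 : (1 <= n)%N).
Let H := tail P (X * Y).
Let M := tail P (weighted_sum Xs Ys n).
Let G := distribution P Y.
Let D : set R := `]0, +oo[%classic.
Let mD : measurable D. Proof. exact: measurable_itv. Qed.

Let DE v : (v \in D) = (0 < v).
Proof. by apply/idP/idP; rewrite inE /D /= in_itv/= andbT. Qed.

Hypotheses (H_gt0 : forall x, 0 < H x)
  (Sn_RV : regularly_varying P alpha (weighted_sum Xs Ys n))
  (H_int : (\int[G]_(v in D) tail_ratio_sup P (X * Y)%R v < +oo)%E)
  (moment : P.-integrable setT (fun w => (Y w `^ (alpha + eps))%:E)).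

Let M_gt0 : forall x, 0 < M x. Proof. by case: (regularly_varyingP Sn_RV). Qed.

Let M_RV y : 0 < y -> M (x * y) / M x @[x --> +oo] --> y `^ (- alpha).
Proof. by case: (regularly_varyingP Sn_RV) => _; exact. Qed.

Lemma integrable_powR_alpha : P.-integrable setT (fun w => (Y w `^ alpha)%:E).
Proof.
have i1 : P.-integrable setT (EFin \o cst (1 : R)) by exact: finite_measure_integrable_cst.
apply: (ae_le_integrable (g := fun w => 1 + Y w `^ (alpha + eps))).
- by apply: (measurableT_comp (measurable_powR alpha)).
- exact: (integrableD measurableT i1 moment).
- apply/aeW => w; rewrite ger0_norm ?powR_ge0//.
  by apply: powR_le1D; [exact: ltW|rewrite lerDl ltW].
Qed.

Let iY := integrable_powR_alpha.

Let mK : measurable_fun setT (ratio_sup P (X * Y)%R).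
Proof. exact: measurable_ratio_sup. Qed.

Lemma integral_ratio_sup_lty : (\int[P]_w ratio_sup P (X * Y)%R (Y w) < +oo)%E.
Proof.
have K0 v : (0 <= ratio_sup P (X * Y)%R v)%E by exact: ratio_sup_ge0.
have <- : (\int[G]_v ratio_sup P (X * Y)%R v = \int[P]_w ratio_sup P (X * Y)%R (Y w))%E.
  exact: ge0_integral_distribution.
apply: le_lt_trans H_int; rewrite [leRHS]integral_mkcond le_eqVlt.
apply/orP; left; apply/eqP; apply: eq_integral => v _.
by rewrite patchE /ratio_sup DE.
Qed.

Let KY := integral_ratio_sup_lty.

Definition prodM k : {mfun T >-> R} := \prod_(j < k) Ys j.

Lemma prodME k w : prodM k w = prodY Ys k w.
Proof. by rewrite /prodM /prodY; elim/big_rec2: _ => //= j y ? _ <-. Qed.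

Let nu : {finite_measure set R -> \bar R} := law_sum P prodM n.

Let w1 := mellin_weight (fun=> 1) alpha.

Let weightE (g : R -> R) : measurable_fun setT g -> (forall v, `|g v| <= 1) ->
  \int[nu]_v (w1 v * g v) =
  \sum_(k < n) \int[P]_w (prodY Ys k w `^ alpha * g (prodY Ys k w)).
Proof.
move=> mg g1; have mw : measurable_fun setT (fun v => w1 v * g v).
  by apply: measurable_funM => //; apply: measurable_funM => //; exact: measurable_powR.
rewrite Rintegral_law_sum//.
  apply: eq_bigr => k _; apply: eq_Rintegral => w _.
  by rewrite /w1 /mellin_weight mul1r prodME.
move=> k; apply: (ae_le_integrable (g := fun w => prodY Ys k w `^ alpha)).
- exact: (measurableT_comp mw).
- exact: (integrable_prodY_powR indep ident Y_ge0 k iY).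
- apply/aeW => w; rewrite /w1 /mellin_weight prodME mul1r normrM.
  by rewrite ger0_norm ?powR_ge0// ler_piMr ?powR_ge0.
Qed.

Lemma sum_mellin_prodY b :
  Complex (cosT nu (@ln R) w1 b) (sinT nu (@ln R) w1 b) =
  \sum_(k < n) Complex (\int[P]_w (Y w `^ alpha * cos (b * ln (Y w))))
                       (\int[P]_w (Y w `^ alpha * sin (b * ln (Y w)))) ^+ k.
Proof.
rewrite /cosT /sinT (weightE (measurable_cosM (@measurable_ln R) b) (fun v => cos_max _)).
rewrite (weightE (measurable_sinM (@measurable_ln R) b) (fun v => sin_max _)) -(sum_Complex n
  (fun k => \int[P]_w (prodY Ys k w `^ alpha * cos (b * ln (prodY Ys k w))))
  (fun k => \int[P]_w (prodY Ys k w `^ alpha * sin (b * ln (prodY Ys k w))))).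
by apply: eq_bigr => k _; exact: (mellin_prodY indep ident Y_ge0 alpha_gt0).
Qed.

Hypothesis neq2 : forall b,
  \sum_(k < n) Complex (\int[P]_w (Y w `^ alpha * cos (b * ln (Y w))))
                       (\int[P]_w (Y w `^ alpha * sin (b * ln (Y w)))) ^+ k != 0.

Let EY := \int[P]_w (Y w `^ alpha).

Let nu_weight : \int[nu]_v w1 v = \sum_(k < n) EY ^+ k.
Proof.
have := sum_mellin_prodY 0.
have -> : cosT nu (@ln R) w1 0 = \int[nu]_v w1 v.
  by apply: eq_Rintegral => v _; rewrite mul0r cos0 mulr1.
have -> : \int[P]_w (Y w `^ alpha * cos (0 * ln (Y w))) = EY.
  by apply: eq_Rintegral => v _; rewrite mul0r cos0 mulr1.
have -> : \int[P]_w (Y w `^ alpha * sin (0 * ln (Y w))) = 0.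
  rewrite (_ : (fun w => _) = cst (0 : R)) ?Rintegral_cst ?mul0r//.
  by apply/funext => w; rewrite mul0r sin0 mulr0.
rewrite -/(EY%:C%C).
under eq_bigr do rewrite -rmorphXn.
by rewrite -rmorph_sum => -[].
Qed.

(** This is [inverse_breiman] for the summed laws of the products [prodM k], with [u = 1] and
    [B = H]. The Mellin transform is the sum of the powers of that of [Y], and its value at
    frequency [0] gives the constant. *)
Lemma product_tail_over_sum_tail :
  H x / M x @[x --> +oo] --> (\sum_(k < n) EY ^+ k)^-1.
Proof.
have HM x : 0 < x -> H x <= M x by exact: product_tail_le.
have iK : nu.-integrable setT (ratio_sup P (X * Y)%R).
  apply: integrable_law_sum => // k.
  have := integrable_ratio_sup indep ident Y_ge0 H_gt0 KY k.
  by under eq_fun do rewrite -prodME.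
rewrite -nu_weight -div1r.
apply: (@inverse_breiman R nu (fun=> 1) alpha eps 1 _ _ alpha_gt0 eps_gt0 _ _ _
  M H 1 1 1 (fun v => fine (ratio_sup P (X * Y)%R v))) => //.
- by move=> v; rewrite normr1.
- have : {ae nu, forall v, `[0, +oo[%classic v}.
    apply: law_sum_ae => [|k]; first exact: measurable_itv.
    by apply: filterS (prodY_ge0 ident Y_ge0) => w Hw; rewrite /= in_itv/= andbT prodME.
  by apply: filterS => v /=; rewrite in_itv/= andbT.
- apply: integrable_law_sum.
  + by apply/measurable_EFinP; exact: measurable_powR.
  + move=> k; have := integrable_prodY_powR indep ident Y_ge0 k moment.
    by under eq_fun do rewrite -prodME.
- move=> b; apply: Complex_neq0; rewrite sum_mellin_prodY; exact: neq2.
- by move=> x y; exact: tail_nincr.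
- by move=> x y; exact: tail_nincr.
- by move=> x; exact: tail_ge0.
- by move=> x x0; rewrite mul1r HM.
- apply: le_integrable iK => //.
    by apply/measurable_EFinP; exact: measurableT_comp.
  move=> v _ /=; case: (ratio_sup _ _ _) => //=; by rewrite normr0 leey.
- have := integrable_ae measurableT iK.
  apply: filterS => v /(_ Logic.I) Kv x v0 x1.
  have x0 : 0 < x := lt_le_trans ltr01 x1.
  apply: (@le_trans _ _ (H (x / v) / H x)).
    by rewrite ler_wpM2l ?tail_ge0// lef_pV2 ?posrE// HM.
  by rewrite -lee_fin fineK//; apply: ratio_supP.
- have := sum_terms_equiv indep ident X_ge0 Y_ge0 H_gt0 KY n_ge1 M_gt0 M_RV.
  apply: cvg_trans; apply: near_eq_cvg; near=> x; have x0 : 0 < x by [].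
  congr (_ / _); rewrite Rintegral_mkcond.
  have E v : ((fun v => 1 * H (x / v)) \_ D) v = scaled_tail P X Y x v.
    by rewrite patchE DE mul1r.
  rewrite (_ : _ \_ _ = scaled_tail P X Y x); last by apply/funext => v; exact: E.
  rewrite Rintegral_law_sum.
  + by apply: eq_bigr => k _; apply: eq_Rintegral => w _; rewrite prodME.
  + exact: measurable_scaled_tail.
  + move=> k; apply: (ae_le_integrable (g := cst 1)).
    * exact: (measurableT_comp (measurable_scaled_tail P X Y x0)).
    * exact: finite_measure_integrable_cst.
    * by apply/aeW => w; rewrite ger0_norm ?scaled_tail_ge0 ?scaled_tail_le1.
Unshelve. all: end_near. Qed.

End inversion.

Lemma ae_distribution d (T : measurableType d) (R : realType) (P : probability T R)
    (Y : {mfun T >-> R}) (Q : R -> Prop) :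
  {ae distribution P Y, forall v, Q v} -> {ae P, forall w, Q (Y w)}.
Proof.
move=> [N [mN N0 HN]]; exists (Y @^-1` N); split; [exact: measurable_funPTI|exact: N0|].
by move=> w; exact: HN.
Qed.

(** * Second inversion: from the product to [X] *)

Section sarmanov_inversion.
Context d {T : measurableType d} {R : realType}.
Variables (P : probability T R) (X Y : {mfun T >-> R})
  (Xs Ys : nat -> {mfun T >-> R}) (phi1 phi2 : R -> R) (theta d1 : R)
  (n : nat) (alpha eps : R).
Hypotheses (indep : mutually_independent P (fun i => rvpair (Xs i) (Ys i)))
  (ident : forall i, same_law P (rvpair (Xs i) (Ys i)) (rvpair X Y))
  (sarm : sarmanov P X Y phi1 phi2 theta) (phi1_lim : phi1 @ +oo --> d1)
  (X_ge0 : {ae P, forall w, 0 <= X w})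
  (alpha_gt0 : 0 < alpha) (eps_gt0 : 0 < eps)
  (moment : P.-integrable setT (fun w => (Y w `^ (alpha + eps))%:E)).
Let F := distribution P X.
Let G := distribution P Y.
Variables (psi : R -> R) (K : R).
Hypotheses (mpsi : measurable_fun setT psi) (psiK : forall v, `|psi v| <= K)
  (psi_phi2 : {ae G, forall v, theta * d1 * phi2 v = d1 * psi v}).
Let u v := 1 + d1 * psi v.

Let Y_ge0 : {ae P, forall w, 0 <= Y w}. Proof. by case: sarm. Qed.

Let iY : P.-integrable setT (fun w => (Y w `^ alpha)%:E).
Proof. exact: integrable_powR_alpha moment. Qed.

Lemma integral_mellin_density (g : R -> R) : measurable_fun setT g ->
  (forall v, `|g v| <= 1) ->
  \int[G]_v (mellin_weight u alpha v * g v) =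
  \int[P]_w (Y w `^ alpha * g (Y w)) +
  theta * d1 * \int[P]_w (phi2 (Y w) * (Y w `^ alpha * g (Y w))).
Proof.
move=> mg g1; have m2 : measurable_fun setT phi2 by case: sarm => -[].
pose h v := v `^ alpha * g v.
have mh : measurable_fun setT h.
  by apply: measurable_funM => //; exact: measurable_powR.
have ihY : P.-integrable setT (fun w => (h (Y w))%:E).
  apply: (integrable_bounded_factor iY _ (fun w => g1 (Y w))).
  exact: measurableT_comp.
have ih : G.-integrable setT (EFin \o h).
  by apply: integrable_distribution => //; exact/measurable_EFinP.
have ipsi : G.-integrable setT (EFin \o (fun v => d1 * (h v * psi v))).
  exact: (integrableZl measurableT d1 (integrable_bounded_factor ih mpsi psiK)).
have mhpsi : measurable_fun setT (fun v => d1 * (h v * psi v)).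
  by apply: measurable_funM => //; exact: measurable_funM.
have ipsiY : P.-integrable setT (fun w => (d1 * (h (Y w) * psi (Y w)))%:E).
  apply: (integrableZl measurableT d1 (integrable_bounded_factor ihY _ (fun w => psiK (Y w)))).
  exact: measurableT_comp.
transitivity (\int[G]_v (h v + d1 * (h v * psi v))).
  by apply: eq_Rintegral => v _; rewrite /mellin_weight /u /h; ring.
rewrite (RintegralD measurableT ih ipsi); congr (_ + _).
  exact: Rintegral_distribution.
rewrite (Rintegral_distribution mhpsi ipsiY).
have aeY : {ae P, forall w, d1 * (h (Y w) * psi (Y w)) = theta * d1 * (phi2 (Y w) * h (Y w))}.
  by apply: filterS (ae_distribution psi_phi2) => w wE; rewrite mulrCA -wE; ring.
have mpY : measurable_fun setT (fun w => phi2 (Y w) * h (Y w)).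
  by apply: measurable_funM; exact: measurableT_comp.
have mtY : measurable_fun setT (fun w => theta * d1 * (phi2 (Y w) * h (Y w))).
  exact: measurable_funM.
have mhY : measurable_fun setT (fun w => d1 * (h (Y w) * psi (Y w))).
  exact: (measurableT_comp mhpsi).
rewrite (ae_eq_Rintegral mhY mtY aeY).
(* If [theta * d1] is nonzero, integrability of [phi2 (Y) * h (Y)] follows from that of the term
   with the bounded [psi], by division; if it is zero, both sides vanish. *)
have [->|td0] := eqVneq (theta * d1) 0.
  rewrite mul0r (_ : (fun w => _) = cst (0 : R)) ?Rintegral_cst ?mul0r//.
  by apply/funext => w; rewrite mul0r.
rewrite RintegralZl//; apply: (ae_le_integrable
  (g := fun w => `|(theta * d1)^-1 * (d1 * (h (Y w) * psi (Y w)))|)) => //.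
  exact: (integrable_norm (integrableZl measurableT (theta * d1)^-1 ipsiY)).
by apply: filterS aeY => w ->; rewrite mulKf.
Qed.

Hypotheses (psi_ge0 : {ae G, forall v, 0 <= 1 + d1 * psi v})
  (psi_dens : {ae (F \x G)%E, forall z, theta * phi1 z.1 * phi2 z.2 = phi1 z.1 * psi z.2}).
Hypothesis neq1 : forall b,
  cosT G (@ln R) (mellin_weight u alpha) b ^+ 2 +
  sinT G (@ln R) (mellin_weight u alpha) b ^+ 2 != 0.
Hypothesis neq2 : forall b,
  \sum_(k < n) Complex (\int[P]_w (Y w `^ alpha * cos (b * ln (Y w))))
                       (\int[P]_w (Y w `^ alpha * sin (b * ln (Y w)))) ^+ k != 0.
Hypotheses (F_dom : dominatedly_varying P X)
  (G_o_F : (fun x => tail P Y x / tail P X x) @ +oo --> (0 : R))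
  (H_int : (\int[G]_(v in `]0%R, +oo[) tail_ratio_sup P (X * Y)%R v < +oo)%E)
  (n_ge1 : (1 <= n)%N)
  (Sn_RV : regularly_varying P alpha (weighted_sum Xs Ys n)).
Let H := tail P (X * Y).
Let M := tail P (weighted_sum Xs Ys n).
Let EY := \int[P]_w (Y w `^ alpha).

Let mu_ : measurable_fun setT u.
Proof. by apply: measurable_funD => //; exact: measurable_funM. Qed.

Let G_ge0 : {ae G, forall v, 0 <= v}. Proof. exact: distribution_ge0. Qed.

Let moment_G : G.-integrable setT (fun v => (v `^ (alpha + eps))%:E).
Proof.
by apply: integrable_distribution => //; apply/measurable_EFinP; exact: measurable_powR.
Qed.

(** Otherwise the Mellin weight would vanish almost everywhere, the point [0] included since
    [alpha > 0], and so would its transform at frequency [0]. *)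
Lemma density_nondegenerate : ~ {ae G, forall v, 0 < v -> u v = 0}.
Proof.
move=> u0; have /eqP := neq1 0; apply.
have w0 : {ae G, forall v, mellin_weight u alpha v = 0}.
  apply: filterS2 u0 G_ge0 => v uv; rewrite /mellin_weight le_eqVlt.
  by move=> /predU1P[<-|/uv->]; rewrite ?mul0r// powR0 ?gt_eqF// mulr0.
have mw : measurable_fun setT (mellin_weight u alpha).
  by apply: measurable_funM => //; exact: measurable_powR.
have zero (g : R -> R) : measurable_fun setT g ->
    \int[G]_v (mellin_weight u alpha v * g v) = 0.
  move=> mg; rewrite (@ae_eq_Rintegral _ _ _ G _ (cst 0)).
  - by rewrite Rintegral_cst// mul0r.
  - exact: measurable_funM.
  - exact: measurable_cst.
  - by apply: filterS w0 => v ->; rewrite mul0r.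
rewrite /cosT /sinT !zero ?expr0n ?addr0//.
- exact: measurable_sinM.
- exact: measurable_cosM.
Qed.

Let nondeg := density_nondegenerate.

Let H_gt0 x : 0 < H x.
Proof. by have [] := tail_le_product_tail sarm phi1_lim mpsi psiK psi_ge0 psi_dens F_dom nondeg. Qed.

Lemma product_tail_ratio : H x / M x @[x --> +oo] --> (\sum_(k < n) EY ^+ k)^-1.
Proof.
exact: (product_tail_over_sum_tail indep ident X_ge0 Y_ge0 alpha_gt0 eps_gt0 n_ge1
  H_gt0 Sn_RV H_int moment neq2).
Qed.

(** [inverse_breiman] for the law of [Y], with [B] the tail of [X] and [u] the limiting density. The
    right side of its equation is the limit of [H / M] found before, and [C * ratio_sup] dominates
    since the tail of [X] is at most [C * H] and [H <= M]. *)
Lemma tail_ratio : tail P X x / M x @[x --> +oo] -->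
  (\sum_(k < n) EY ^+ k)^-1 / \int[G]_v mellin_weight u alpha v.
Proof.
have [M_gt0 M_RV] := regularly_varyingP Sn_RV.
have HM x : 0 < x -> H x <= M x by exact: product_tail_le.
have [_ [C C0 FC]] := tail_le_product_tail sarm phi1_lim mpsi psiK psi_ge0 psi_dens F_dom nondeg.
have KY := integral_ratio_sup_lty H_gt0 H_int.
have iK : G.-integrable setT (ratio_sup P (X * Y)%R).
  apply: integrable_distribution; first exact: measurable_ratio_sup.
  apply/integrableP; split.
    by apply: measurableT_comp => //; exact: measurable_ratio_sup.
  by under eq_integral do rewrite gee0_abs ?ratio_sup_ge0//.
apply: (@inverse_breiman R G u alpha eps (1 + `|d1| * K) mu_ _ alpha_gt0 eps_gt0 G_ge0
  moment_G neq1 M (tail P X) C _ 1 (fun v => C * fine (ratio_sup P (X * Y)%R v))) => //.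
- exact: density_le.
- by move=> x y; exact: tail_nincr.
- by move=> x y; exact: tail_nincr.
- by move=> x; exact: tail_ge0.
- by move=> x x0; rewrite (le_trans (FC _ x0))// ler_pM2l// HM.
- apply: (integrableZl measurableT C (f := EFin \o (fine \o ratio_sup P (X * Y)%R))).
  apply: le_integrable iK => //.
    by apply/measurable_EFinP; apply: measurableT_comp => //; exact: measurable_ratio_sup.
  by move=> v _ /=; case: (ratio_sup _ _ _) => //=; rewrite normr0 leey.
- have := integrable_ae measurableT iK.
  apply: filterS => v /(_ Logic.I) Kv x v0 x1.
  have x0 : 0 < x := lt_le_trans ltr01 x1.
  apply: (@le_trans _ _ (C * H (x / v) / H x)).
    apply: ler_pM; rewrite ?tail_ge0 ?invr_ge0 ?(ltW (M_gt0 x))//.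
      by rewrite FC// divr_gt0.
    by rewrite lef_pV2 ?posrE// HM.
  by rewrite -mulrA ler_pM2l// -lee_fin fineK//; apply: ratio_supP.
- have L1 := product_tail_equiv sarm phi1_lim mpsi psiK psi_ge0 psi_dens F_dom nondeg H_int G_o_F.
  have L2 : (\int[G]_(v in `]0, +oo[) (u v * tail P X (x / v))) / H x * (H x / M x)
      @[x --> +oo] --> 1 * (\sum_(k < n) EY ^+ k)^-1.
    exact: cvgM L1 product_tail_ratio.
  rewrite mul1r in L2; apply: cvg_trans L2; apply: near_eq_cvg; apply: nearW => x /=.
  by field; rewrite !gt_eqF.
Qed.

End sarmanov_inversion.

Theorem theorem3p3 (R : realType) (d : measure_display) (T : measurableType d)
  (P : probability T R)
  (* generic vector (X, Y) and the sequence (X_i, Y_i), indexed from 0 *)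
  (X Y : {mfun T >-> R}) (Xs Ys : nat -> {mfun T >-> R})
  (phi1 phi2 : R -> R) (theta d1 alpha : R) (n : nat)
  (indep : mutually_independent P (fun i => rvpair (Xs i) (Ys i)))
  (ident : forall i, same_law P (rvpair (Xs i) (Ys i)) (rvpair X Y))
  (sarm : sarmanov P X Y phi1 phi2 theta)
  (phi1_lim : phi1 @ +oo --> d1)
  (F_dom : dominatedly_varying P X)
  (G_o_F : (fun x => tail P Y x / tail P X x) @ +oo --> (0 : R))
  (H_int : (\int[distribution P Y]_(v in `]0%R, +oo[)
              tail_ratio_sup P (X * Y)%R v < +oo)%E)
  (X_ge0 : {ae P, forall w, 0 <= X w})
  (alpha_gt0 : 0 < alpha)
  (n_ge1 : (1 <= n)%N)
  (Sn_RV : regularly_varying P alpha (weighted_sum Xs Ys n))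
  (Y_moment : exists2 eps : R, 0 < eps &
     ('E_P[(fun w => Y w `^ (alpha + eps))%R] < +oo)%E)
  (nonzero1 : forall beta : R,
     cexpectation P (fun w => cpow (Y w) (Complex alpha beta)) +
     (theta * d1)%:C%C *
       cexpectation P (fun w =>
         (phi2 (Y w))%:C%C * cpow (Y w) (Complex alpha beta)) != 0)
  (nonzero2 : forall beta : R,
     \sum_(k < n)
       cexpectation P (fun w => cpow (Y w) (Complex alpha beta)) ^+ k != 0) :
  (forall i, regularly_varying P alpha (Xs i)) /\
  (let EY := fine 'E_P[(fun w => Y w `^ alpha)%R]%E in
   let EphiY := fine 'E_P[(fun w => phi2 (Y w) * Y w `^ alpha)%R]%E in
   asymp_equiv (tail P (weighted_sum Xs Ys n))
     (fun x => (if EY == 1 then n%:R else (1 - EY ^+ n) / (1 - EY)) *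
               (EY + theta * d1 * EphiY) * tail P X x)).
Proof.
have [_ Y_ge0 _ _ _] := sarm.
have [psi [K [[mpsi psiK] psi_phi2 psi_ge0 psi_dens]]] :=
  sarmanov_density sarm phi1_lim F_dom.1.
have [eps eps_gt0 EYeps] := Y_moment.
have moment : P.-integrable setT (fun w => (Y w `^ (alpha + eps))%:E).
  have mY : measurable_fun setT (fun w => Y w `^ (alpha + eps)).
    exact: (measurableT_comp (measurable_powR (alpha + eps))).
  apply/integrableP; split; first exact/measurable_EFinP.
  move: EYeps; rewrite unlock; under eq_integral do rewrite /= -[X in X%:E]ger0_norm ?powR_ge0//.
  by [].
pose EC b := \int[P]_w (Y w `^ alpha * cos (b * ln (Y w))).
pose ES b := \int[P]_w (Y w `^ alpha * sin (b * ln (Y w))).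
have expE b : cexpectation P (fun w => cpow (Y w) (Complex alpha b)) =
    Complex (EC b) (ES b).
  by rewrite /cexpectation unlock.
have neq2 b : \sum_(k < n) Complex (EC b) (ES b) ^+ k != 0 by rewrite -expE.
pose w1 := mellin_weight (fun v => 1 + d1 * psi v) alpha.
(* The first nonvanishing assumption, carried from [phi2] to [psi] and read on the squared
   modulus. *)
have neq1 b : cosT (distribution P Y) (@ln R) w1 b ^+ 2 +
    sinT (distribution P Y) (@ln R) w1 b ^+ 2 != 0.
  apply: Complex_neq0; rewrite /cosT /sinT.
  rewrite !(integral_mellin_density sarm alpha_gt0 eps_gt0 moment mpsi psiK psi_phi2).
  - have := nonzero1 b; rewrite expE.
    have -> : cexpectation P (fun w => (phi2 (Y w))%:C%C * cpow (Y w) (Complex alpha b)) =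
      Complex (\int[P]_w (phi2 (Y w) * (Y w `^ alpha * cos (b * ln (Y w)))))
              (\int[P]_w (phi2 (Y w) * (Y w `^ alpha * sin (b * ln (Y w))))).
      rewrite /cexpectation unlock; congr Complex; apply: eq_Rintegral => w _ /=; ring.
    rewrite (_ : Complex _ _ + _ * _ = Complex
      (EC b + theta * d1 * \int[P]_w (phi2 (Y w) * (Y w `^ alpha * cos (b * ln (Y w)))))
      (ES b + theta * d1 * \int[P]_w (phi2 (Y w) * (Y w `^ alpha * sin (b * ln (Y w))))))//.
    by apply/eqP; rewrite eq_complex /=; apply/andP; split; apply/eqP; ring.
  - exact: measurable_sinM.
  - by move=> v; exact: sin_max.
  - exact: measurable_cosM.
  - by move=> v; exact: cos_max.
have LF := tail_ratio indep ident sarm phi1_lim X_ge0 alpha_gt0 eps_gt0 moment mpsi psiK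
  psi_ge0 psi_dens neq1 neq2 F_dom G_o_F H_int n_ge1 Sn_RV.
have [M_gt0 _] := regularly_varyingP Sn_RV.
have EYE : fine 'E_P[(fun w => Y w `^ alpha)%R]%E = \int[P]_w (Y w `^ alpha).
  by rewrite unlock.
have EphiE : fine 'E_P[(fun w => phi2 (Y w) * Y w `^ alpha)%R]%E =
    \int[P]_w (phi2 (Y w) * Y w `^ alpha) by rewrite unlock.
have wE : \int[distribution P Y]_v w1 v = \int[P]_w (Y w `^ alpha) +
    theta * d1 * \int[P]_w (phi2 (Y w) * Y w `^ alpha).
  have := integral_mellin_density sarm alpha_gt0 eps_gt0 moment mpsi psiK psi_phi2
    (g := cst 1) (measurable_cst _).
  have H1 : forall v : R, `|cst (1 : R) v| <= 1 by move=> v; rewrite normr1.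
  move=> /(_ H1); under eq_Rintegral do rewrite mulr1.
  move=> ->; congr (_ + _ * _); apply: eq_Rintegral => w _; by rewrite mulr1.
rewrite EYE EphiE /=.
set EY := \int[P]_w (Y w `^ alpha) in LF wE *.
set S := \sum_(k < n) EY ^+ k in LF.
set W := EY + _ in wE *.
have S0 : S != 0.
  have EY0 : 0 <= EY by apply: Rintegral_ge0 => w _; exact: powR_ge0.
  have : 1 <= S.
    rewrite /S; case: (n) n_ge1 => // m _; rewrite big_ord_recl expr0 lerDl.
    by apply: sumr_ge0 => k _; exact: exprn_ge0.
  by move=> /(lt_le_trans ltr01) /lt0r_neq0.
(* [W] is the transform of [w1] at frequency [0], where the sine part vanishes. *)
have W0 : W != 0.
  apply: contra (neq1 0) => /eqP W0; rewrite /cosT /sinT.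
  under eq_Rintegral do rewrite mul0r cos0 mulr1.
  under [X in _ + X ^+ 2]eq_Rintegral do rewrite mul0r sin0 mulr0.
  by rewrite wE W0 Rintegral_cst// mul0r expr0n addr0.
rewrite wE in LF.
have SW0 : S^-1 / W != 0 by rewrite mulf_neq0// invr_eq0.
split=> [i|].
  rewrite /regularly_varying (same_law_tail (ident i)).
  exact: (regularly_varying_equiv SW0 F_dom.1 Sn_RV LF).
have -> : (if EY == 1 then n%:R else (1 - EY ^+ n) / (1 - EY)) = S.
  case: eqVneq => [E|E].
    by rewrite /S E; under eq_bigr do rewrite expr1n; rewrite sumr_const card_ord.
  have E1 : 1 - EY != 0 by rewrite subr_eq0 eq_sym.
  by apply: (mulIf E1); rewrite divfK// -[LHS]opprB subrX1 -/S; ring.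
have L : (S * W)^-1 * (tail P X x / tail P (weighted_sum Xs Ys n) x)^-1 @[x --> +oo]
    --> (S * W)^-1 * (S^-1 / W)^-1.
  by apply: cvgM; [exact: cvg_cst|exact: cvgV].
have E : (S * W)^-1 * (S^-1 / W)^-1 = 1 by field; rewrite S0 W0.
rewrite E in L; apply: cvg_trans L; apply: near_eq_cvg; apply: nearW => x.
have F0 := F_dom.1 x; have M0 := M_gt0 x.
by field; rewrite S0 W0 !gt_eqF.
Qed.
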